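(* There exists an arc in $\mathbb{C}^3$ that has nontrivial rational hull and is the union of two polynomially convex arcs.
   Context: An arc is a space homeomorphic to the closed unit interval. For a compact set $X\subset\mathbb{C}^N$, the polynomial hull is $\widehat X=\{z\in\mathbb{C}^N:|p(z)|\le\max_{x\in X}|p(x)|\text{ for all polynomials }p\}$ and the rational hull is $h_r(X)=\{z\in\mathbb{C}^N:p(z)\in p(X)\text{ for all polynomials }p\}$, where polynomials are in the complex coordinates. $X$ is polynomially convex if $\widehat X=X$; the rational hull of $X$ is nontrivial if $h_r(X)\setminus X\neq\emptyset$. *)

(* Defs.v *)
From HB Require Import structures.
From mathcomp Require Import all_boot all_order all_algebra.
From mathcomp Require Import all_classical all_reals topology normedtype.
From mathcomp Require Import complex.
From mathcomp Require mpoly.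

Set Implicit Arguments.
Unset Strict Implicit.
Unset Printing Implicit Defensive.

Import Order.TTheory GRing.Theory Num.Theory.
Import numFieldNormedType.Exports.

Local Open Scope classical_set_scope.
Local Open Scope ring_scope.
Local Open Scope complex_scope.

(* [mpoly] is required without being imported because its notations clash with
   those of the analysis library; [mpoly.mpoly N K] is the type of polynomials
   in N variables over K. *)

(* The topology of R[i] is the one of its modulus, as for any numFieldType; the
   library only declares it on abstract number fields and on R[i]^o. *)
#[export, non_forgetful_inheritance]
HB.instance Definition _ (R : realType) := NormedModule.copy R[i] R[i]^o.

(* Continuity is for the subspace topologies on A and B, so only the values of
   f on A and of g on B matter. *)
Definition homeomorphic (T U : topologicalType) (A : set T) (B : set U) : Prop :=
  exists (f : T -> U) (g : U -> T),
    [/\ {within A, continuous f}, {within B, continuous g},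
        set_fun A B f, set_fun B A g
      & {in A, cancel f g} /\ {in B, cancel g f}].

Section Hulls.
Variables (R : realType) (N : nat).

Definition is_arc (X : set 'rV[R[i]]_N) : Prop :=
  homeomorphic (`[0, 1] : set R) X.

Definition poly_eval (p : mpoly.mpoly N R[i]) (z : 'rV[R[i]]_N) : R[i] :=
  mpoly.meval (fun i : 'I_N => z ord0 i) p.

(* [ComplexField.Normc.normc] is the R-valued modulus.  Meant for compact X, on
   which the supremum is the maximum of |p|; since [sup set0 = 0], the hull of
   the empty set is empty. *)
Definition poly_hull (X : set 'rV[R[i]]_N) : set 'rV[R[i]]_N :=
  [set z | forall p : mpoly.mpoly N R[i],
     ComplexField.Normc.normc (poly_eval p z)
       <= sup [set ComplexField.Normc.normc (poly_eval p x) | x in X]].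

Definition rational_hull (X : set 'rV[R[i]]_N) : set 'rV[R[i]]_N :=
  [set z | forall p : mpoly.mpoly N R[i],
     (poly_eval p @` X) (poly_eval p z)].

Definition polynomially_convex (X : set 'rV[R[i]]_N) : Prop :=
  compact X /\ poly_hull X = X.

Definition nontrivial_rational_hull (X : set 'rV[R[i]]_N) : Prop :=
  rational_hull X `\` X !=set0.

End Hulls.

(* Main.v *)
Require Import Defs.
From mathcomp Require Import all_boot all_order all_algebra.
From mathcomp Require Import all_classical all_reals topology normedtype.
From mathcomp Require Import derive sequences trigo.
From mathcomp Require Import complex ring lra.
From mathcomp Require mpoly.
Import (canonicals) mpoly.

(** Let E be the planar Cantor set of the sums of rho^k d_k, with digits d_k =
+-1 +-i and rho = 4/15, and let f be the Cauchy transform of the uniform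
probability on E.  As 4 rho > 1, the functional equation f(d + rho z) = (f(z) +
a function holomorphic near E) / (4 rho) is contracting on E, so that f,
holomorphic off E, extends continuously to the plane.  All estimates are made on
the rational approximants of f, which are the means of 1/(z - c) over the 4^n
centres c of the n-th generation.

Rational hull.  Put copies of E, a translate and a reflected one, around -T and
T, with T = 100, and let F(z) = (f(z - T), f(z + T), mu z f(z - T)).  This map
is continuous on the Riemann sphere and holomorphic off the two copies.  If p is
a polynomial and p o F - p(F(0)) had no zero on the copies, then around each
pole disc the rational approximants of p o F - p(F(0)) would be close to nonzero
constants; by the argument principle each disc would contain as many zeros as
poles, and the degree would leave no zero outside of the discs, where 0 lies.
Hence every p takes the value p(F(0)) on the image of the two copies, and F(0)
is in the rational hull of every compact set containing this image
(no_outer_zero, hull_point).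

The arcs.  The Cantor set lies on an injective planar path zarc.  The curve u
|-> (f(zarc u - 2T), boundary value of f, mu (zarc u - T) f(zarc u - 2T)) passes
through the image of the first copy; adding to its third coordinate a real
height that vanishes exactly on the Cantor set keeps this property, and after
the end of zarc the height goes down to -1 on a short link.  A second curve is
attached in the same way to the other copy.  For a suitable mu the curves meet
at their last points only: equality elsewhere would make the sum of the two
heights close to -2 (curves_disjoint).  So the union is an arc.

Polynomial convexity of each curve.  Near -2T the transform f is almost 1/z, so
zarc can be recovered from the coordinate f(zarc - 2T) by a Picard iteration in
polynomials (ulim_inverse), and then so can the real height.  Powers of 1 -
(height - s)^2/M show that a point of the hull is in the hull of a single fibre
of the height (fibre_separation).  Fibres over nonzero values are finite. The
fibre over 0 is the Cantor set, on which the indicators of the small pieces are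
uniform limits of polynomials (word_indicator): a Newton iteration towards the
fourth roots of unity reads off the first digit.  In both cases a point off the
curve is separated from the fibre (sep_list, sep_cantor). *)

Set Implicit Arguments.
Unset Strict Implicit.
Unset Printing Implicit Defensive.
Import Order.TTheory GRing.Theory Num.Theory.
Import numFieldNormedType.Exports.
Local Open Scope classical_set_scope.
Local Open Scope ring_scope.
Local Open Scope complex_scope.
Local Notation Re := complex.Re.
Local Notation Im := complex.Im.

(** * Real-valued modulus and continuity of complex functions *)

Section Modulus.
Variable R : realType.
Implicit Types (x y z : R[i]) (a b : R).

(** The norm of R[i] is R[i]-valued; estimates are made with this real-valued
one. *)
Definition cn (z : R[i]) : R := ComplexField.Normc.normc z.

Lemma cnE x : cn x = Num.sqrt (Re x ^+ 2 + Im x ^+ 2).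
Proof. by case: x. Qed.

Lemma cn_ge0 x : 0 <= cn x.
Proof. by rewrite cnE sqrtr_ge0. Qed.

Lemma cnsq x : cn x ^+ 2 = Re x ^+ 2 + Im x ^+ 2.
Proof. by rewrite cnE sqr_sqrtr // addr_ge0 // sqr_ge0. Qed.

Lemma cn0 : cn 0 = 0. Proof. exact: ComplexField.Normc.normc0. Qed.
Lemma cn1 : cn 1 = 1. Proof. exact: ComplexField.Normc.normc1. Qed.
Lemma cnM x y : cn (x * y) = cn x * cn y.
Proof. exact: ComplexField.Normc.normcM. Qed.
Lemma cnV x : cn x^-1 = (cn x)^-1.
Proof. exact: ComplexField.Normc.normcV. Qed.
Lemma cn_div x y : cn (x / y) = cn x / cn y.
Proof. by rewrite cnM cnV. Qed.
Lemma cnN x : cn (- x) = cn x.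
Proof. by rewrite !cnE !raddfN /= !sqrrN. Qed.
Lemma cnB x y : cn (x - y) = cn (y - x).
Proof. by rewrite -cnN opprB. Qed.
Lemma cnX x n : cn (x ^+ n) = cn x ^+ n.
Proof. by elim: n => [|n IH]; rewrite ?expr0 ?cn1 // !exprS cnM IH. Qed.
Lemma cn_real a : cn a%:C = `|a|.
Proof. by rewrite cnE /= expr0n addr0 sqrtr_sqr. Qed.
Lemma cn_pos a : 0 <= a -> cn a%:C = a.
Proof. by move=> h; rewrite cn_real ger0_norm. Qed.
Lemma cn_eq0 x : (cn x == 0) = (x == 0).
Proof.
by apply/eqP/eqP => [/ComplexField.Normc.eq0_normc //|->]; rewrite cn0.
Qed.
Lemma cn_gt0 x : (0 < cn x) = (x != 0).
Proof. by rewrite lt_neqAle cn_ge0 andbT eq_sym cn_eq0. Qed.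

Lemma ler_cnD x y : cn (x + y) <= cn x + cn y.
Proof. exact: (@le_normcD R x y). Qed.
Lemma ler_cnB x y : cn (x - y) <= cn x + cn y.
Proof. by rewrite -(cnN y) ler_cnD. Qed.
Lemma lerB_cn x y : cn x - cn y <= cn (x + y).
Proof. by rewrite lerBlDr; have := ler_cnB (x + y) y; rewrite addrK. Qed.
Lemma lerB_cnB x y : cn x - cn y <= cn (x - y).
Proof. by rewrite -(cnN y) lerB_cn. Qed.
Lemma cn_tri y x z : cn (x - z) <= cn (x - y) + cn (y - z).
Proof. by have := ler_cnD (x - y) (y - z); rewrite addrA subrK. Qed.

Lemma Re_cn x : `|Re x| <= cn x.
Proof.
rewrite -(@ler_pXn2r _ 2) ?nnegrE ?cn_ge0 // cnsq real_normK ?num_real //.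
by rewrite lerDl sqr_ge0.
Qed.
Lemma Im_cn x : `|Im x| <= cn x.
Proof.
rewrite -(@ler_pXn2r _ 2) ?nnegrE ?cn_ge0 // cnsq real_normK ?num_real //.
by rewrite lerDr sqr_ge0.
Qed.
Lemma cn_leD x : cn x <= `|Re x| + `|Im x|.
Proof.
rewrite -(@ler_pXn2r _ 2) ?nnegrE ?cn_ge0 ?addr_ge0 // cnsq sqrrD.
rewrite !real_normK ?num_real // lerD2r lerDl.
by rewrite mulrn_wge0 // mulr_ge0.
Qed.

Lemma cn_le_sq x a : 0 <= a -> Re x ^+ 2 + Im x ^+ 2 <= a ^+ 2 -> cn x <= a.
Proof. by move=> a0; rewrite -cnsq ler_pXn2r // nnegrE ?cn_ge0. Qed.
Lemma cn_ge_sq x a : 0 <= a -> a ^+ 2 <= Re x ^+ 2 + Im x ^+ 2 -> a <= cn x.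
Proof. by move=> a0; rewrite -cnsq ler_pXn2r // nnegrE ?cn_ge0. Qed.

Lemma ler_cn_sum (I : Type) (s : seq I) (F : I -> R[i]) :
  cn (\sum_(i <- s) F i) <= \sum_(i <- s) cn (F i).
Proof.
elim: s => [|i s IH]; first by rewrite !big_nil cn0.
by rewrite !big_cons (le_trans (ler_cnD _ _)) // lerD2l.
Qed.

Lemma ReM x y : Re (x * y) = Re x * Re y - Im x * Im y.
Proof. by case: x y => [? ?] [? ?]. Qed.
Lemma ImM x y : Im (x * y) = Re x * Im y + Im x * Re y.
Proof. by case: x y => [? ?] [? ?]. Qed.
Lemma ReD x y : Re (x + y) = Re x + Re y. Proof. exact: raddfD. Qed.
Lemma ImD x y : Im (x + y) = Im x + Im y. Proof. exact: raddfD. Qed.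
Lemma ReN x : Re (- x) = - Re x. Proof. exact: raddfN. Qed.
Lemma ImN x : Im (- x) = - Im x. Proof. exact: raddfN. Qed.
Lemma ReZ a x : Re (a%:C * x) = a * Re x. Proof. by rewrite ReM /= mul0r subr0. Qed.
Lemma ImZ a x : Im (a%:C * x) = a * Im x. Proof. by rewrite ImM /= mul0r addr0. Qed.

Lemma Cext x y : Re x = Re y -> Im x = Im y -> x = y.
Proof. by case: x y => [? ?] [? ?] /= -> ->. Qed.

Lemma realC_inj a b : a%:C = b%:C -> a = b.
Proof. by case. Qed.

Lemma expr_le_eps (q e : R) (M : R) : 0 <= q < 1 -> 0 < e -> exists n0 : nat,
  forall n, (n0 <= n)%N -> M * q ^+ n <= e.
Proof.
move=> /andP[q0 q1] e0.
have := @cvg_expr R q; rewrite ger0_norm // => /(_ q1) /cvgrPdist_le.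
have M0 : 0 < `|M| + 1 by rewrite ltr_wpDl.
move=> /(_ (e / (`|M| + 1)) (divr_gt0 e0 M0)) [n0 _ H]; exists n0 => n hn.
have /= := H n hn; rewrite sub0r normrN ger0_norm ?exprn_ge0 //.
rewrite ler_pdivlMr // mulrC => h; apply: le_trans h.
rewrite ler_wpM2r ?exprn_ge0 //.
by have := ler_norm M; lra.
Qed.

End Modulus.

Section Continuity.
Variable R : realType.
Implicit Types (u v : R -> R[i]) (a b : R) (x : R[i]).

Definition ccont u := forall t (e : R), 0 < e ->
  exists2 d : R, 0 < d & forall s, `|s - t| < d -> cn (u s - u t) < e.
Definition rcont (f : R -> R) := forall t (e : R), 0 < e ->
  exists2 d : R, 0 < d & forall s, `|s - t| < d -> `|f s - f t| < e.

Lemma rcontP f : rcont f <-> continuous f.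
Proof.
split=> [cf t|cf t e e0].
  apply/cvgrPdist_lt => e e0; have [d d0 H] := cf t e e0.
  exists d => //= s /=; rewrite distrC => h; rewrite distrC; exact: H.
have /cvgrPdist_lt/(_ e e0) [d /= d0 H] := cf t.
by exists d => // s h; rewrite distrC; apply: H; rewrite /= distrC.
Qed.

Lemma ccont_cst x : ccont (fun=> x).
Proof. by move=> t e e0; exists 1 => // s _; rewrite subrr cn0. Qed.

Lemma ccont_ext u v : u =1 v -> ccont u -> ccont v.
Proof. by move=> /funext ->. Qed.

Lemma ccontD u v : ccont u -> ccont v -> ccont (fun t => u t + v t).
Proof.
move=> cu cv t e e0; have e2 : 0 < e / 2 by lra.
have [d d0 H] := cu t _ e2; have [d' d0' H'] := cv t _ e2.
exists (Num.min d d'); first by rewrite lt_min d0.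
move=> s; rewrite lt_min => /andP[/H h /H' h'].
have := ler_cnD (u s - u t) (v s - v t).
have -> : u s - u t + (v s - v t) = u s + v s - (u t + v t) by ring.
lra.
Qed.

Lemma ccontM u v : ccont u -> ccont v -> ccont (fun t => u t * v t).
Proof.
move=> cu cv t e e0.
pose M := cn (u t) + cn (v t) + 1 : R.
have M0 : 0 < M by rewrite /M; have := cn_ge0 (u t); have := cn_ge0 (v t); lra.
pose k := Num.min 1 (e / (2 * M)).
have k0 : 0 < k by rewrite lt_min ltr01 divr_gt0 // mulr_gt0.
have [d d0 H] := cu t _ k0; have [d' d0' H'] := cv t _ k0.
exists (Num.min d d'); first by rewrite lt_min d0.
move=> s; rewrite lt_min => /andP[/H h /H' h'].
have -> : u s * v s - u t * v t =
  (u s - u t) * (v s - v t) + (u s - u t) * v t + u t * (v s - v t) by ring.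
have k1 : k <= 1 by rewrite ge_min lexx.
have kM : k * (2 * M) <= e.
  by rewrite -ler_pdivlMr ?mulr_gt0 // /k ge_min lexx orbT.
have := ler_cnD ((u s - u t) * (v s - v t) + (u s - u t) * v t) (u t * (v s - v t)).
have := ler_cnD ((u s - u t) * (v s - v t)) ((u s - u t) * v t).
rewrite !cnM.
have p1 : cn (u s - u t) * cn (v s - v t) <= k * 1.
  by apply: ler_pM; rewrite ?cn_ge0 //; lra.
have p2 : cn (u s - u t) * cn (v t) <= k * cn (v t).
  by apply: ler_wpM2r; rewrite ?cn_ge0 //; lra.
have p3 : cn (u t) * cn (v s - v t) <= cn (u t) * k.
  by apply: ler_wpM2l; rewrite ?cn_ge0 //; lra.
have eM : k * (2 * M) = 2 * (k * cn (u t) + k * cn (v t) + k) by rewrite /M; ring.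
rewrite [cn (u t) * k]mulrC in p3; rewrite eM in kM.
lra.
Qed.

Lemma ccontN u : ccont u -> ccont (fun t => - u t).
Proof.
move=> cu t e e0; have [d d0 H] := cu t e e0; exists d => // s /H.
by rewrite -opprD cnN.
Qed.

Lemma ccontB u v : ccont u -> ccont v -> ccont (fun t => u t - v t).
Proof. by move=> cu cv; exact: ccontD cu (ccontN cv). Qed.

Lemma ccont_real f : rcont f -> ccont (fun t => (f t)%:C).
Proof.
move=> cf t e e0; have [d d0 H] := cf t e e0; exists d => // s /H.
by rewrite -rmorphB cn_real.
Qed.

Lemma ccont_comp u (f : R -> R) : ccont u -> rcont f -> ccont (u \o f).
Proof.
move=> cu cf t e e0; have [d d0 H] := cu (f t) e e0.
by have [d' d0' H'] := cf t d d0; exists d' => // s /H' /H.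
Qed.

Lemma ccont_sum (I : Type) (s : seq I) (F : I -> R -> R[i]) :
  (forall i, ccont (F i)) -> ccont (fun t => \sum_(i <- s) F i t).
Proof.
move=> cF; elim: s => [|i s IH].
  by apply: (ccont_ext _ (ccont_cst 0)) => t; rewrite big_nil.
by apply: (ccont_ext _ (ccontD (cF i) IH)) => t; rewrite big_cons.
Qed.

Lemma rcont_cn u : ccont u -> rcont (fun t => cn (u t)).
Proof.
move=> cu t e e0; have [d d0 H] := cu t e e0; exists d => // s /H.
apply: le_lt_trans; rewrite ler_norml; apply/andP; split.
  by have := lerB_cnB (u t) (u s); rewrite cnB; lra.
by exact: lerB_cnB.
Qed.

Lemma rcont_Re u : ccont u -> rcont (fun t => Re (u t)).
Proof.
move=> cu t e e0; have [d d0 H] := cu t e e0; exists d => // s /H.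
by apply: le_lt_trans; have := Re_cn (u s - u t); rewrite ReD ReN.
Qed.

Lemma ccont_unif u (un : nat -> R -> R[i]) :
  (forall n, ccont (un n)) ->
  (forall e : R, 0 < e -> exists n, forall t, cn (un n t - u t) <= e) ->
  ccont u.
Proof.
move=> cn_ H t e e0; have e4 : 0 < e / 4 by lra.
have [n Hn] := H _ e4; have [d d0 Hd] := cn_ n t _ e4.
exists d => // s /Hd h.
have := cn_tri (un n s) (u s) (u t); have := cn_tri (un n t) (un n s) (u t).
have := Hn s; have := Hn t; rewrite (cnB (un n s) (u s)); lra.
Qed.

Lemma ccont_lip u (f : R[i] -> R[i]) (P : R[i] -> Prop) (L : R) :
  (forall x y, P x -> P y -> cn (f x - f y) <= L * cn (x - y)) ->
  (forall t, P (u t)) -> ccont u -> ccont (fun t => f (u t)).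
Proof.
move=> Lf Pu cu t e e0.
have M0 : 0 < `|L| + 1 by rewrite ltr_wpDl.
have [d d0 H] := cu t _ (divr_gt0 e0 M0); exists d => // s /H h.
apply: le_lt_trans (Lf _ _ (Pu s) (Pu t)) _.
rewrite ltr_pdivlMr // in h.
have := cn_ge0 (u s - u t) => p.
have := ler_norm L => q.
have : L * cn (u s - u t) <= `|L| * cn (u s - u t) by rewrite ler_wpM2r.
lra.
Qed.

Lemma rcont_id : rcont id.
Proof. by move=> t e e0; exists e. Qed.
Lemma rcont_cst a : rcont (fun=> a).
Proof. by move=> t e e0; exists 1 => // s _; rewrite subrr normr0. Qed.
Lemma rcont_lip (f : R -> R) (L : R) :
  (forall s t, `|f s - f t| <= L * `|s - t|) -> rcont f.
Proof.
move=> Lf t e e0.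
have M0 : 0 < `|L| + 1 by rewrite ltr_wpDl.
exists (e / (`|L| + 1)); first exact: divr_gt0.
move=> s h; apply: le_lt_trans (Lf _ _) _.
rewrite ltr_pdivlMr // in h.
have := normr_ge0 (s - t) => p.
have := ler_norm L => q.
have : L * `|s - t| <= `|L| * `|s - t| by rewrite ler_wpM2r.
lra.
Qed.
Lemma rcontD f g : rcont f -> rcont g -> rcont (fun t => f t + g t).
Proof.
move=> /rcontP cf /rcontP cg; apply/rcontP => t; apply: cvgD; [exact: cf|exact: cg].
Qed.
Lemma rcont_max f g : rcont f -> rcont g -> rcont (fun t => Num.max (f t) (g t)).
Proof.
move=> cf cg; have [/rcontP cf' /rcontP cg'] := (cf, cg).
by apply/rcontP => t; apply: continuous_max; [exact: cf'|exact: cg'].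
Qed.

Lemma pos_lower (f : R -> R) a b : a <= b -> rcont f ->
  (forall t, a <= t <= b -> 0 < f t) ->
  exists2 d : R, 0 < d & forall t, a <= t <= b -> d <= f t.
Proof.
move=> ab /rcontP cf pf.
have [|c cab H] := @EVT_min R f a b ab; first exact: continuous_subspaceT.
exists (f c); first by apply: pf; move: cab; rewrite in_itv.
by move=> t tab; apply: H; rewrite in_itv.
Qed.

Lemma bounded_above (f : R -> R) a b : a <= b -> rcont f ->
  exists M : R, forall t, a <= t <= b -> f t <= M.
Proof.
move=> ab /rcontP cf.
have [|c cab H] := @EVT_max R f a b ab; first exact: continuous_subspaceT.
by exists (f c) => t tab; apply: H; rewrite in_itv.
Qed.

(** Compactness: |g| + max(0, f) is positive on the segment, hence bounded
below. *)
Lemma separate_level (g f : R -> R) a b : a <= b -> rcont g -> rcont f ->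
  (forall t, a <= t <= b -> g t = 0 -> 0 < f t) ->
  exists2 d : R, 0 < d & forall t, a <= t <= b -> `|g t| < d -> 0 < f t.
Proof.
move=> ab cg cf H.
have cag : rcont (fun t => `|g t|).
  apply/rcontP => t; apply: cvg_norm; exact: (rcontP g).1.
have [||d d0 Hd] := @pos_lower (fun t => `|g t| + Num.max 0 (f t)) a b ab.
- by apply: rcontD => //; apply: rcont_max => //; exact: rcont_cst.
- move=> t tab; have [g0|g0] := eqVneq (g t) 0.
    by rewrite ltr_wpDl // lt_max H ?orbT.
  by rewrite ltr_pwDl ?normr_gt0 // le_max lexx.
exists d => // t tab gd; have [//|f0] := ltP 0 (f t).
by move: (Hd t tab); rewrite (max_idPl f0) addr0 leNgt gd.
Qed.

(** Completeness of R, applied to the real and imaginary parts. *)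
Lemma geom_cauchy (x : nat -> R[i]) (M q : R) : 0 <= q < 1 ->
  (forall n, cn (x n.+1 - x n) <= M * q ^+ n) ->
  exists l, forall n, cn (x n - l) <= M / (1 - q) * q ^+ n.
Proof.
move=> /andP[q0 q1] H.
have M0 : 0 <= M by have := H 0%N; rewrite expr0 mulr1; apply: le_trans; exact: cn_ge0.
have q1' : 0 < 1 - q by lra.
pose K := M / (1 - q).
have K0 : 0 <= K by rewrite divr_ge0 // ltW.
have KM : K * (1 - q) = M by rewrite /K divfK // gt_eqF.
rewrite -/K; clearbody K.
have D n m : cn (x (n + m)%N - x n) <= K * q ^+ n * (1 - q ^+ m).
  elim: m => [|m IH]; first by rewrite addn0 subrr cn0 expr0 subrr mulr0.
  rewrite addnS; apply: le_trans (cn_tri (x (n + m)%N) _ _) _.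
  have := H (n + m)%N; rewrite exprD exprS -KM.
  have -> : K * (1 - q) * (q ^+ n * q ^+ m) =
     K * q ^+ n * (1 - q * q ^+ m) - K * q ^+ n * (1 - q ^+ m) by ring.
  lra.
have D' n m : cn (x (n + m)%N - x n) <= K * q ^+ n.
  apply: le_trans (D n m) _; rewrite ler_piMr ?mulr_ge0 ?exprn_ge0 //.
  by have := exprn_ge0 m q0; lra.
have C (f : R[i] -> R) : (forall z, `|f z| <= cn z) -> (forall z w, f (z - w) = f z - f w) ->
   exists l : R, (fun n => f (x n)) @ \oo --> l.
  move=> fle fB; apply/cvg_ex/cauchy_cvgP/cauchyP => /= e e0.
  have [n0 Hn0] := @expr_le_eps R q (e/2) K (introT andP (conj q0 q1)) ltac:(lra).
  exists (f (x n0)); exists n0 => //= n hn; rewrite /ball /= -normrN opprB -fB.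
  apply: le_lt_trans (fle _) _; rewrite -(subnKC hn).
  by apply: le_lt_trans (D' _ _) _; have := Hn0 n0 (leqnn _); lra.
have [||l1 H1] := C (@Re R).
- exact: Re_cn.
- by move=> z w; rewrite ReD ReN.
have [||l2 H2] := C (@Im R).
- exact: Im_cn.
- by move=> z w; rewrite ImD ImN.
exists (l1 +i* l2) => n; apply/ler_addgt0Pr => e e0.
have e2 : 0 < e / 2 by lra.
move/cvgrPdist_le: H1 => /(_ _ e2) [n1 _ H1].
move/cvgrPdist_le: H2 => /(_ _ e2) [n2 _ H2].
pose m := maxn n (maxn n1 n2).
have := H1 m; rewrite /= /m !leq_max leqnn orbT => /(_ isT) h1.
have := H2 m; rewrite /= /m !leq_max leqnn !orbT => /(_ isT) h2.
apply: le_trans (cn_tri (x m) _ _) _; rewrite lerD //.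
  by rewrite cnB /m -(subnKC (leq_maxl n (maxn n1 n2))).
apply: le_trans (cn_leD _) _; rewrite ReD ReN ImD ImN /=.
by rewrite distrC -/m in h1; rewrite distrC -/m in h2; lra.
Qed.

End Continuity.

(** * The Cantor set and its Cauchy transform *)

Section CauchyTransform.
Variable R : realType.
Implicit Types (x y z c d : R[i]).

(** Four similarities of ratio rho: 4 rho > 1 makes the dimension of the Cantor
set larger than 1, while rho < 1/2 keeps the four pieces apart. *)
Definition rho : R := 4 / 15.
(** The factor 1 / (4 rho) of the functional equation of the Cauchy transform.
*)
Definition theta : R := 15 / 16.
Definition digits : seq R[i] :=
  [:: (-1) +i* (-1); (-1) +i* 1; 1 +i* (-1); 1 +i* 1].

Fixpoint centers (n : nat) : seq R[i] :=
  if n is m.+1 then [seq d + rho%:C * c | d <- digits, c <- centers m] else [:: 0].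

(** The Cauchy transform of the uniform probability on centers n, given by
self-similarity; approx_centers is the explicit form. *)
Fixpoint approx (n : nat) z : R[i] :=
  if n is m.+1 then theta%:C * \sum_(d <- digits) approx m ((z - d) / rho%:C) else z^-1.

Lemma approxS n z : approx n.+1 z = theta%:C * \sum_(d <- digits) approx n ((z - d) / rho%:C).
Proof. by []. Qed.

Lemma centersS n : centers n.+1 = [seq d + rho%:C * c | d <- digits, c <- centers n].
Proof. by []. Qed.

Lemma big_digits (V : nmodType) (F : R[i] -> V) : \sum_(d <- digits) F d =
  F ((-1) +i* (-1)) + F ((-1) +i* 1) + F (1 +i* (-1)) + F (1 +i* 1).
Proof. by rewrite /digits !big_cons big_nil addr0 !addrA. Qed.

Lemma rho_gt0 : 0 < rho. Proof. rewrite /rho; lra. Qed.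
Lemma rho_lt1 : 0 <= rho < 1. Proof. rewrite /rho; lra. Qed.
Lemma cn_rho : cn rho%:C = rho. Proof. by rewrite cn_pos // ltW // rho_gt0. Qed.
Lemma rhoC_neq0 : rho%:C != 0 :> R[i].
Proof. by rewrite -cn_gt0 cn_pos ?rho_gt0 // ltW // rho_gt0. Qed.
Lemma rhoX_gt0 n : 0 < rho ^+ n. Proof. by rewrite exprn_gt0 // rho_gt0. Qed.
Lemma rhoX_ge0 n : 0 <= rho ^+ n. Proof. exact: ltW (rhoX_gt0 n). Qed.
Lemma rhoX_le1 n : rho ^+ n <= 1.
Proof. by rewrite exprn_ile1 // /rho; lra. Qed.

Lemma cn_digits d : d \in digits -> cn d <= 71 / 50.
Proof.
by rewrite !inE => /or4P[] /eqP ->; apply: cn_le_sq => /=; lra.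
Qed.

Lemma digits_sep d d' : d \in digits -> d' \in digits -> d != d' -> 2 <= cn (d - d').
Proof.
by rewrite !inE => /or4P[] /eqP -> /or4P[] /eqP -> h; apply: cn_ge_sq => /=;
  try lra; move: h; rewrite eqxx.
Qed.

Lemma centers_bound n c : c \in centers n -> cn c <= 2 - 2 * rho ^+ n.
Proof.
elim: n c => [|n IH] c; first by rewrite inE expr0 => /eqP ->; rewrite cn0; lra.
move=> /allpairsP[[d c'] /= [dd cc ->]].
have := ler_cnD d (rho%:C * c'); rewrite cnM cn_rho.
have := cn_digits dd; have := IH _ cc; rewrite exprS /rho; lra.
Qed.

Lemma size_centers n : size (centers n) = (4 ^ n)%N.
Proof. by elim: n => //= n IH; rewrite !size_cat !size_map IH expnS /= !mulSn mul0n. Qed.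

Lemma approx_centers n z : approx n z = ((1 / 4) ^+ n)%:C * \sum_(c <- centers n) (z - c)^-1.
Proof.
elim: n z => [|n IH] z; first by rewrite big_seq1 subr0 expr0 mul1r.
rewrite approxS centersS big_allpairs_dep.
rewrite mulr_sumr mulr_sumr; apply: eq_bigr => d _; rewrite IH.
rewrite mulrA !mulr_sumr; apply: eq_bigr => c _.
have -> : (z - d) / rho%:C - c = (z - (d + rho%:C * c)) / rho%:C.
  by field; exact: rhoC_neq0.
rewrite -rmorphM /= invfM invrK exprSr.
have -> : ((1 / 4) ^+ n * (1 / 4))%:C = ((1 / 4) ^+ n)%:C * (1 / 4)%:C :> R[i] by exact: rmorphM.
rewrite rmorphM /=.
have -> : (1 / 4)%:C = theta%:C * rho%:C :> R[i].
  by rewrite -rmorphM /=; congr (_ %:C); rewrite /theta /rho; field.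
ring.
Qed.

Lemma cn_mean n (F : R[i] -> R[i]) (B : R) :
  (forall c, cn c <= 2 -> cn (F c) <= B) ->
  cn (((1 / 4) ^+ n)%:C * \sum_(c <- centers n) F c) <= B.
Proof.
move=> H; rewrite cnM cn_pos ?exprn_ge0 //; last by lra.
apply: (@le_trans _ _ ((1 / 4) ^+ n * \sum_(c <- centers n) B)).
  rewrite ler_wpM2l ?exprn_ge0 //; first by lra.
  apply: le_trans (ler_cn_sum _ _) _; rewrite big_seq [leRHS]big_seq.
  apply: ler_sum => c /centers_bound h; apply: H.
  by have := rhoX_gt0 n; lra.
rewrite big_const_seq count_predT size_centers iter_addr_0 -[B *+ _]mulr_natr natrX.
rewrite mulrC -mulrA -exprMn (_ : 4%:R * (1 / 4) = 1 :> R); last by field.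
by rewrite expr1n mulr1.
Qed.

Lemma mean_cst n x : ((1 / 4) ^+ n)%:C * \sum_(c <- centers n) x = x.
Proof.
rewrite big_const_seq count_predT size_centers iter_addr_0 -[x *+ _]mulr_natl natrX mulrA.
rewrite rmorphXn /= -exprMn (_ : (1 / 4)%:C * 4%:R = 1 :> R[i]) ?expr1n ?mul1r //.
by rewrite fmorphV /= rmorph_nat mulVf // pnatr_eq0.
Qed.

Lemma approx_odd n z : approx n (- z) = - approx n z.
Proof.
elim: n z => [|n IH] z; first by rewrite /= invrN.
rewrite !approxS !big_digits -mulrN; congr (_ * _).
have E d d' : d' = - d -> approx n ((- z - d) / rho%:C) = - approx n ((z - d') / rho%:C).
  by move=> ->; rewrite -IH; congr approx; rewrite opprK -mulNr opprD.
rewrite (E ((-1) +i* (-1)) (1 +i* 1)) ?(E ((-1) +i* 1) (1 +i* (-1))).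
  rewrite ?(E (1 +i* (-1)) ((-1) +i* 1)) ?(E (1 +i* 1) ((-1) +i* (-1))).
    by ring.
all: by apply: Cext; rewrite /= ?opprK.
Qed.

(** Induction on n.  The weight 1 / (|z| - 2)^2 is compatible with the
rescalings z |-> (z - d) / rho because |d| <= 2 - 2 rho, and each rescaling
gains the factor 4 theta rho^2 = rho. *)
Lemma approx_step n z : 2 < cn z ->
  cn (approx n.+1 z - approx n z) <= 2 * rho ^+ n / (cn z - 2) ^+ 2.
Proof.
elim: n z => [|n IH] z z2.
  have z0 : z != 0 by rewrite -cn_gt0; lra.
  have -> : approx 1 z - approx 0 z = (1 / 4)%:C * \sum_(d <- digits) (d / ((z - d) * z)).
    rewrite (_ : approx 1 z = ((1 / 4) ^+ 1)%:C * \sum_(c <- centers 1) (z - c)^-1); last exact: approx_centers.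
    rewrite [approx 0 z]/= -[z^-1 in LHS](mean_cst 1) -mulrBr expr1 -sumrB; congr (_ * _).
    rewrite [centers 1]/= !mulr0 !addr0 -/digits big_seq [RHS]big_seq; apply: eq_bigr => d hd.
    have zd : z - d != 0 by rewrite -cn_gt0; have := lerB_cnB z d; have := cn_digits hd; lra.
    by field; rewrite z0 zd.
  rewrite expr0 mulr1 cnM cn_pos; last by lra.
  have P0 : 0 < (cn z - 2) ^+ 2 by rewrite exprn_gt0 //; lra.
  have B d : d \in digits -> cn (d / ((z - d) * z)) <= 2 / (cn z - 2) ^+ 2.
    move=> hd; rewrite cn_div cnM; apply: ler_pM; rewrite ?cn_ge0 ?invr_ge0 ?mulr_ge0 ?cn_ge0 //.
      by have := cn_digits hd; lra.
    rewrite lef_pV2 ?posrE // ?expr2.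
      by apply: ler_pM; try lra; have := lerB_cnB z d; have := cn_digits hd; lra.
    by rewrite mulr_gt0 //; have := lerB_cnB z d; have := cn_digits hd; lra.
  have := ler_cn_sum digits (fun d => d / ((z - d) * z)).
  have : \sum_(d <- digits) cn (d / ((z - d) * z)) <= \sum_(d <- digits) 2 / (cn z - 2) ^+ 2.
    by rewrite big_seq [leRHS]big_seq; apply: ler_sum => d; exact: B.
  rewrite (big_digits (fun=> 2 / (cn z - 2) ^+ 2)); set K := 2 / _; lra.
have P0 : 0 < cn z - 2 by lra.
have -> : approx n.+2 z - approx n.+1 z =
   theta%:C * \sum_(d <- digits) (approx n.+1 ((z - d) / rho%:C) - approx n ((z - d) / rho%:C)).
  by rewrite !approxS sumrB mulrBr.
rewrite cnM cn_pos; last by rewrite /theta; lra.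
have := ler_cn_sum digits (fun d => approx n.+1 ((z - d) / rho%:C) - approx n ((z - d) / rho%:C)).
have B d : d \in digits -> cn (approx n.+1 ((z - d) / rho%:C) - approx n ((z - d) / rho%:C))
   <= 2 * rho ^+ n * rho ^+ 2 / (cn z - 2) ^+ 2.
  move=> hd; have hw : (cn z - 2) / rho <= cn ((z - d) / rho%:C) - 2.
    rewrite cn_div cn_rho ler_pdivrMr ?rho_gt0 // mulrBl.
    rewrite divfK ?gt_eqF ?rho_gt0 //.
    by have := lerB_cnB z d; have := cn_digits hd; rewrite /rho; lra.
  have hp : 0 < (cn z - 2) / rho by rewrite divr_gt0 ?rho_gt0.
  apply: le_trans (IH _ _) _; first by lra.
  have -> : 2 * rho ^+ n * rho ^+ 2 / (cn z - 2) ^+ 2 =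
      2 * rho ^+ n / ((cn z - 2) / rho) ^+ 2.
    by field; rewrite (gt_eqF P0) (gt_eqF rho_gt0).
  rewrite ler_pM2l ?mulr_gt0 ?rhoX_gt0 //.
  rewrite lef_pV2 ?posrE ?exprn_gt0 //; last by lra.
  by rewrite ler_pXn2r ?nnegrE //; lra.
have : \sum_(d <- digits) cn (approx n.+1 ((z - d) / rho%:C) - approx n ((z - d) / rho%:C)) <=
   \sum_(d <- digits) 2 * rho ^+ n * rho ^+ 2 / (cn z - 2) ^+ 2.
  by rewrite big_seq [leRHS]big_seq; apply: ler_sum => d; exact: B.
rewrite (big_digits (fun=> 2 * rho ^+ n * rho ^+ 2 / (cn z - 2) ^+ 2)) => h1 h2.
have -> : 2 * rho ^+ n.+1 / (cn z - 2) ^+ 2 = theta * (4 * (2 * rho ^+ n * rho ^+ 2 / (cn z - 2) ^+ 2)).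
  by rewrite exprS /theta /rho; field; rewrite gt_eqF.
by rewrite ler_wpM2l /theta //; lra.
Qed.

(** The Cauchy transform away from the Cantor set, used for |z| >= 3 only. *)
Definition far z : R[i] :=
  xget 0 [set l | forall n, cn (approx n z - l) <= 3 * rho ^+ n].

Lemma farP n z : 3 <= cn z -> cn (approx n z - far z) <= 3 * rho ^+ n.
Proof.
move=> z3; rewrite /far; case: xgetP => [l _ H|H]; first exact: H.
exfalso; have [|l Hl] := @geom_cauchy R (fun n => approx n z) 2 rho rho_lt1.
  move=> k; apply: le_trans (approx_step _ _) _; first by lra.
  have Q : 1 <= (cn z - 2) ^+ 2 by rewrite exprn_ege1 //; lra.
  rewrite ler_pdivrMr ?(lt_le_trans _ Q) //.
  by rewrite ler_peMr ?mulr_ge0 ?rhoX_ge0.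
apply: (H l) => k; apply: le_trans (Hl k) _.
rewrite ler_wpM2r ?rhoX_ge0 // /rho ler_pdivrMr; lra.
Qed.

(** Estimates on far are proved on all its rational approximants, where they
hold termwise over the centres. *)
Lemma far_limit z (B : R) x y : 3 <= cn z ->
  (forall n, cn (x * approx n z + y) <= B) -> cn (x * far z + y) <= B.
Proof.
move=> z3 H; apply/ler_addgt0Pr => e e0.
have [n /(_ n (leqnn n)) hn] := @expr_le_eps R rho e (3 * cn x) rho_lt1 e0.
have := farP n z3 => h.
have := cn_tri (x * approx n z + y) (x * far z + y) 0; rewrite !subr0.
have -> : x * far z + y - (x * approx n z + y) = x * (far z - approx n z) by ring.
rewrite cnM (cnB (far z)).
have : cn x * cn (approx n z - far z) <= cn x * (3 * rho ^+ n) by rewrite ler_wpM2l ?cn_ge0.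
rewrite (_ : 3 * cn x * rho ^+ n = cn x * (3 * rho ^+ n)) in hn; last by ring.
have := H n.
lra.
Qed.

Lemma far_limit2 z z' (B : R) x x' y : 3 <= cn z -> 3 <= cn z' ->
  (forall n, cn (x * approx n z + x' * approx n z' + y) <= B) ->
  cn (x * far z + x' * far z' + y) <= B.
Proof.
move=> z3 z3' H; apply/ler_addgt0Pr => e e0.
have [n /(_ n (leqnn n)) hn] := @expr_le_eps R rho e (3 * (cn x + cn x')) rho_lt1 e0.
have h := farP n z3; have h' := farP n z3'.
have := cn_tri (x * approx n z + x' * approx n z' + y) (x * far z + x' * far z' + y) 0; rewrite !subr0.
have -> : x * far z + x' * far z' + y - (x * approx n z + x' * approx n z' + y) =
  x * (far z - approx n z) + x' * (far z' - approx n z') by ring.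
have := ler_cnD (x * (far z - approx n z)) (x' * (far z' - approx n z')).
rewrite !cnM (cnB (far z)) (cnB (far z')).
have : cn x * cn (approx n z - far z) <= cn x * (3 * rho ^+ n) by rewrite ler_wpM2l ?cn_ge0.
have : cn x' * cn (approx n z' - far z') <= cn x' * (3 * rho ^+ n) by rewrite ler_wpM2l ?cn_ge0.
rewrite (_ : 3 * (cn x + cn x') * rho ^+ n =
  cn x * (3 * rho ^+ n) + cn x' * (3 * rho ^+ n)) in hn; last by ring.
have := H n.
lra.
Qed.

Lemma approx_lip n z z' : 3 <= cn z -> 3 <= cn z' ->
  cn (approx n z - approx n z') <= cn (z - z').
Proof.
move=> z3 z3'; rewrite !approx_centers -mulrBr -sumrB; apply: cn_mean => c c2.
have h := lerB_cnB z c; have h' := lerB_cnB z' c.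
have zc : z - c != 0 by rewrite -cn_gt0; lra.
have zc' : z' - c != 0 by rewrite -cn_gt0; lra.
have -> : (z - c)^-1 - (z' - c)^-1 = (z' - z) / ((z - c) * (z' - c)).
  by field; rewrite zc zc'.
rewrite cn_div cnB ler_pdivrMr; last by rewrite cn_gt0 mulf_neq0.
rewrite ler_peMr ?cn_ge0 // cnM.
by rewrite -[leLHS]mulr1 ler_pM //; lra.
Qed.

Lemma far_lip z z' : 3 <= cn z -> 3 <= cn z' ->
  cn (far z - far z') <= cn (z - z').
Proof.
move=> z3 z3'; have := @far_limit2 z z' (cn (z - z')) 1 (-1) 0 z3 z3'.
rewrite !mul1r mulN1r addr0; apply => n.
by rewrite mul1r mulN1r addr0 approx_lip.
Qed.

Lemma far_inv z : 98 <= cn z -> cn (z * far z - 1) <= 1 / 48.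
Proof.
move=> z98; apply: far_limit => [|n]; first by lra.
rewrite approx_centers mulrCA mulr_sumr -(mean_cst n 1) -mulrBr -sumrB.
apply: cn_mean => c c2; have h := lerB_cnB z c.
have zc : z - c != 0 by rewrite -cn_gt0; lra.
have -> : z / (z - c) - 1 = c / (z - c) by field.
by rewrite cn_div ler_pdivrMr ?cn_gt0 //; lra.
Qed.

(** The distance 2T of the two copies of the Cantor set.  It is large, so that
from one copy the transform attached to the other one looks like 1/z. *)
Definition shift2 : R[i] := 200%:C.
Lemma cn_shift2 : cn shift2 = 200. Proof. by rewrite cn_pos. Qed.

Lemma far_shift y : cn y <= 5 -> 195 <= cn (y - shift2).
Proof. by move=> h; rewrite cnB; have := lerB_cnB shift2 y; rewrite cn_shift2; lra. Qed.

(** Near z = -2T the transform has a derivative close to -1 / (2T)^2, so that y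
|-> (2T)^2 f(y - 2T) + y contracts.  This is the estimate behind the Picard
iteration that inverts y |-> f(y - 2T), and it gives injectivity. *)
Lemma far_conformal y y' : cn y <= 5 -> cn y' <= 5 ->
  cn (shift2 ^+ 2 * far (y - shift2) + - shift2 ^+ 2 * far (y' - shift2) + (y - y'))
    <= 1 / 4 * cn (y - y').
Proof.
move=> y5 y5'; have hy := far_shift y5; have hy' := far_shift y5'.
apply: far_limit2 => [||n]; try lra.
rewrite !approx_centers [shift2 ^+ 2 * _]mulrCA [- shift2 ^+ 2 * _]mulrCA.
rewrite [shift2 ^+ 2 * \sum_(_ <- _) _]mulr_sumr [- shift2 ^+ 2 * \sum_(_ <- _) _]mulr_sumr.
rewrite -[X in cn (_ + _ + X)](mean_cst n) -!mulrDr -!big_split /=; apply: cn_mean => c c2.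
have h := lerB_cnB (y - shift2) c; have h' := lerB_cnB (y' - shift2) c.
have zc : y - shift2 - c != 0 by rewrite -cn_gt0; lra.
have zc' : y' - shift2 - c != 0 by rewrite -cn_gt0; lra.
rewrite [X in cn X](_ : _ = (y - y') *
   (((y - c) * (y' - c) - shift2 * ((y - c) + (y' - c))) / ((y - shift2 - c) * (y' - shift2 - c)))); last first.
  by move: zc zc'; generalize shift2 => S0 zc zc'; field; rewrite zc zc'.
rewrite cnM mulrC ler_wpM2r ?cn_ge0 // cn_div ler_pdivrMr; last first.
  by rewrite cn_gt0 mulf_neq0.
rewrite cnM.
have B : 193 * 193 <= cn (y - shift2 - c) * cn (y' - shift2 - c) by rewrite ler_pM; lra.
have := ler_cnB ((y - c) * (y' - c)) (shift2 * ((y - c) + (y' - c))).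
rewrite !cnM cn_shift2.
have := ler_cnD (y - c) (y' - c); have := ler_cnB y c; have := ler_cnB y' c => a1 a2 a3.
have : cn (y - c) * cn (y' - c) <= 7 * 7 by rewrite ler_pM ?cn_ge0 //; lra.
lra.
Qed.

End CauchyTransform.

(** * Self-similar functions on the unit interval *)

Section SelfSimilar.
Variable R : realType.
Implicit Types (s t : R) (u v : R -> R[i]).

Definition clamp t : R := Num.max 0 (Num.min t 1).
Definition tent t : R := Num.max 0 (Num.min t (1 - t)).

Lemma clamp_id t : 0 <= t <= 1 -> clamp t = t.
Proof. by case/andP => t0 t1; rewrite /clamp (min_idPl t1) (max_idPr t0). Qed.
Lemma clamp_le0 t : t <= 0 -> clamp t = 0.
Proof. by move=> t0; rewrite /clamp min_l ?(max_idPl _) //; lra. Qed.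
Lemma clamp_ge1 t : 1 <= t -> clamp t = 1.
Proof. by move=> t0; rewrite /clamp (min_idPr t0) (max_idPr _). Qed.
Lemma clamp01 t : 0 <= clamp t <= 1.
Proof.
rewrite /clamp le_max lexx /= ge_max ler01 /=.
by rewrite ge_min lexx orbT.
Qed.
Lemma clampK t : clamp (clamp t) = clamp t.
Proof. exact: clamp_id (clamp01 t). Qed.
Lemma tent_out t : (t <= 0) || (1 <= t) -> tent t = 0.
Proof.
move=> h; apply/max_idPl; rewrite ge_min; case/orP: h => h; first by rewrite h.
by apply/orP; right; lra.
Qed.
Lemma tent_ge0 t : 0 <= tent t. Proof. by rewrite /tent le_max lexx. Qed.
Lemma tent_le t : tent t <= 1 / 2.
Proof.
rewrite /tent ge_max; apply/andP; split; first by lra.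
by rewrite ge_min; case: (lerP t (1 / 2)) => //= h; lra.
Qed.
Lemma tent_in t : 0 <= t <= 1 -> tent t = t \/ tent t = 1 - t.
Proof.
move=> t01; rewrite /tent; case: (lerP t (1 - t)) => h.
  by left; rewrite max_r //; lra.
by right; rewrite max_r //; lra.
Qed.
Lemma tent_gt0 t : 0 < t < 1 -> 0 < tent t.
Proof. by move=> h; have [||] := @tent_in t; lra. Qed.

Lemma rcont_min (f g : R -> R) : rcont f -> rcont g ->
  rcont (fun t => Num.min (f t) (g t)).
Proof.
move=> cf cg; have [/rcontP cf' /rcontP cg'] := (cf, cg).
by apply/rcontP => t; apply: continuous_min; [exact: cf'|exact: cg'].
Qed.
Lemma rcont_clamp : rcont clamp.
Proof.
apply: rcont_max; first exact: rcont_cst.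
by apply: rcont_min; [exact: rcont_id|exact: rcont_cst].
Qed.
Lemma rcont_affine a b : rcont (fun t => a * t + b).
Proof.
apply: (@rcont_lip _ _ `|a|) => s t.
by rewrite -normrM (_ : a * s + b - (a * t + b) = a * (s - t)) //; ring.
Qed.
Lemma rcont_comp (f g : R -> R) : rcont f -> rcont g -> rcont (f \o g).
Proof.
move=> cf cg t e e0; have [d d0 H] := cf (g t) e e0.
by have [d' d0' H'] := cg t d d0; exists d' => // s /H' /H.
Qed.
Lemma rcont_tent : rcont tent.
Proof.
apply: rcont_max; first exact: rcont_cst.
apply: rcont_min; first exact: rcont_id.
apply: (@rcont_lip _ _ 1) => s t; rewrite mul1r -normrN.
by rewrite (_ : - (1 - s - (1 - t)) = s - t) //; ring.
Qed.

(** The subdivision of the unit interval into four pieces [2j/7, (2j+1)/7] and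
the three gaps between them, each parametrized by s in the unit interval. *)
Lemma unit_cases t : 0 <= t <= 1 ->
  (exists j s, [/\ (j < 4)%N, 0 <= s <= 1 & t = (s + 2 * j%:R) / 7]) \/
  (exists j s, [/\ (j < 3)%N, 0 < s < 1 & t = (s + 2 * j%:R + 1) / 7]).
Proof.
move=> t01.
have [h0|h0] := lerP t (1/7).
  by left; exists 0%N, (7 * t); split => //; lra.
have [h1|h1] := ltrP t (2/7).
  by right; exists 0%N, (7 * t - 1); split => //; lra.
have [h2|h2] := lerP t (3/7).
  by left; exists 1%N, (7 * t - 2); split => //; lra.
have [h3|h3] := ltrP t (4/7).
  by right; exists 1%N, (7 * t - 3); split => //; lra.
have [h4|h4] := lerP t (5/7).
  by left; exists 2%N, (7 * t - 4); split => //; lra.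
have [h5|h5] := ltrP t (6/7).
  by right; exists 2%N, (7 * t - 5); split => //; lra.
by left; exists 3%N, (7 * t - 6); split => //; lra.
Qed.

(** If q bounds phi by itself at another point, iterate: the a priori bound B
only enters through B q^n. *)
Lemma contract_bound (phi : R -> R) (B q m : R) : 0 <= q < 1 ->
  (forall t, phi t <= B) ->
  (forall t, 0 <= t <= 1 -> exists2 s, 0 <= s <= 1 & phi t <= m + q * phi s) ->
  forall t, 0 <= t <= 1 -> phi t <= m / (1 - q).
Proof.
move=> q01 HB H t t01; have [q0 q1] := andP q01.
pose K := m / (1 - q).
have KM : m = K * (1 - q) by rewrite /K divfK // gt_eqF; lra.
have P n : forall t, 0 <= t <= 1 -> phi t <= K + (B - K) * q ^+ n.
  elim: n => [|n IH] t' t01'; first by rewrite expr0; have := HB t'; lra.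
  have [s s01 /le_trans] := H t' t01'; apply.
  have h := IH s s01; have : q * phi s <= q * (K + (B - K) * q ^+ n) by rewrite ler_wpM2l.
  by rewrite exprS [m]KM; lra.
apply/ler_addgt0Pr => e e0.
have [n /(_ n (leqnn n)) hn] := @expr_le_eps R q e (B - K) q01 e0.
by have := P n t t01; rewrite -/K; lra.
Qed.

Section Fix.
Variables (a k : R[i]) (q M : R) (b : nat -> R -> R[i]).
Hypotheses (q01 : 0 <= q < 1) (aq : cn a <= q)
  (cb : forall j, ccont (b j)) (bM : forall j t, cn (b j t) <= M).

Let U u j s := a * u (clamp s) + b j (clamp s).
(** The sum of truncated terms telescopes to the required value on each piece and
gap; in this form continuity needs no gluing. *)
Let Phi u t :=
  let x := 7 * clamp t in
  U u 0 x + (U u 1 (x - 2) - U u 1 0) + (U u 2 (x - 4) - U u 2 0)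
    + (U u 3 (x - 6) - U u 3 0)
    + (clamp (x - 1))%:C * (U u 1 0 - U u 0 1)
    + (clamp (x - 3))%:C * (U u 2 0 - U u 1 1)
    + (clamp (x - 5))%:C * (U u 3 0 - U u 2 1)
    + k * (tent (x - 1) + tent (x - 3) + tent (x - 5))%:C.

Let U_le u j s : s <= 0 -> U u j s = U u j 0.
Proof. by move=> h; rewrite /U !clamp_le0. Qed.
Let U_ge u j s : 1 <= s -> U u j s = U u j 1.
Proof. by move=> h; rewrite /U !clamp_ge1. Qed.

(* Evaluates the truncated terms of Phi at a point whose position relative to
   the breakpoints linear arithmetic can decide. *)
Ltac simpl_Phi u :=
  repeat match goal with
  | |- context [U u ?j ?x] => lazymatch x with 0 => fail | 1 => fail | _ => idtac end;
      first [rewrite (@U_le u j x); [|lra] | rewrite (@U_ge u j x); [|lra]]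
  | |- context [clamp ?x] =>
      first [rewrite (@clamp_le0 x); [|lra] | rewrite (@clamp_ge1 x); [|lra]]
  | |- context [tent ?x] => rewrite (@tent_out x); [|lra]
  end.

Lemma Phi_piece u j s : (j < 4)%N -> 0 <= s <= 1 ->
  Phi u ((s + 2 * j%:R) / 7) = a * u s + b j s.
Proof.
move=> j4 s01; have <- : U u j s = a * u s + b j s by rewrite /U clamp_id.
rewrite /Phi clamp_id; last by case: j j4 => [|[|[|[|]]]] //= _; lra.
rewrite (_ : 7 * ((s + 2 * j%:R) / 7) = s + 2 * j%:R); last by field.
case: j j4 => [|[|[|[|]]]] //= _; simpl_Phi u.
- by rewrite (_ : s + 2 * 0 = s); last ring; rewrite !addr0 mulr0; ring.
- by rewrite (_ : s + 2 * 1 - 2 = s); last ring; rewrite !addr0 mulr0; ring.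
- by rewrite (_ : s + 2 * 2 - 4 = s); last ring; rewrite !addr0 mulr0; ring.
- by rewrite (_ : s + 2 * 3 - 6 = s); last ring; rewrite !addr0 mulr0; ring.
Qed.

Lemma Phi_gap u j s : (j < 3)%N -> 0 <= s <= 1 ->
  Phi u ((s + 2 * j%:R + 1) / 7) =
  (1 - s%:C) * (a * u 1 + b j 1) + s%:C * (a * u 0 + b j.+1 0) + k * (tent s)%:C.
Proof.
move=> j3 s01.
have <- : U u j 1 = a * u 1 + b j 1 by rewrite /U clamp_id //; lra.
have <- : U u j.+1 0 = a * u 0 + b j.+1 0 by rewrite /U clamp_id //; lra.
rewrite /Phi clamp_id; last by case: j j3 => [|[|[|]]] //= _; lra.
rewrite (_ : 7 * ((s + 2 * j%:R + 1) / 7) = s + 2 * j%:R + 1); last by field.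
case: j j3 => [|[|[|]]] //= _; simpl_Phi u.
- rewrite (_ : s + 2 * 0 + 1 - 1 = s); last by lra.
  by rewrite clamp_id // ?addr0 ?add0r; ring.
- rewrite (_ : s + 2 * 1 + 1 - 3 = s); last by lra.
  by rewrite clamp_id // ?addr0 ?add0r; ring.
- rewrite (_ : s + 2 * 2 + 1 - 5 = s); last by lra.
  by rewrite clamp_id // ?addr0 ?add0r; ring.
Qed.

Let Phi_clamp u t : Phi u (clamp t) = Phi u t.
Proof. by rewrite /Phi clampK. Qed.

Let Phi_cont u : ccont u -> ccont (Phi u).
Proof.
move=> cu.
have cU j c : ccont (fun t => U u j (7 * clamp t - c)).
  have cc : rcont (fun t => clamp (7 * clamp t - c)).
    apply: (rcont_comp rcont_clamp).
    by apply: (@rcont_comp (fun t => 7 * t - c)); [exact: rcont_affine|exact: rcont_clamp].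
  apply: ccontD; last exact: ccont_comp (cb j) cc.
  by apply: ccontM; [exact: ccont_cst|exact: ccont_comp cu cc].
have cC c : ccont (fun t => (clamp (7 * clamp t - c))%:C).
  apply: ccont_real; apply: (rcont_comp rcont_clamp).
  by apply: (@rcont_comp (fun t => 7 * t - c)); [exact: rcont_affine|exact: rcont_clamp].
have cT c : rcont (fun t => tent (7 * clamp t - c)).
  apply: (rcont_comp rcont_tent).
  by apply: (@rcont_comp (fun t => 7 * t - c)); [exact: rcont_affine|exact: rcont_clamp].
have cU0 : ccont (fun t => U u 0 (7 * clamp t)).
  by apply: ccont_ext (cU 0%N 0) => t; rewrite subr0.
have cc x : ccont (fun=> x) by exact: ccont_cst.
rewrite /Phi.
apply: ccontD; last first.
  apply: ccontM; first exact: cc.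
  apply: ccont_real; apply: rcontD; last exact: cT.
  by apply: rcontD; exact: cT.
do 3! (apply: ccontD; last by apply: ccontM; [exact: cC|exact: cc]).
by do 3! (apply: ccontD; last by apply: ccontB; [exact: cU|exact: cc]).
Qed.

Let Phi_contr u v (D : R) : (forall t, cn (u t - v t) <= D) ->
  forall t, cn (Phi u t - Phi v t) <= q * D.
Proof.
move=> HD t; rewrite -(Phi_clamp u) -(Phi_clamp v).
have P x : cn (a * u x - a * v x) <= q * D.
  by rewrite -mulrBr cnM ler_pM ?cn_ge0.
have [[j [s [j4 s01 ->]]]|[j [s [j3 s01 ->]]]] := unit_cases (clamp01 t).
  by rewrite !Phi_piece // opprD addrACA subrr addr0.
have s01' : 0 <= s <= 1 by lra.
rewrite !Phi_gap //.
have -> : (1 - s%:C) * (a * u 1 + b j 1) + s%:C * (a * u 0 + b j.+1 0) + k * (tent s)%:C -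
  ((1 - s%:C) * (a * v 1 + b j 1) + s%:C * (a * v 0 + b j.+1 0) + k * (tent s)%:C) =
  (1 - s)%:C * (a * u 1 - a * v 1) + s%:C * (a * u 0 - a * v 0).
  by rewrite rmorphB rmorph1 /=; ring.
apply: le_trans (ler_cnD _ _) _; rewrite !cnM !cn_pos; try lra.
have := P 1; have := P 0 => p0 p1.
have : (1 - s) * cn (a * u 1 - a * v 1) <= (1 - s) * (q * D) by rewrite ler_wpM2l; lra.
have : s * cn (a * u 0 - a * v 0) <= s * (q * D) by rewrite ler_wpM2l; lra.
lra.
Qed.

(** Picard iteration for u = a u + b_j on the pieces, where the gaps carry the
linear interpolation of the ends of the pieces plus a multiple k of a tent.  The
path zarc, the height and the boundary values are all of this form. *)
Lemma selfsim_solution : exists u,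
  [/\ ccont u, exists B, forall t, cn (u t) <= B,
   forall t, u (clamp t) = u t,
   forall j s, (j < 4)%N -> 0 <= s <= 1 -> u ((s + 2 * j%:R) / 7) = a * u s + b j s &
   forall j s, (j < 3)%N -> 0 <= s <= 1 -> u ((s + 2 * j%:R + 1) / 7) =
     (1 - s%:C) * (a * u 1 + b j 1) + s%:C * (a * u 0 + b j.+1 0) + k * (tent s)%:C].
Proof.
pose un n := iter n Phi (fun=> 0 : R[i]).
pose L := M + M + cn k.
have L0 t : cn (un 1 t - un 0 t) <= L.
  rewrite /un /= subr0 -Phi_clamp.
  have m0 : 0 <= M by apply: le_trans (cn_ge0 (b 0 0)) (bM 0 0).
  have [[j [s [j4 s01 ->]]]|[j [s [j3 s01 ->]]]] := unit_cases (clamp01 t).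
    by rewrite Phi_piece // mulr0 add0r; have := bM j s; have := cn_ge0 k; rewrite /L; lra.
  have s01' : 0 <= s <= 1 by lra.
  rewrite Phi_gap // !mulr0 !add0r.
  apply: le_trans (ler_cnD _ _) _; apply: lerD.
    apply: le_trans (ler_cnD _ _) _; apply: lerD.
      rewrite -(rmorph1 (real_complex R)) -rmorphB cnM cn_pos /=; last by lra.
      by rewrite -[leRHS]mul1r ler_pM ?cn_ge0 ?bM //; lra.
    rewrite cnM cn_pos /=; last by lra.
    by rewrite -[leRHS]mul1r ler_pM ?cn_ge0 ?bM //; lra.
  rewrite cnM cn_pos ?tent_ge0 // -[leRHS]mulr1 ler_pM ?cn_ge0 ?tent_ge0 //.
  by have := tent_le s; lra.
have S n : forall t, cn (un n.+1 t - un n t) <= L * q ^+ n.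
  elim: n => [|n IH] t; first by rewrite expr0 mulr1.
  by rewrite exprS mulrCA; exact: Phi_contr.
have [u Hu] : exists u : R -> R[i], forall t n, cn (un n t - u t) <= L / (1 - q) * q ^+ n.
  have H t := @geom_cauchy R (fun n => un n t) L q q01 (fun n => S n t).
  by exists (fun t => projT1 (cid (H t))) => t n; exact: (projT2 (cid (H t))).
have unif e : 0 < e -> exists n, forall t, cn (un n t - u t) <= e.
  move=> e0; have [n /(_ n (leqnn n)) hn] := @expr_le_eps R q e (L / (1 - q)) q01 e0.
  by exists n => t; apply: le_trans (Hu t n) hn.
have fixu t : Phi u t = u t.
  apply/eqP; rewrite -subr_eq0 -cn_eq0 eq_le cn_ge0 andbT.
  apply/ler_addgt0Pr => e e0; rewrite add0r.
  have e2 : 0 < e / 2 by lra.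
  have [n /[dup] /(_ n (leqnn n)) hn /(_ n.+1 (leqnSn n)) hn'] :=
    @expr_le_eps R q (e / 2) (L / (1 - q)) q01 e2.
  have h1 : cn (Phi u t - Phi (un n) t) <= q * (e / 2).
    by apply: Phi_contr => t'; rewrite cnB; apply: le_trans (Hu t' n) hn.
  have h2 : cn (un n.+1 t - u t) <= e / 2 by apply: le_trans (Hu t n.+1) hn'.
  have := cn_tri (Phi (un n) t) (Phi u t) (u t).
  have : q * (e / 2) <= e / 2 by move: (q01) => /andP[? ?]; rewrite ler_piMl //; lra.
  by move: h2; rewrite (_ : un n.+1 t = Phi (un n) t) //; lra.
have un_cont n : ccont (un n) by elim: n => [|n IH]; [exact: ccont_cst|exact: Phi_cont].
exists u; split.
- exact: ccont_unif un_cont unif.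
- exists (L / (1 - q)) => t.
  by have := Hu t 0%N; rewrite expr0 mulr1 /un /= sub0r cnN.
- by move=> t; rewrite -fixu Phi_clamp fixu.
- by move=> j s j4 s01; rewrite -fixu Phi_piece.
- by move=> j s j4 s01; rewrite -fixu Phi_gap.
Qed.

End Fix.
End SelfSimilar.

(** * A planar arc through the Cantor set, and a height on it *)

Section CantorArc.
Variable R : realType.
Implicit Types (s t : R).

Definition digit (j : nat) : R[i] := nth 0 (@digits R) j.

Lemma digit_in j : (j < 4)%N -> digit j \in @digits R.
Proof. by move=> h; apply: mem_nth. Qed.

Lemma zarc_exists : exists u : R -> R[i],
  [/\ ccont u, exists B, forall t, cn (u t) <= B,
   forall t, u (clamp t) = u t,
   forall j s, (j < 4)%N -> 0 <= s <= 1 ->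
     u ((s + 2 * j%:R) / 7) = (rho R)%:C * u s + digit j &
   forall j s, (j < 3)%N -> 0 <= s <= 1 -> u ((s + 2 * j%:R + 1) / 7) =
     (1 - s%:C) * ((rho R)%:C * u 1 + digit j) + s%:C * ((rho R)%:C * u 0 + digit j.+1)].
Proof.
have [|||u [H1 H2 H3 H4 H5]] :=
  @selfsim_solution R (rho R)%:C 0 (rho R) (71 / 50) (fun j _ => digit j) (rho_lt1 R).
- by rewrite cn_rho.
- by move=> j; exact: ccont_cst.
- move=> j _; have [h|h] := ltnP j 4; first exact/cn_digits/digit_in.
  by rewrite /digit nth_default // cn0; lra.
by exists u; split => // j s j3 s01; rewrite H5 // mul0r addr0.
Qed.

(** The path visits the four pieces of the Cantor set in the order of digits and
joins them by segments. *)
Definition zarc : R -> R[i] := projT1 (cid zarc_exists).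

Lemma zarc_cont : ccont zarc. Proof. by rewrite /zarc; case: cid => u []. Qed.
Lemma zarc_clamp t : zarc (clamp t) = zarc t. Proof. by rewrite /zarc; case: cid => u []. Qed.
Lemma zarc_piece j s : (j < 4)%N -> 0 <= s <= 1 ->
  zarc ((s + 2 * j%:R) / 7) = (rho R)%:C * zarc s + digit j.
Proof. by rewrite /zarc; case: cid => u [] /= ? ? ? + ?; apply. Qed.
Lemma zarc_gap j s : (j < 3)%N -> 0 <= s <= 1 -> zarc ((s + 2 * j%:R + 1) / 7) =
  (1 - s%:C) * ((rho R)%:C * zarc 1 + digit j) + s%:C * ((rho R)%:C * zarc 0 + digit j.+1).
Proof. by rewrite /zarc; case: cid => u [] /= ? ? ? ?; apply. Qed.
Lemma zarc_bdd : exists B, forall t, cn (zarc t) <= B.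
Proof. by rewrite /zarc; case: cid => u []. Qed.

Lemma zarc0 : zarc 0 = (15 / 11)%:C * ((-1) +i* (-1)).
Proof.
have := @zarc_piece 0%N 0 isT; rewrite lexx ler01 => /(_ isT).
rewrite mulr0 addr0 mul0r /digit /= /rho => E.
apply: Cext; first have := congr1 (@complex.Re R) E; last have := congr1 (@complex.Im R) E.
  by rewrite ReD !ReZ /=; lra.
by rewrite ImD !ImZ /=; lra.
Qed.

Lemma zarc1 : zarc 1 = (15 / 11)%:C * (1 +i* 1).
Proof.
have := @zarc_piece 3%N 1 isT; rewrite lexx ler01 => /(_ isT).
rewrite (_ : (1 + 2 * 3%:R) / 7 = 1); last by field.
rewrite /digit /= /rho => E.
apply: Cext; first have := congr1 (@complex.Re R) E; last have := congr1 (@complex.Im R) E.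
  by rewrite ReD !ReZ /=; lra.
by rewrite ImD !ImZ /=; lra.
Qed.

(** Stated for a real linear form, to serve the real and the imaginary part. *)
Lemma zarc_coord (f : R[i] -> R) : (forall z, `|f z| <= cn z) ->
  (forall z w, f (z + w) = f z + f w) -> (forall a z, f (a%:C * z) = a * f z) ->
  (forall j, (j < 4)%N -> `|f (digit j)| <= 1) ->
  forall t, `|f (zarc t)| <= 15 / 11.
Proof.
move=> fle fD fZ fd t; rewrite -zarc_clamp.
have [B HB] := zarc_bdd.
have -> : 15 / 11 = 1 / (1 - rho R) by rewrite /rho; field.
apply: (@contract_bound R (fun t => `|f (zarc t)|) B (rho R) 1 (rho_lt1 R)).
- by move=> t'; apply: le_trans (fle _) (HB _).
- move=> t' /unit_cases[[j [s [j4 s01 ->]]]|[j [s [j3 s01 ->]]]].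
    exists s => //; rewrite zarc_piece // fD fZ addrC.
    apply: le_trans (ler_normD _ _) _; rewrite lerD ?fd //.
    by rewrite normrM ger0_norm // /rho; lra.
  have s01' : 0 <= s <= 1 by lra.
  rewrite zarc_gap // (_ : 1 - s%:C = (1 - s)%:C); last by rewrite rmorphB rmorph1.
  rewrite fD !fZ !fD !fZ.
  have d1 := fd j (ltnW (j3 : (j.+1 < 4)%N)); have d2 := fd j.+1 j3.
  rewrite !ler_norml in d1 d2.
  set x := f (zarc 1); set y := f (zarc 0).
  have rr : rho R = 4 / 15 by [].
  have key z : `|x| <= z -> `|y| <= z ->
     `|(1 - s) * (rho R * x + f (digit j)) + s * (rho R * y + f (digit j.+1))| <= 1 + rho R * z.
    rewrite !ler_norml rr => hx hy.
    have a1 : (1 - s) * (4 / 15 * x + f (digit j)) <= (1 - s) * (1 + 4 / 15 * z).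
      by rewrite ler_wpM2l; lra.
    have a2 : (1 - s) * (- (1 + 4 / 15 * z)) <= (1 - s) * (4 / 15 * x + f (digit j)).
      by rewrite ler_wpM2l; lra.
    have a3 : s * (4 / 15 * y + f (digit j.+1)) <= s * (1 + 4 / 15 * z).
      by rewrite ler_wpM2l; lra.
    have a4 : s * (- (1 + 4 / 15 * z)) <= s * (4 / 15 * y + f (digit j.+1)).
      by rewrite ler_wpM2l; lra.
    lra.
  have [xy|yx] := lerP `|x| `|y|.
    by exists 0; [rewrite lexx ler01|exact: key].
  by exists 1; [rewrite lexx ler01|apply: key => //; exact: ltW].
- exact: clamp01.
Qed.

Lemma Re_zarc t : - (15 / 11) <= Re (zarc t) <= 15 / 11.
Proof.
rewrite -ler_norml; apply: (@zarc_coord (@complex.Re R)) => //.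
- exact: Re_cn.
- exact: ReD.
- exact: ReZ.
- by case=> [|[|[|[|]]]] //= _; rewrite ?normrN normr1.
Qed.
Lemma Im_zarc t : - (15 / 11) <= Im (zarc t) <= 15 / 11.
Proof.
rewrite -ler_norml; apply: (@zarc_coord (@complex.Im R)) => //.
- exact: Im_cn.
- exact: ImD.
- exact: ImZ.
- by case=> [|[|[|[|]]]] //= _; rewrite ?normrN normr1.
Qed.

Lemma cn_zarc_sq t : cn (zarc t) ^+ 2 <= 2 * (15 / 11) ^+ 2.
Proof.
rewrite cnsq; have h1 := Re_zarc t; have h2 := Im_zarc t.
have : Re (zarc t) ^+ 2 <= (15 / 11) ^+ 2.
  by rewrite -[leLHS]real_normK ?num_real // ler_pXn2r ?nnegrE ?normr_ge0 ?ler_norml //; lra.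
have : Im (zarc t) ^+ 2 <= (15 / 11) ^+ 2.
  by rewrite -[leLHS]real_normK ?num_real // ler_pXn2r ?nnegrE ?normr_ge0 ?ler_norml //; lra.
lra.
Qed.

Lemma cn_zarc t : cn (zarc t) <= 2.
Proof.
have : cn (zarc t) ^+ 2 <= 2 ^+ 2 by have := cn_zarc_sq t; lra.
by rewrite ler_pXn2r ?nnegrE ?cn_ge0.
Qed.

Lemma piece_coord j s : (j < 4)%N -> 0 <= s <= 1 ->
  Re (zarc ((s + 2 * j%:R) / 7)) = 4 / 15 * Re (zarc s) + Re (digit j) /\
  Im (zarc ((s + 2 * j%:R) / 7)) = 4 / 15 * Im (zarc s) + Im (digit j).
Proof. by move=> j4 s01; rewrite zarc_piece // ReD ImD ReZ ImZ. Qed.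

Lemma gap_coord j s : (j < 3)%N -> 0 <= s <= 1 ->
  Re (zarc ((s + 2 * j%:R + 1) / 7)) =
    (1 - s) * (4 / 11 + Re (digit j)) + s * (- (4 / 11) + Re (digit j.+1)) /\
  Im (zarc ((s + 2 * j%:R + 1) / 7)) =
    (1 - s) * (4 / 11 + Im (digit j)) + s * (- (4 / 11) + Im (digit j.+1)).
Proof.
move=> j3 s01; rewrite zarc_gap // (_ : 1 - s%:C = (1 - s)%:C); last by rewrite rmorphB rmorph1.
rewrite zarc0 zarc1 !(ReD, ImD, ReZ, ImZ) /= /rho; split.
  by field.
by field.
Qed.

(** The coordinates tell apart the different pieces and gaps, so that equal
values lie in the same one; in a piece, rescale and repeat, gaining a factor 1/7
in the distance of the parameters each time. *)
Lemma zarc_inj s t : 0 <= s <= 1 -> 0 <= t <= 1 -> zarc s = zarc t -> s = t.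
Proof.
have P n : forall s t, 0 <= s <= 1 -> 0 <= t <= 1 -> zarc s = zarc t -> `|s - t| <= (1 / 7) ^+ n.
  elim: n => [|n IH] s' t' hs ht.
    by move=> _; rewrite expr0 ler_norml; lra.
  have [[j [a [j4 a01 ->]]]|[j [a [j3 a01 ->]]]] := unit_cases hs;
  have [[k [b [k4 b01 ->]]]|[k [b [k3 b01 ->]]]] := unit_cases ht.
  - have [->|jk] := eqVneq j k.
      rewrite !zarc_piece // => /addIr /(mulfI (rhoC_neq0 R)) /(IH _ _ a01 b01).
      rewrite exprS (_ : (a + 2 * k%:R) / 7 - (b + 2 * k%:R) / 7 = 1 / 7 * (a - b)).
        by rewrite normrM (@ger0_norm _ (1 / 7)) //; lra.
      by field.
    move=> E; exfalso.
    have [r1 i1] := piece_coord j4 a01; have [r2 i2] := piece_coord k4 b01.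
    rewrite E in r1 i1; rewrite r1 in r2; rewrite i1 in i2.
    have := Re_zarc a; have := Re_zarc b; have := Im_zarc a; have := Im_zarc b.
    move: j4 k4 jk r2 i2; rewrite /digit.
    by case: j E r1 i1 => [|[|[|[|]]]] //= _ _ _ _; case: k => [|[|[|[|]]]] //= _ _; lra.
  - have b01' : 0 <= b <= 1 by lra.
    move=> E; exfalso.
    have [r1 i1] := piece_coord j4 a01; have [r2 i2] := gap_coord k3 b01'.
    rewrite E in r1 i1; rewrite r1 in r2; rewrite i1 in i2.
    have := Re_zarc a; have := Im_zarc a; move: j4 k3 r2 i2; rewrite /digit.
    by case: j E r1 i1 => [|[|[|[|]]]] //= _ _ _ _; case: k => [|[|[|]]] //= _; lra.
  - have a01' : 0 <= a <= 1 by lra.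
    move=> E; exfalso.
    have [r1 i1] := gap_coord j3 a01'; have [r2 i2] := piece_coord k4 b01.
    rewrite E in r1 i1; rewrite r1 in r2; rewrite i1 in i2.
    have := Re_zarc b; have := Im_zarc b; move: j3 k4 r2 i2; rewrite /digit.
    by case: j E r1 i1 => [|[|[|]]] //= _ _ _ _; case: k => [|[|[|[|]]]] //= _; lra.
  - have a01' : 0 <= a <= 1 by lra.
    have b01' : 0 <= b <= 1 by lra.
    move=> E.
    have [r1 i1] := gap_coord j3 a01'; have [r2 i2] := gap_coord k3 b01'.
    rewrite E in r1 i1; rewrite r1 in r2; rewrite i1 in i2.
    have p : 0 <= (1 / 7 : R) ^+ n.+1 by rewrite exprn_ge0; lra.
    (* The three connecting segments are pairwise disjoint. *)
    suff -> : (a + 2 * j%:R + 1) / 7 = (b + 2 * k%:R + 1) / 7 by rewrite subrr normr0.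
    move: j3 k3 r2 i2; rewrite /digit; clear - a01 b01.
    by case: j => [|[|[|]]] //= _; case: k => [|[|[|]]] //= _; lra.
move=> hs ht E; apply/eqP; rewrite -subr_eq0 -normr_eq0 eq_le normr_ge0 andbT.
apply/ler_addgt0Pr => eps eps0; rewrite add0r.
have q01 : 0 <= (1 / 7 : R) < 1 by lra.
have [n /(_ n (leqnn n)) hn] := @expr_le_eps R (1 / 7) eps 1 q01 eps0.
by apply: le_trans (P n s t hs ht E) _; rewrite mul1r in hn.
Qed.

Lemma height_exists : exists u : R -> R,
  [/\ rcont u, exists B, forall t, `|u t| <= B,
   forall t, u (clamp t) = u t,
   forall j s, (j < 4)%N -> 0 <= s <= 1 -> u ((s + 2 * j%:R) / 7) = u s / 7 &
   forall j s, (j < 3)%N -> 0 <= s <= 1 -> u ((s + 2 * j%:R + 1) / 7) =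
     (1 - s) * (u 1 / 7) + s * (u 0 / 7) + tent s].
Proof.
have q01 : 0 <= (1 / 7 : R) < 1 by lra.
have [|||u [H1 [B HB] H3 H4 H5]] :=
  @selfsim_solution R (1 / 7)%:C 1 (1 / 7) 0 (fun _ _ => 0) q01.
- by rewrite cn_pos; lra.
- by move=> j; exact: ccont_cst.
- by move=> j _; rewrite cn0.
exists (fun t => Re (u t)); split.
- exact: rcont_Re.
- by exists B => t; apply: le_trans (Re_cn _) (HB t).
- by move=> t; rewrite H3.
- by move=> j s j4 s01; rewrite H4 // addr0 ReZ; field.
move=> j s j3 s01; rewrite H5 // !addr0 (_ : 1 - s%:C = (1 - s)%:C); last by rewrite rmorphB rmorph1.
by rewrite !ReD !ReZ mul1r /=; field.
Qed.

(** Zero exactly at the parameters of the Cantor set, with a tent of height 7^-n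
/ 2 over each gap of generation n. *)
Definition height : R -> R := projT1 (cid height_exists).

Lemma height_cont : rcont height. Proof. by rewrite /height; case: cid => u []. Qed.
Lemma height_clamp t : height (clamp t) = height t. Proof. by rewrite /height; case: cid => u []. Qed.
Lemma height_bdd : exists B, forall t, `|height t| <= B.
Proof. by rewrite /height; case: cid => u []. Qed.
Lemma height_piece j s : (j < 4)%N -> 0 <= s <= 1 -> height ((s + 2 * j%:R) / 7) = height s / 7.
Proof. by rewrite /height; case: cid => u [] /= ? ? ? + ?; apply. Qed.
Lemma height_at0 : height 0 = 0.
Proof.
have := @height_piece 0%N 0 isT; rewrite lexx ler01 mulr0 addr0 mul0r => /(_ isT); lra.
Qed.
Lemma height_at1 : height 1 = 0.
Proof.
have := @height_piece 3%N 1 isT; rewrite lexx ler01 (_ : (1 + 2 * 3%:R) / 7 = 1); last by field.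
move=> /(_ isT); lra.
Qed.
Lemma height_gap j s : (j < 3)%N -> 0 <= s <= 1 -> height ((s + 2 * j%:R + 1) / 7) = tent s.
Proof.
move=> j3 s01; have : height ((s + 2 * j%:R + 1) / 7) =
     (1 - s) * (height 1 / 7) + s * (height 0 / 7) + tent s.
  by rewrite /height; case: cid => u [] /= ? ? ? ?; apply.
by rewrite height_at0 height_at1 !mul0r !mulr0 !add0r.
Qed.

Lemma height_bounds t : 0 <= height t <= 7 / 12.
Proof.
have q01 : 0 <= (1 / 7 : R) < 1 by lra.
have [B HB] := height_bdd; have z01 : 0 <= (0 : R) <= 1 by rewrite lexx ler01.
rewrite -height_clamp; apply/andP; split.
  rewrite -oppr_le0 (_ : 0 = 0 / (1 - 1 / 7)); last by rewrite mul0r.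
  apply: (@contract_bound R (fun t => - height t) B (1 / 7) 0 q01) (clamp01 t).
    by move=> s; apply: le_trans (HB s); rewrite -normrN ler_norm.
  move=> s /unit_cases[[j [a [j4 a01 ->]]]|[j [a [j3 a01 ->]]]].
    by exists a => //; rewrite height_piece //; lra.
  by exists 0 => //; rewrite height_at0 height_gap //; [have := tent_ge0 a|]; lra.
rewrite (_ : 7 / 12 = (1 / 2) / (1 - 1 / 7)); last by field.
apply: (@contract_bound R height B (1 / 7) (1 / 2) q01) (clamp01 t).
  by move=> s; apply: le_trans (HB s); rewrite ler_norm.
move=> s /unit_cases[[j [a [j4 a01 ->]]]|[j [a [j3 a01 ->]]]].
  by exists a => //; rewrite height_piece //; lra.
by exists 0 => //; rewrite height_at0 height_gap //; [have := tent_le a|]; lra.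
Qed.

Lemma height_zero t : 0 <= t <= 1 -> height t = 0 ->
  exists j s, [/\ (j < 4)%N, 0 <= s <= 1, height s = 0 & t = (s + 2 * j%:R) / 7].
Proof.
move=> /unit_cases[[j [a [j4 a01 ->]]]|[j [a [j3 a01 ->]]]].
  by rewrite height_piece // => E; exists j, a; split => //; lra.
by rewrite height_gap; [|done|lra]; have := tent_gt0 a01; lra.
Qed.

(** Heights in a piece are 7 times smaller, so only finitely many gaps reach the
level c, and a tent takes each value at most twice. *)
Lemma height_level c : 0 < c -> exists l : seq R, forall t, 0 <= t <= 1 -> height t = c -> t \in l.
Proof.
have P n : forall c, 1 < 7 ^+ n * c -> exists l : seq R, forall t, 0 <= t <= 1 -> height t = c -> t \in l.
  elim: n => [|n IH] {}c hc.
    by exists [::] => t _ ht; have := height_bounds t; rewrite ht; rewrite expr0 in hc; lra.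
  have [|l Hl] := IH (7 * c); first by rewrite mulrA -exprSr.
  exists ([seq (s + 2 * j%:R) / 7 | j <- iota 0 4, s <- l] ++
          [seq (s + 2 * j%:R + 1) / 7 | j <- iota 0 3, s <- [:: c; 1 - c]]) => t.
  move=> /unit_cases[[j [a [j4 a01 ->]]]|[j [a [j3 a01 ->]]]].
    rewrite height_piece // => E; rewrite mem_cat; apply/orP; left.
    by apply/allpairsP; exists (j, a); split; [by rewrite mem_iota|by apply: Hl => //; lra|by []].
  have a01' : 0 <= a <= 1 by lra.
  rewrite height_gap // => E; rewrite mem_cat; apply/orP; right.
  apply/allpairsP; exists (j, a); split; [by rewrite mem_iota| |by []].
  rewrite !inE -E; have [->|->] := tent_in a01'; first by rewrite eqxx.
  by rewrite (_ : 1 - (1 - a) = a) ?eqxx ?orbT //; ring.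
move=> c0; have q01 : 0 <= (1 / 7 : R) < 1 by lra.
have [n /(_ n (leqnn n)) hn] := @expr_le_eps R (1 / 7) (c / 2) 1 q01 ltac:(lra).
apply: (P n); rewrite mul1r expr_div_n expr1n in hn.
have p7 : 0 < (7 : R) ^+ n by rewrite exprn_gt0.
have : 7 ^+ n * (1 / 7 ^+ n) <= 7 ^+ n * (c / 2) by rewrite ler_pM2l.
have p7c : 0 < 7 ^+ n * c by rewrite mulr_gt0.
by rewrite mul1r divff ?gt_eqF // => h; lra.
Qed.

End CantorArc.

(** * Boundary values of the Cauchy transform *)

Section BoundaryValues.
Variable R : realType.
Implicit Types (s t : R) (y c d : R[i]).

Lemma rho_inv d : d / (rho R)%:C = (15 / 4)%:C * d.
Proof.
rewrite mulrC; congr (_ * _); rewrite -fmorphV /=; congr (_ %:C).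
by rewrite /rho invf_div.
Qed.

(** The part of the transform at d_j + rho y that comes from the pieces other
than the j-th, up to the factor theta.  For y near the Cantor set only values of
far at points of modulus at least 5 occur. *)
Definition siblings (j : nat) y : R[i] :=
  \sum_(d <- digits R) (if d == digit R j then 0 else far (y + (digit R j - d) / (rho R)%:C)).

Lemma far_bdd y : 3 <= cn y -> cn (far y) <= 4.
Proof.
move=> y3; have := farP 0 y3; rewrite expr0 /= => h.
have := cn_tri (y^-1) (far y) 0; rewrite !subr0 (cnB (far y)) cnV.
have : (cn y)^-1 <= 3^-1 by rewrite lef_pV2 // posrE; lra.
by lra.
Qed.

Lemma siblings_shift j d y : (j < 4)%N -> d \in digits R -> d != digit R j -> cn y <= 2 ->
  5 <= cn (y + (digit R j - d) / (rho R)%:C).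
Proof.
move=> j4 hd dj y2; rewrite addrC.
have := lerB_cn ((digit R j - d) / (rho R)%:C) y.
rewrite rho_inv cnM cn_pos; last by lra.
have : 2 <= cn (digit R j - d) by apply: digits_sep => //; [exact: digit_in|rewrite eq_sym].
lra.
Qed.

Lemma siblings_bdd j y : (j < 4)%N -> cn y <= 2 -> cn (siblings j y) <= 16.
Proof.
move=> j4 y2; apply: le_trans (ler_cn_sum _ _) _.
rewrite (_ : 16 = \sum_(d <- digits R) 4); last by rewrite big_digits; ring.
rewrite big_seq [leRHS]big_seq; apply: ler_sum => d hd.
case: eqP => [_|/eqP dj]; first by rewrite cn0.
by apply: far_bdd; have := siblings_shift j4 hd dj y2; lra.
Qed.

Lemma siblings_cont j : (j < 4)%N -> ccont (fun t => siblings j (zarc t)).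
Proof.
move=> j4.
apply: (@ccont_ext R (fun t => \sum_(d <- digits R)
   (if d \in digits R then
      if d == digit R j then 0 else far (zarc t + (digit R j - d) / (rho R)%:C) else 0))).
  by move=> t; rewrite /siblings [RHS]big_seq [RHS]big_mkcond.
apply: (@ccont_sum R R[i] (digits R) (fun d t => if d \in digits R then
      if d == digit R j then 0 else far (zarc t + (digit R j - d) / (rho R)%:C) else 0)) => d.
have [hd|hd] := boolP (d \in digits R); last exact: ccont_cst.
have [_|dj] := eqVneq d (digit R j); first exact: ccont_cst.
apply: (@ccont_lip R _ (@far R) (fun z => 3 <= cn z) 1).
- by move=> x y hx hy; rewrite mul1r; exact: far_lip.
- by move=> t; have := siblings_shift j4 hd dj (cn_zarc t); lra.
- by apply: ccontD; [exact: zarc_cont|exact: ccont_cst].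
Qed.

Lemma bval_exists : exists u : R -> R[i],
  [/\ ccont u, exists B, forall t, cn (u t) <= B,
   forall t, u (clamp t) = u t &
   forall j s, (j < 4)%N -> 0 <= s <= 1 ->
     u ((s + 2 * j%:R) / 7) = (theta R)%:C * u s + (theta R)%:C * siblings j (zarc s)].
Proof.
have q01 : 0 <= theta R < 1 by rewrite /theta; lra.
have [|||u [H1 H2 H3 H4 H5]] := @selfsim_solution R (theta R)%:C 0 (theta R) 16
   (fun j t => if (j < 4)%N then (theta R)%:C * siblings j (zarc t) else 0) q01.
- by rewrite cn_pos //; lra.
- move=> j; have [hj|hj] := boolP (j < 4)%N; last exact: ccont_cst.
  by apply: ccontM; [exact: ccont_cst|exact: siblings_cont].
- move=> j t; case: ifP => hj; last by rewrite cn0.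
  rewrite cnM cn_pos; last by lra.
  have := siblings_bdd hj (cn_zarc t); have := cn_ge0 (siblings j (zarc t)) => a1 a2.
  have : theta R * cn (siblings j (zarc t)) <= 1 * cn (siblings j (zarc t)) by rewrite ler_wpM2r; lra.
  lra.
by exists u; split => // j s j4 s01; rewrite H4 // j4.
Qed.

(** The boundary values of the Cauchy transform on the Cantor set, as the
solution of its functional equation; the values in the gaps are a mere
interpolation. *)
Definition bval : R -> R[i] := projT1 (cid bval_exists).
Lemma bval_cont : ccont bval. Proof. by rewrite /bval; case: cid => u []. Qed.
Lemma bval_clamp t : bval (clamp t) = bval t. Proof. by rewrite /bval; case: cid => u []. Qed.
Lemma bval_bdd : exists B, forall t, cn (bval t) <= B.
Proof. by rewrite /bval; case: cid => u []. Qed.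
Lemma bval_piece j s : (j < 4)%N -> 0 <= s <= 1 -> bval ((s + 2 * j%:R) / 7) =
  (theta R)%:C * bval s + (theta R)%:C * siblings j (zarc s).
Proof. by rewrite /bval; case: cid => u [] /= ? ? ?; apply. Qed.

Lemma uniq_digits : uniq (digits R).
Proof.
have n1 : (-1 == 1 :> R) = false by apply/eqP; lra.
have n2 : (1 == -1 :> R) = false by apply/eqP; lra.
by rewrite /= !inE !eq_complex /= n1 n2 !andbF.
Qed.

Lemma digits_digit d : d \in digits R -> exists2 j, (j < 4)%N & d = digit R j.
Proof.
by move=> hd; exists (index d (digits R)); [move: hd; rewrite -index_mem|rewrite /digit nth_index].
Qed.

Lemma centersSP n c : c \in centers R n.+1 ->
  exists d c', [/\ d \in digits R, c' \in centers R n & c = d + (rho R)%:C * c'].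
Proof. by rewrite centersS => /allpairsP[[d c'] /= []]; exists d, c'. Qed.

(** Induction on n: passing to the piece that contains c multiplies the error by
theta = 15/16 and adds an error O(rho^n) in the contributions of the other
pieces. The ratio 31/32 is chosen between 15/16 and 1 to absorb the latter. *)
Lemma circle_approx : exists2 C, 0 <= C & forall n c, c \in centers R n ->
  exists t, [/\ 0 <= t <= 1, height t = 0, cn (c - zarc t) <= 4 * rho R ^+ n &
    forall y, cn (y - c) = 2 * rho R ^+ n ->
      cn y <= 2 /\ cn (approx n y - bval t) <= C * (31 / 32) ^+ n].
Proof.
have [B HB] := bval_bdd.
have B0 : 0 <= B by apply: le_trans (HB 0); exact: cn_ge0.
exists (2000 + B); first by lra.
elim=> [|n IH] c.
  rewrite inE => /eqP ->; exists 0; rewrite !expr0 !mulr1 lexx ler01 height_at0; split => //.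
    by rewrite sub0r cnN; have := cn_zarc (0 : R); lra.
  move=> y; rewrite subr0 => hy; split; first by rewrite hy.
  apply: le_trans (ler_cnB _ _) _; rewrite /= cnV hy; have := HB 0; lra.
move=> /centersSP[d [c' [hd hc ->]]].
have [t' [t01 ht hct H]] := IH c' hc; have [j j4 dE] := digits_digit hd.
exists ((t' + 2 * j%:R) / 7).
have d0 : digit R j + (rho R)%:C * c' - ((rho R)%:C * zarc t' + digit R j) = (rho R)%:C * (c' - zarc t').
  by ring.
split.
- by case: j j4 {dE d0} => [|[|[|[|]]]] //= _; lra.
- by rewrite height_piece // ht mul0r.
- rewrite zarc_piece // dE d0 cnM cn_rho exprS mulrCA ler_wpM2l //.
  by rewrite ltW // rho_gt0.
move=> y hy.
pose y' := (y - d) / (rho R)%:C.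
have yE : y = d + (rho R)%:C * y' by rewrite /y' mulrC divfK ?rhoC_neq0 // addrC subrK.
have hy' : cn (y' - c') = 2 * rho R ^+ n.
  move: hy; rewrite yE (_ : d + _ - _ = (rho R)%:C * (y' - c')); last by ring.
  rewrite cnM cn_rho exprS mulrCA => /mulfI; apply.
  by rewrite gt_eqF // rho_gt0.
have [y2 Hf] := H y' hy'.
split.
  rewrite yE; apply: le_trans (ler_cnD _ _) _; rewrite cnM cn_rho.
  by have := cn_digits hd; rewrite /rho; lra.
rewrite bval_piece // approxS -mulrDr -mulrBr cnM cn_pos; last by rewrite /theta; lra.
have key : cn (\sum_(d' <- digits R) approx n ((y - d') / (rho R)%:C) - (bval t' + siblings j (zarc t')))
   <= (2000 + B) * (31 / 32) ^+ n + 36 * rho R ^+ n.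
  have -> : \sum_(d' <- digits R) approx n ((y - d') / (rho R)%:C) - (bval t' + siblings j (zarc t')) =
     (approx n y' - bval t') + (\sum_(d' <- digits R)
       (if d' == digit R j then 0 else approx n (y' + (digit R j - d') / (rho R)%:C)
           - far (zarc t' + (digit R j - d') / (rho R)%:C))).
    have -> : \sum_(d' <- digits R) approx n ((y - d') / (rho R)%:C) = approx n y' +
       \sum_(d' <- digits R) (if d' == digit R j then 0 else approx n (y' + (digit R j - d') / (rho R)%:C)).
      have Q d' : (y - d') / (rho R)%:C = y' + (digit R j - d') / (rho R)%:C.
        by rewrite /y' -mulrDl dE; congr (_ / _); ring.
      rewrite (bigD1_seq d hd uniq_digits) (bigD1_seq d hd uniq_digits) /= dE eqxx add0r; congr (_ + _);
      first by rewrite /y' dE.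
      by apply: eq_bigr => d' /negbTE ->; rewrite Q.
    rewrite opprD addrACA; congr (_ + _).
    rewrite /siblings -sumrB; apply: eq_bigr => d' _; case: ifP => // _; by rewrite subr0.
  apply: le_trans (ler_cnD _ _) _; apply: lerD => //.
  apply: le_trans (ler_cn_sum _ _) _.
  rewrite (_ : 36 * rho R ^+ n = \sum_(d <- digits R) 9 * rho R ^+ n); last by rewrite big_digits; ring.
  rewrite big_seq [leRHS]big_seq; apply: ler_sum => d' hd'.
  case: eqP => [_|/eqP dj]; first by rewrite cn0 mulr_ge0 // rhoX_ge0.
  have s1 := siblings_shift j4 hd' dj y2; have s2 := siblings_shift j4 hd' dj (cn_zarc t').
  apply: le_trans (cn_tri (approx n (zarc t' + (digit R j - d') / (rho R)%:C)) _ _) _.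
  have h35 : 3 <= (5 : R) by lra.
  have := farP n (le_trans h35 s2) => F.
  have := @approx_lip R n _ _ (le_trans h35 s1) (le_trans h35 s2) => L.
  move: L; rewrite (_ : y' + _ - _ = y' - zarc t'); last by ring.
  have := cn_tri c' y' (zarc t'); rewrite hy'; have := rhoX_ge0 R n; lra.
apply: le_trans (ler_wpM2l _ key) _; first by rewrite /theta; lra.
have p1 : rho R ^+ n <= (31 / 32) ^+ n.
  by apply: lerXn2r; rewrite ?nnegrE /rho; lra.
have p2 : 0 <= (31 / 32 : R) ^+ n by rewrite exprn_ge0 //; lra.
have p3 : 0 <= B * (31 / 32) ^+ n by rewrite mulr_ge0.
by rewrite exprS /theta; lra.
Qed.

End BoundaryValues.

(** * Zeros and poles counted by the argument *)

Section Winding.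
Variable R : realType.
Implicit Types (u v : R -> R[i]) (a c z w eta : R[i]) (phi D s : R).

Definition cis phi : R[i] := cos phi +i* sin phi.

Lemma cn_cis phi : cn (cis phi) = 1.
Proof. by rewrite cnE /= cos2Dsin2 sqrtr1. Qed.
Lemma cisD phi psi : cis (phi + psi) = cis phi * cis psi.
Proof. by apply: Cext; rewrite ?ReM ?ImM /= ?cosD ?sinD //; ring. Qed.
Lemma cisN phi : cis (- phi) = (cis phi)^-1.
Proof.
have n0 : cis phi != 0 by rewrite -cn_gt0 cn_cis.
apply: (mulfI n0); rewrite -cisD subrr divff //.
by apply: Cext; rewrite /= ?cos0 ?sin0.
Qed.

(** A nonvanishing path with an explicit continuous argument al, up to a
constant K and a positive modulus; D is the total turn.  Working with lifts
directly makes the turn of a product the sum of the turns. *)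
Definition winds u D := exists (al : R -> R) (K : R[i]) (m : R -> R),
  [/\ rcont al, K != 0, forall phi, 0 < m phi,
      forall phi, u phi = K * (m phi)%:C * cis (al phi)
    & al (2 * pi) - al 0 = D].

Lemma winds_ext u v D : u =1 v -> winds u D -> winds v D.
Proof. by move=> /funext ->. Qed.

Lemma winds_cst w : w != 0 -> winds (fun=> w) 0.
Proof.
move=> w0; exists (fun=> 0), w, (fun=> 1); split => //.
- exact: rcont_cst.
- by move=> phi; rewrite mulr1 (_ : cis 0 = 1) ?mulr1 //; apply: Cext; rewrite /= ?cos0 ?sin0.
- by rewrite subrr.
Qed.

Lemma windsM u v D E : winds u D -> winds v E -> winds (fun x => u x * v x) (D + E).
Proof.
move=> [al [K [m [c1 K0 m0 eu <-]]]] [be [L [n [c2 L0 n0 ev <-]]]].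
exists (fun x => al x + be x), (K * L), (fun x => m x * n x); split.
- exact: rcontD.
- exact: mulf_neq0.
- by move=> phi; exact: mulr_gt0.
- by move=> phi; rewrite eu ev cisD rmorphM /=; ring.
- ring.
Qed.

Lemma windsV u D : winds u D -> winds (fun x => (u x)^-1) (- D).
Proof.
move=> [al [K [m [c1 K0 m0 eu <-]]]].
exists (fun x => - al x), K^-1, (fun x => (m x)^-1); split.
- by apply/rcontP => x; apply: cvgN; exact: (rcontP _).1.
- by rewrite invr_eq0.
- by move=> phi; rewrite invr_gt0.
- by move=> phi; rewrite eu cisN !invfM -fmorphV.
- ring.
Qed.

Lemma winds_cis : winds cis (2 * pi).
Proof.
exists id, 1, (fun=> 1); split => //; first exact: rcont_id.
- exact: oner_neq0.
- by move=> phi; rewrite !mul1r.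
- by rewrite subr0.
Qed.

Lemma polar w : 0 < Re w -> w = (cn w)%:C * cis (atan (Im w / Re w)).
Proof.
move=> w0; set x := Im w / Re w; set cc := cos (atan x).
have c0 : 0 < cc by rewrite /cc cos_atan invr_gt0 sqrtr_gt0; have := sqr_ge0 x; lra.
have sE : sin (atan x) = x * cc.
  by rewrite -{2}(atanK x) /tan divfK // gt_eqF.
have c1 : cc ^+ 2 * (1 + x ^+ 2) = 1.
  by have := cos2Dsin2 (atan x); rewrite sE -/cc => E1; rewrite -[RHS]E1; ring.
have E : Re w = cn w * cc.
  apply/eqP; rewrite -(@eqrXn2 _ 2) ?mulr_ge0 ?cn_ge0 ?ltW // exprMn cnsq.
  have xE : Im w = x * Re w by rewrite /x divfK // gt_eqF.
  rewrite xE (_ : (Re w ^+ 2 + (x * Re w) ^+ 2) * cc ^+ 2 = Re w ^+ 2 * (cc ^+ 2 * (1 + x ^+ 2))).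
    by rewrite c1 mulr1.
  ring.
apply: Cext; rewrite ?ReZ ?ImZ /=; first exact: E.
by rewrite sE mulrCA -E /x divfK // gt_eqF.
Qed.

(** In the right half plane the arctangent of Im / Re is a continuous argument.
*)
Lemma winds_right (u : R -> R[i]) : rcont (fun x => Re (u x)) -> rcont (fun x => Im (u x)) ->
  (forall x, 0 < Re (u x)) -> u (2 * pi) = u 0 -> winds u 0.
Proof.
move=> cR cI u0 per.
exists (fun x => atan (Im (u x) / Re (u x))), 1, (fun x => cn (u x)); split.
- apply/rcontP => x; apply: continuous_comp; last exact: continuous_atan.
  apply: cvgM; first exact: (rcontP _).1.
  by apply: cvgV; [rewrite gt_eqF|exact: (rcontP _).1].
- exact: oner_neq0.
- by move=> x; rewrite cn_gt0; apply/eqP => E; have := u0 x; rewrite E ltxx.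
- by move=> x; rewrite mul1r; exact: polar.
- by rewrite per subrr.
Qed.

Lemma rcont_cos : rcont (@cos R). Proof. by apply/rcontP; exact: continuous_cos. Qed.
Lemma rcont_sin : rcont (@sin R). Proof. by apply/rcontP; exact: continuous_sin. Qed.
Lemma rcont_scale (k : R) (f : R -> R) : rcont f -> rcont (fun x => k * f x).
Proof.
move=> /rcontP cf; apply/rcontP => x; apply: cvgM; [exact: cvg_cst|exact: cf].
Qed.

Lemma winds_perturb eta (k : R) : k = 1 \/ k = -1 -> cn eta < 1 ->
  winds (fun x => 1 + eta * cis (k * x)) 0.
Proof.
move=> k1 h.
have cC : rcont (fun x => cos (k * x)).
  exact: (rcont_comp rcont_cos (rcont_scale k (@rcont_id R))).
have cS : rcont (fun x => sin (k * x)).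
  exact: (rcont_comp rcont_sin (rcont_scale k (@rcont_id R))).
apply: winds_right.
- have : rcont (fun x => 1 + (Re eta * cos (k * x) + (- Im eta) * sin (k * x))).
    by apply: rcontD; [exact: rcont_cst|apply: rcontD; exact: rcont_scale].
  by congr rcont; apply/funext => x; rewrite ReD ReM /=; ring.
- have : rcont (fun x => Re eta * sin (k * x) + Im eta * cos (k * x)).
    by apply: rcontD; exact: rcont_scale.
  by congr rcont; apply/funext => x; rewrite ImD ImM /=; ring.
- move=> x; rewrite ReD /=; have := Re_cn (eta * cis (k * x)); rewrite cnM cn_cis mulr1.
  by rewrite ler_norml => /andP[]; lra.
- congr (1 + eta * _); rewrite mulr0; case: k1 => ->; rewrite ?mulN1r ?mul1r; apply: Cext;
  by rewrite /= ?cosN ?sinN mulrC mulr_natr ?cos2pi ?sin2pi ?cos0 ?sin0 ?oppr0.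
Qed.

(** For a outside of the circle the loop is a constant times a small
perturbation of 1, for a inside of it s cis x times such a perturbation. *)
Lemma winds_linear c s a : 0 < s -> cn (a - c) != s ->
  winds (fun x => c + s%:C * cis x - a) (if cn (a - c) < s then 2 * pi else 0).
Proof.
move=> s0 ne; have sC0 : s%:C != 0 :> R[i] by rewrite -cn_gt0 cn_pos ?ltW.
have [lt|ge] := ltP (cn (a - c)) s.
  have h : cn ((c - a) / s%:C) < 1.
    by rewrite cn_div cn_pos ?ltW // ltr_pdivrMr // mul1r cnB.
  have := windsM (winds_cst sC0) (windsM winds_cis (winds_perturb (or_intror erefl) h)).
  rewrite add0r addr0; apply: winds_ext => x; rewrite mulN1r cisN.
  have n0 : cis x != 0 by rewrite -cn_gt0 cn_cis.
  by field; rewrite sC0 n0.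
have gt : s < cn (a - c) by rewrite lt_neqAle eq_sym ne.
have ac0 : c - a != 0 by rewrite -cn_gt0 cnB; lra.
have h : cn (s%:C / (c - a)) < 1.
  by rewrite cn_div cn_pos ?ltW // ltr_pdivrMr ?cn_gt0 // mul1r cnB.
have := windsM (winds_cst ac0) (winds_perturb (or_introl erefl) h).
rewrite addr0; apply: winds_ext => x; rewrite mul1r.
by field.
Qed.

Lemma winds_prod c s (rs : seq R[i]) : 0 < s -> (forall a, a \in rs -> cn (a - c) != s) ->
  winds (fun x => \prod_(a <- rs) (c + s%:C * cis x - a))
    (2 * pi * (count (fun a => cn (a - c) < s) rs)%:R).
Proof.
move=> s0; elim: rs => [|a rs IH] H.
  rewrite mulr0; apply: winds_ext (winds_cst (oner_neq0 _)) => x.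
  by rewrite big_nil.
have {}IH := IH (fun b hb => H b (mem_behead (s := a :: rs) hb)).
have := windsM (winds_linear s0 (H a (mem_head _ _))) IH.
have -> : (if cn (a - c) < s then 2 * pi else 0) +
  2 * pi * (count (fun a => cn (a - c) < s) rs)%:R =
  2 * pi * (count (fun a => cn (a - c) < s) (a :: rs))%:R :> R.
  by rewrite /= natrD; case: ifP => _; rewrite /=; ring.
by apply: winds_ext => x; rewrite big_cons.
Qed.

(** A turn by a nonzero multiple of 2 pi passes through half a turn, where the
direction is opposite to the initial one: this cannot happen in a half plane. *)
Lemma winds_zero u w (p q : nat) : winds u (2 * pi * p%:R - 2 * pi * q%:R) ->
  (forall x, 0 < Re (w * u x)) -> p = q.
Proof.
move=> [al [K [m [cal K0 m0 eu D]]]] H; apply/eqP/negPn/negP => pq.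
have pi0 := pi_gt0 R.
have [x [eps [epsE xE]]] : exists x eps, (eps = 1 \/ eps = -1) /\ al x = al 0 + eps * pi.
  have cw : {within `[0, 2 * pi], continuous al}.
    by apply: continuous_subspaceT; exact: (rcontP _).1.
  have pi2 : 0 <= 2 * pi :> R by lra.
  have [lt|] := ltnP p q.
    have : p%:R + 1 <= q%:R :> R by rewrite natr1 ler_nat.
    move=> h.
    have h' : pi * (q%:R - p%:R) >= pi * 1 :> R by rewrite ler_wpM2l; lra.
    have [|x _ xE] := @IVT R al 0 (2 * pi) (al 0 - pi) pi2 cw.
      rewrite ge_min le_max; apply/andP; split; apply/orP; [right|left]; lra.
    by exists x, (-1); split; [right|rewrite xE mulN1r].
  rewrite leq_eqVlt eq_sym (negbTE pq) /= => lt.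
  have : q%:R + 1 <= p%:R :> R by rewrite natr1 ler_nat.
  move=> h.
  have h' : pi * (p%:R - q%:R) >= pi * 1 :> R by rewrite ler_wpM2l; lra.
  have [|x _ xE] := @IVT R al 0 (2 * pi) (al 0 + pi) pi2 cw.
    rewrite ge_min le_max; apply/andP; split; apply/orP; [left|right]; lra.
  by exists x, 1; split; [left|rewrite xE mul1r].
have cisE : cis (al x) = - cis (al 0).
  rewrite xE; case: epsE => ->; rewrite ?mul1r ?mulN1r; apply: Cext.
  - by rewrite /= cosDpi.
  - by rewrite /= sinDpi.
  - by rewrite /= -[in RHS](subrK pi (al 0)) cosDpi opprK.
  - by rewrite /= -[in RHS](subrK pi (al 0)) sinDpi opprK.
have := H x; have := H 0; rewrite !eu cisE.
have -> : w * (K * (m 0)%:C * cis (al 0)) = (m 0)%:C * (w * K * cis (al 0)) by ring.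
have -> : w * (K * (m x)%:C * - cis (al 0)) = (m x)%:C * (- (w * K * cis (al 0))) by ring.
by rewrite !ReZ ReN !pmulr_rgt0 //; lra.
Qed.

Theorem zeros_eq_poles c s (rs qs : seq R[i]) w : 0 < s ->
  (forall z, cn (z - c) = s ->
     0 < Re (w * (\prod_(a <- rs) (z - a) / \prod_(q <- qs) (z - q)))) ->
  count (fun a => cn (a - c) < s) rs = count (fun a => cn (a - c) < s) qs.
Proof.
move=> s0 H.
have hr a : a \in rs -> cn (a - c) != s.
  move=> ar; apply/eqP => E; have := H a E.
  by rewrite (big_rem a) //= subrr !mul0r mulr0 ltxx.
have hq a : a \in qs -> cn (a - c) != s.
  move=> ar; apply/eqP => E; have := H a E.
  by rewrite [\prod_(q <- qs) _](big_rem a) //= subrr mul0r invr0 !mulr0 ltxx.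
have := windsM (winds_prod s0 hr) (windsV (winds_prod s0 hq)).
move/winds_zero => /(_ w); apply => x.
by apply: H; rewrite addrC addKr cnM cn_cis mulr1 cn_pos ?ltW.
Qed.

End Winding.

(** * Polynomials along rational curves *)

Section PolyFun.
Variables (R : realType) (N : nat).
Implicit Types (f g : 'rV[R[i]]_N -> R[i]) (c : R[i]).

(** Polynomial maps as functions, so that they can be built pointwise without
handling formal polynomials. *)
Definition polyfun f := exists p, forall z, poly_eval p z = f z.

Lemma polyfun_cst c : polyfun (fun=> c).
Proof. by exists (mpoly.mpolyC N c) => z; rewrite /poly_eval mpoly.mevalC. Qed.
Lemma polyfun_coord i : polyfun (fun z => z ord0 i).
Proof. by exists (mpoly.mpolyX _ (mpoly.mnm1 i)) => z; rewrite /poly_eval mpoly.mevalXU. Qed.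
Lemma polyfunD f g : polyfun f -> polyfun g -> polyfun (fun z => f z + g z).
Proof. by move=> [p Hp] [q Hq]; exists (p + q) => z; rewrite /poly_eval mpoly.mevalD -Hp -Hq. Qed.
Lemma polyfunM f g : polyfun f -> polyfun g -> polyfun (fun z => f z * g z).
Proof. by move=> [p Hp] [q Hq]; exists (p * q) => z; rewrite /poly_eval mpoly.mevalM -Hp -Hq. Qed.
Lemma polyfun_ext f g : f =1 g -> polyfun f -> polyfun g.
Proof. by move=> /funext ->. Qed.

Lemma polyfun_ind (P : ('rV[R[i]]_N -> R[i]) -> Prop) :
  (forall c, P (fun=> c)) -> (forall i, P (fun z => z ord0 i)) ->
  (forall f g, P f -> P g -> P (fun z => f z + g z)) ->
  (forall f g, P f -> P g -> P (fun z => f z * g z)) ->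
  forall f, polyfun f -> P f.
Proof.
move=> Pc Pi PD PM f [p Hp].
have E : f = fun z : 'rV[R[i]]_N => \sum_(m <- mpoly.msupp p)
   mpoly.mcoeff m p * \prod_i z ord0 i ^+ mpoly.fun_of_multinom m i.
  by apply/funext => z; rewrite -Hp /poly_eval mpoly.mevalE.
rewrite E; elim: (mpoly.msupp p) => [|m s IH].
  rewrite (_ : (fun z : 'rV_N => _) = (fun=> 0)) //.
  by apply/funext => z; rewrite big_nil.
rewrite (_ : (fun z : 'rV_N => _) = (fun z : 'rV[R[i]]_N => mpoly.mcoeff m p *
   \prod_i z ord0 i ^+ mpoly.fun_of_multinom m i +
   \sum_(m <- s) mpoly.mcoeff m p * \prod_i z ord0 i ^+ mpoly.fun_of_multinom m i)); last first.
  by apply/funext => z; rewrite big_cons.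
apply: PD => //; apply: (PM) => //.
elim: (index_enum _) => [|i r IHr].
  by rewrite (_ : (fun z : 'rV_N => _) = (fun=> 1)) //; apply/funext => z; rewrite big_nil.
rewrite (_ : (fun z : 'rV_N => _) = (fun z : 'rV[R[i]]_N => z ord0 i ^+ mpoly.fun_of_multinom m i *
   \prod_(j <- r) z ord0 j ^+ mpoly.fun_of_multinom m j)); last first.
  by apply/funext => z; rewrite big_cons.
apply: (PM) => //; elim: (mpoly.fun_of_multinom m i) => [|k IHk].
  by rewrite (_ : (fun z : 'rV_N => _) = (fun=> 1)) //; apply/funext => z; rewrite expr0.
rewrite (_ : (fun z : 'rV_N => _) = (fun z : 'rV[R[i]]_N => z ord0 i * z ord0 i ^+ k)); first exact: (PM).
by apply/funext => z; rewrite exprS.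
Qed.

Lemma polyfunN f : polyfun f -> polyfun (fun z => - f z).
Proof.
move=> pf; apply: polyfun_ext (polyfunM (polyfun_cst (-1)) pf) => z.
by rewrite mulN1r.
Qed.
Lemma polyfunB f g : polyfun f -> polyfun g -> polyfun (fun z => f z - g z).
Proof. by move=> pf pg; apply: polyfunD => //; exact: polyfunN. Qed.

(** The bound and the Lipschitz constant are proved together, since the product
rule needs both. *)
Lemma polyfun_lipschitz f (M : R) : polyfun f -> exists2 L : R, 0 <= L &
  forall x : 'rV_N, (forall i, cn (x ord0 i) <= M) -> cn (f x) <= L /\
  forall (y : 'rV_N) (d : R), (forall i, cn (y ord0 i) <= M) ->
     (forall i, cn (x ord0 i - y ord0 i) <= d) -> cn (f x - f y) <= L * `|d|.
Proof.
move: f; apply: polyfun_ind => [c|i|f g [L L0 HL] [K K0 HK]|f g [L L0 HL] [K K0 HK]].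
- exists (cn c); first exact: cn_ge0.
  by move=> x _; split => // y d _ _; rewrite subrr cn0 mulr_ge0 // cn_ge0.
- exists (`|M| + 1); first by have := normr_ge0 M; lra.
  move=> x xM; split; first by have := xM i; have := ler_norm M; lra.
  move=> y d yM /(_ i) h; have := ler_norm d; have := normr_ge0 d; have := normr_ge0 M.
  move=> M0 d0 dd; have : 0 <= `|M| * `|d| by rewrite mulr_ge0.
  lra.
- exists (L + K); first by lra.
  move=> x xM; have [h1 h2] := HL x xM; have [k1 k2] := HK x xM; split.
    by apply: le_trans (ler_cnD _ _) _; lra.
  move=> y d yM xy; have := h2 y d yM xy; have := k2 y d yM xy.
  rewrite (_ : f x + g x - _ = (f x - f y) + (g x - g y)); last by ring.
  have := ler_cnD (f x - f y) (g x - g y); rewrite mulrDl; lra.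
- exists (2 * (L * K) + L * K); first by rewrite addr_ge0 // !mulr_ge0.
  move=> x xM; have [h1 h2] := HL x xM; have [k1 k2] := HK x xM; split.
    rewrite cnM; have := ler_pM (cn_ge0 _) (cn_ge0 _) h1 k1.
    have p : 0 <= L * K by rewrite mulr_ge0.
    lra.
  move=> y d yM xy; have hh := h2 y d yM xy; have kk := k2 y d yM xy.
  have [k3 _] := HK y yM.
  rewrite (_ : f x * g x - _ = f x * (g x - g y) + (f x - f y) * g y); last by ring.
  have := ler_cnD (f x * (g x - g y)) ((f x - f y) * g y); rewrite !cnM.
  have := ler_pM (cn_ge0 _) (cn_ge0 _) h1 kk.
  have := ler_pM (cn_ge0 _) (cn_ge0 _) hh k3.
  have p : 0 <= L * K * `|d| by rewrite !mulr_ge0.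
  rewrite (_ : L * (K * `|d|) = L * K * `|d|); last by ring.
  rewrite (_ : L * `|d| * K = L * K * `|d|); last by ring.
  rewrite (_ : (2 * (L * K) + L * K) * `|d| = 3 * (L * K * `|d|)); last by ring.
  lra.
Qed.

Lemma polyfun_ccont f (G : R -> 'rV[R[i]]_N) : (forall i, ccont (fun t => G t ord0 i)) ->
  polyfun f -> ccont (fun t => f (G t)).
Proof.
move=> cG; move: f; apply: polyfun_ind => [c|i|f g|f g].
- exact: ccont_cst.
- exact: cG.
- exact: ccontD.
- exact: ccontM.
Qed.

End PolyFun.

Section RationalCurves.
Variable R : realType.
Implicit Types (psi : R[i] -> R[i]) (D P : {poly R[i]}) (z a c : R[i]).

(** Rational functions with all poles among the roots of D.  The bound on the
size of P says that they are bounded at infinity. *)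
Definition ratfun D psi := exists k P, (size P <= (k * (size D).-1).+1)%N /\
  forall z, D.[z] != 0 -> psi z * D.[z] ^+ k = P.[z].

Lemma ratfun_cst D c : ratfun D (fun=> c).
Proof.
exists 0%N, c%:P; split; first by rewrite mul0n size_polyC leq_b1.
by move=> z _; rewrite expr0 mulr1 hornerC.
Qed.

Lemma size_mulX D P k l : (size P <= (k * (size D).-1).+1)%N ->
  (size (P * D ^+ l)%R <= ((k + l) * (size D).-1).+1)%N.
Proof.
move=> sP; apply: leq_trans (size_polyMleq _ _) _.
have := size_poly_exp_leq D l; rewrite mulnDl => h.
have := leq_add sP h; rewrite [(_.-1 * l)%N]mulnC addSn addnS.
by case: (size P + _)%N => // n; rewrite ltnS.
Qed.

Lemma ratfunD D f g : ratfun D f -> ratfun D g -> ratfun D (fun z => f z + g z).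
Proof.
move=> [k [P [sP HP]]] [l [Q [sQ HQ]]]; exists (k + l)%N, (P * D ^+ l + Q * D ^+ k); split.
  apply: leq_trans (size_polyD _ _) _; rewrite geq_max size_mulX //=.
  by rewrite addnC size_mulX.
move=> z Dz; rewrite hornerD !hornerM !horner_exp -HP // -HQ // exprD; ring.
Qed.

Lemma ratfunM D f g : ratfun D f -> ratfun D g -> ratfun D (fun z => f z * g z).
Proof.
move=> [k [P [sP HP]]] [l [Q [sQ HQ]]]; exists (k + l)%N, (P * Q); split.
  apply: leq_trans (size_polyMleq _ _) _; rewrite mulnDl.
  have := leq_add sP sQ; rewrite addSn addnS.
  by case: (size P + _)%N => // n; rewrite ltnS.
by move=> z Dz; rewrite hornerM -HP // -HQ // exprD; ring.
Qed.

Lemma ratfun_ext D f g : f =1 g -> ratfun D f -> ratfun D g.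
Proof. by move=> /funext ->. Qed.

Lemma ratfun_sum D (s : seq R[i]) (F : R[i] -> R[i] -> R[i]) :
  (forall c, c \in s -> ratfun D (F c)) -> ratfun D (fun z => \sum_(c <- s) F c z).
Proof.
elim: s => [|c s IH] H.
  by apply: ratfun_ext (ratfun_cst D 0) => z; rewrite big_nil.
apply: (@ratfun_ext _ (fun z => F c z + \sum_(c <- s) F c z)).
  by move=> z; rewrite big_cons.
apply: ratfunD; first by apply: H; rewrite mem_head.
by apply: IH => d ds; apply: H; rewrite in_cons ds orbT.
Qed.

Lemma ratfun_poly N D (F : R[i] -> 'rV[R[i]]_N) f :
  (forall i, ratfun D (fun z => F z ord0 i)) -> polyfun f -> ratfun D (fun z => f (F z)).
Proof.
move=> rF; move: f; apply: polyfun_ind => [c|i|f g|f g].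
- exact: ratfun_cst.
- exact: rF.
- exact: ratfunD.
- exact: ratfunM.
Qed.

Definition denom (qs : seq R[i]) : {poly R[i]} := \prod_(q <- qs) ('X - q%:P).

Lemma denomE qs z : (denom qs).[z] = \prod_(q <- qs) (z - q).
Proof.
rewrite /denom; elim: qs => [|q qs IH]; first by rewrite !big_nil hornerC.
by rewrite !big_cons hornerM IH hornerXsubC.
Qed.

Lemma denom_neq0 qs z : z \notin qs -> (denom qs).[z] != 0.
Proof.
rewrite denomE; elim: qs => [|q qs IH]; first by rewrite big_nil oner_neq0.
rewrite in_cons negb_or big_cons => /andP[h /IH h'].
by rewrite mulf_neq0 // subr_eq0.
Qed.

Lemma ratfun_pole qs q : q \in qs -> ratfun (denom qs) (fun z => (z - q)^-1).
Proof.
move=> hq; exists 1%N, (\prod_(x <- rem q qs) ('X - x%:P)); split.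
  rewrite /denom !size_prod_XsubC size_rem //= mul1n.
  by case: (qs) hq => // ? ? _.
move=> z Dz; rewrite expr1 /denom (big_rem q) //= hornerM hornerXsubC mulrA mulVf ?mul1r //.
apply: contraNneq Dz => E; rewrite denomE (big_rem q) //= E mul0r //.
Qed.

Lemma ratfun_pole1 qs q : q \in qs -> ratfun (denom qs) (fun z => z / (z - q)).
Proof.
move=> hq; exists 1%N, ('X * \prod_(x <- rem q qs) ('X - x%:P)); split.
  apply: leq_trans (size_polyMleq _ _) _.
  rewrite size_polyX /denom !size_prod_XsubC size_rem //= mul1n.
  by case: (qs) hq => // ? ? _.
move=> z Dz; rewrite expr1 hornerM hornerX /denom (big_rem q) //= hornerM hornerXsubC.
rewrite mulrA -(mulrA z) mulVf ?mulr1 //.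
apply: contraNneq Dz => E; rewrite denomE (big_rem q) //= E mul0r //.
Qed.

Lemma count_swap (T U : Type) (p : T -> U -> bool) (s : seq T) (r : seq U) :
  (\sum_(x <- s) count (p x) r = \sum_(y <- r) count (fun x => p x y) s)%N.
Proof.
have cE (V : Type) (f : V -> bool) (l : seq V) : count f l = (\sum_(y <- l) (f y : nat))%N.
  by elim: l => [|y l IH]; rewrite ?big_nil // big_cons /= IH.
transitivity (\sum_(x <- s) \sum_(y <- r) (p x y : nat))%N.
  by apply: eq_bigr => x _; rewrite cE.
by rewrite exchange_big; apply: eq_bigr => y _; rewrite cE.
Qed.

(** Write psi = P / D^k.  On each circle psi stays in a half plane, so that the
disc contains as many roots of P as of D^k; all roots of D^k are in the disjoint
discs and P has at most the same degree, hence no root is left over for z0. *)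
Theorem no_outer_zero (qs Cs : seq R[i]) (s : R) psi z0 :
  0 < s -> (0 < size Cs)%N ->
  (forall a, (count (fun c => (cn (a - c) < s)%R) Cs <= 1)%N) ->
  (forall q, q \in qs -> has (fun c => cn (q - c) < s) Cs) ->
  (forall c, c \in Cs -> s < cn (z0 - c)) ->
  ratfun (denom qs) psi ->
  (forall c, c \in Cs -> exists w, forall z, cn (z - c) = s -> z \notin qs /\ 0 < Re (w * psi z)) ->
  psi z0 <> 0.
Proof.
move=> s0 Cs0 disj cover out [k [P [sP HP]]] circ psi0.
have zq : z0 \notin qs.
  apply/negP => /cover/hasP[c cC h]; have := out c cC; lra.
have z0P : P.[z0] = 0 by rewrite -HP ?denom_neq0 // psi0 mul0r.
have P0 : P != 0.
  apply/eqP => P0; case: Cs Cs0 circ {disj cover out} => // c Cs _ /(_ c (mem_head _ _))[w H].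
  have [|zqs] := H (c + s%:C); first by rewrite addrC addKr cn_pos // ltW.
  have /eqP := HP _ (denom_neq0 zqs); rewrite P0 horner0 mulf_eq0 expf_eq0.
  by rewrite (negbTE (denom_neq0 zqs)) andbF orbF => /eqP ->; rewrite mulr0 ltxx.
have [rs Prs] := closed_field_poly_normal P.
have lc0 : lead_coef P != 0 by rewrite lead_coef_eq0.
have PE z : P.[z] = lead_coef P * \prod_(a <- rs) (z - a).
  by rewrite {1}Prs hornerZ -denomE.
have sR : size rs = (size P).-1.
  by rewrite {1}Prs size_scale // size_prod_XsubC.
have z0rs : z0 \in rs.
  apply/negPn/negP => nz; have := denom_neq0 nz; rewrite denomE => h.
  by move/eqP: z0P; rewrite PE mulf_eq0 (negbTE lc0) (negbTE h).
have cnt c : c \in Cs -> count (fun a => cn (a - c) < s) rs =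
   (k * count (fun a => (cn (a - c) < s)%R) qs)%N.
  move=> cC; have [w H] := circ c cC.
  rewrite (@zeros_eq_poles R c s rs (flatten (nseq k qs)) (w * lead_coef P)) //.
    by rewrite count_flatten map_nseq sumn_nseq mulnC.
  move=> z zc; have [zqs Hw] := H z zc.
  have Dk : \prod_(q <- flatten (nseq k qs)) (z - q) = (denom qs).[z] ^+ k.
    rewrite big_flatten /= denomE; elim: (k) => [|m IH]; first by rewrite big_nil.
    by rewrite /= big_cons IH exprS.
  rewrite Dk -mulrA (mulrA (lead_coef P)) -PE -HP ?denom_neq0 // mulfK //.
  by rewrite expf_neq0 // denom_neq0.
have h1 : (\sum_(c <- Cs) count (fun a => (cn (a - c) < s)%R) rs < size rs)%N.
  rewrite count_swap (big_rem z0) //=.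
  have -> : count (fun c => cn (z0 - c) < s) Cs = 0%N.
    apply/eqP; rewrite -leqn0 leqNgt -has_count; apply/hasPn => c /out.
    by rewrite -leNgt => /ltW.
  rewrite add0n -(prednK (_ : 0 < size rs)%N); last by case: (rs) z0rs.
  rewrite ltnS -(size_rem z0rs); elim: (rem z0 rs) => [|a l IH]; first by rewrite big_nil.
  by rewrite big_cons /= -add1n leq_add.
have h2 : (k * size qs <= \sum_(c <- Cs) count (fun a => (cn (a - c) < s)%R) rs)%N.
  rewrite big_seq (eq_bigr _ cnt) -big_seq -big_distrr /= leq_mul2l; apply/orP; right.
  rewrite count_swap.
  have : forall q, q \in qs -> (1 <= count (fun c => (cn (q - c) < s)%R) Cs)%N.
    by move=> q /cover; rewrite has_count.
  elim: (qs) => [|q l IH] H //.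
  rewrite big_cons /= -add1n leq_add ?H ?mem_head // IH // => x xl.
  by apply: H; rewrite in_cons xl orbT.
have h3 : (size rs <= k * size qs)%N.
  by rewrite sR; move: sP; rewrite /denom size_prod_XsubC /=; case: (size P).
by have := leq_trans h1 (leq_trans h3 h2); rewrite ltnn.
Qed.

End RationalCurves.

(** * The two curves and the point of the rational hull *)

Definition dom (R : realType) (u : R) : Prop := 0 <= u <= 2.

Lemma dom_bdd (R : realType) (f : R -> R[i]) : ccont f ->
  exists2 M : R, 0 <= M & forall t, dom t -> cn (f t) <= M.
Proof.
move=> cf; have [|M HM] := @bounded_above R _ 0 2 _ (rcont_cn cf); first by [].
exists M => //; apply: le_trans (HM 0 _); rewrite ?cn_ge0 // lexx //=.
Qed.

Lemma curve_bdd (R : realType) (G : R -> 'rV[R[i]]_3) :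
  (forall i, ccont (fun u => G u ord0 i)) ->
  exists M : R, forall i k, dom i -> cn (G i ord0 k) <= M.
Proof.
move=> Gc.
have [M1 p1 H1] := dom_bdd (Gc (@Ordinal 3 0 isT)).
have [M2 p2 H2] := dom_bdd (Gc (@Ordinal 3 1 isT)).
have [M3 p3 H3] := dom_bdd (Gc (@Ordinal 3 2 isT)).
exists (M1 + M2 + M3) => t k dt.
have := H1 t dt; have := H2 t dt; have := H3 t dt.
case: k => [[|[|[|]]] hk] //; rewrite (bool_irrelevance hk isT); lra.
Qed.

Section Curves.
Variable R : realType.
Implicit Types (t u : R) (y c z : R[i]).

Definition shift1 : R[i] := 100%:C.
Lemma shift2E : shift2 R = shift1 + shift1.
Proof. by rewrite /shift2 /shift1 -rmorphD /=; congr (_%:C); ring. Qed.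
Lemma cn_shift1 : cn shift1 = 100. Proof. by rewrite cn_pos. Qed.

Definition outer1 : R[i] := far (zarc 1 - shift2 R).
(** Normalized so that the third coordinates of both curves vanish at u = 2. *)
Definition mu : R[i] := ((zarc 1 - shift1) * outer1)^-1.
(** The height, continued on [1, 2] by 1 - u: this is the link that leads from
the Cantor set to the common end point of the two curves. *)
Definition level u : R := height u - clamp (u - 1).
(** The boundary values, continued on [1, 2] by a segment ending at - outer1,
the value that the junction requires. *)
Definition inner u : R[i] := bval u + (clamp (u - 1))%:C * (- outer1 - bval 1).
Definition outer u : R[i] := far (zarc u - shift2 R).

Definition vec3 (a b c : R[i]) : 'rV[R[i]]_3 := \row_i nth 0 [:: a; b; c] i.

Definition curveA u := vec3 (outer u) (inner u) (mu * (zarc u - shift1) * outer u + (level u)%:C).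
(** The counterpart of curveA under z |-> - z, which exchanges the two copies of
the Cantor set; the transform is odd. *)
Definition curveB u := vec3 (- inner u) (- outer u) (mu * (zarc u - shift1) * inner u - (level u)%:C).
(** The value at 0 of the map of which ratF n is the n-th rational approximant.
*)
Definition hull_pt := vec3 (far (- shift1)) (far shift1) 0.

Lemma vec3_inj a b c a' b' c' : vec3 a b c = vec3 a' b' c' -> [/\ a = a', b = b' & c = c'].
Proof.
move=> /rowP E; split.
- by have := E (@Ordinal 3 0 isT); rewrite !mxE.
- by have := E (@Ordinal 3 1 isT); rewrite !mxE.
- by have := E (@Ordinal 3 2 isT); rewrite !mxE.
Qed.

Lemma zarc_far u : 195 <= cn (zarc u - shift2 R).
Proof. by apply: far_shift; have := cn_zarc u; lra. Qed.

Lemma outer_cont : ccont outer.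
Proof.
apply: (@ccont_lip R _ (@far R) (fun z => 3 <= cn z) 1).
- by move=> x y hx hy; rewrite mul1r; exact: far_lip.
- by move=> t; have := zarc_far t; lra.
- by apply: ccontB; [exact: zarc_cont|exact: ccont_cst].
Qed.
Lemma clamp1_cont : rcont (fun u : R => clamp (u - 1)).
Proof.
apply: (@rcont_comp R (@clamp R) (fun u => u - 1)); first exact: rcont_clamp.
apply: (@rcont_lip _ _ 1) => s t; rewrite mul1r (_ : s - 1 - (t - 1) = s - t) //; ring.
Qed.
Lemma inner_cont : ccont inner.
Proof.
apply: ccontD; first exact: bval_cont.
by apply: ccontM; [exact/ccont_real/clamp1_cont|exact: ccont_cst].
Qed.
Lemma level_cont : rcont level.
Proof.
apply: rcontD; first exact: height_cont.
by apply/rcontP => x; apply: cvgN; exact: (rcontP _).1 clamp1_cont x.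
Qed.

Lemma ccont_vec3 (f g h : R -> R[i]) : ccont f -> ccont g -> ccont h ->
  forall i, ccont (fun u => vec3 (f u) (g u) (h u) ord0 i).
Proof.
move=> cf cg ch [[|[|[|]]] hi] //.
- by apply: ccont_ext cf => u; rewrite mxE.
- by apply: ccont_ext cg => u; rewrite mxE.
- by apply: ccont_ext ch => u; rewrite mxE.
Qed.

Lemma factor_cont : ccont (fun u => mu * (zarc u - shift1)).
Proof.
apply: ccontM; first exact: ccont_cst.
by apply: ccontB; [exact: zarc_cont|exact: ccont_cst].
Qed.

Lemma curveA_cont i : ccont (fun u => curveA u ord0 i).
Proof.
apply: ccont_vec3; [exact: outer_cont|exact: inner_cont|].
by apply: ccontD; [apply: ccontM; [exact: factor_cont|exact: outer_cont]|exact/ccont_real/level_cont].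
Qed.
Lemma curveB_cont i : ccont (fun u => curveB u ord0 i).
Proof.
apply: ccont_vec3; [exact/ccontN/inner_cont|exact/ccontN/outer_cont|].
by apply: ccontB; [apply: ccontM; [exact: factor_cont|exact: inner_cont]|exact/ccont_real/level_cont].
Qed.

Lemma level_main t : 0 <= t <= 1 -> level t = height t.
Proof. by move=> t01; rewrite /level clamp_le0 ?subr0 //; lra. Qed.
Lemma inner_main t : 0 <= t <= 1 -> inner t = bval t.
Proof. by move=> t01; rewrite /inner clamp_le0 ?mul0r ?addr0 //; lra. Qed.

Lemma centers_disc n c : c \in centers R n -> forall y, cn (y - c) <= 2 * rho R ^+ n -> cn y <= 2.
Proof.
move=> /centers_bound h y; have := ler_cnD (y - c) c; rewrite subrK; lra.
Qed.

Lemma circle_off n c c' y : c \in centers R n -> c' \in centers R n ->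
  cn (y - c) = 2 * rho R ^+ n -> y != c'.
Proof.
elim: n c c' y => [|n IH] c c' y.
  rewrite !inE => /eqP -> /eqP ->; rewrite subr0 -cn_gt0 => ->.
  by rewrite expr0; lra.
move=> /centersSP[d [c1 [hd hc1 cE]]] /centersSP[d' [c1' [hd' hc1' cE']]] hy.
have rC := rhoC_neq0 R; have r0 := rho_gt0 R.
pose y' := (y - d) / (rho R)%:C.
have yE : y = d + (rho R)%:C * y' by rewrite /y' mulrC divfK // addrC subrK.
clearbody y'.
have hy' : cn (y' - c1) = 2 * rho R ^+ n.
  move: hy; rewrite yE cE (_ : d + _ - _ = (rho R)%:C * (y' - c1)); last by ring.
  by rewrite cnM cn_rho exprS mulrCA => /mulfI; apply; rewrite gt_eqF.
have [dd|dd] := eqVneq d d'.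
  rewrite yE cE' -dd (inj_eq (addrI d)) (inj_eq (mulfI rC)).
  exact: IH hc1 hc1' hy'.
apply/eqP => E; have := digits_sep hd hd' dd.
have := centers_disc hc1 (y := y'); rewrite hy' lexx => /(_ isT) y2.
have := centers_bound hc1'; have := rhoX_ge0 R n.
have := ler_cnB ((rho R)%:C * c1') ((rho R)%:C * y').
rewrite (_ : (rho R)%:C * c1' - (rho R)%:C * y' = d - d'); last first.
  by move: E; rewrite yE cE' => E; rewrite -[d](addrK ((rho R)%:C * y')) E; ring.
by rewrite !cnM !cn_rho /rho; lra.
Qed.

(** Distinct digits are at distance at least 2, and pieces of the next
generation stay within 2 rho of their digit; then rescale. *)
Lemma centers_disjoint n (a : R[i]) : (count (fun c => (cn (a - c) < 2 * rho R ^+ n)%R) (centers R n) <= 1)%N.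
Proof.
elim: n a => [|n IH] a; first by rewrite /= addn0 leq_b1.
have r0 := rho_gt0 R; have rC := rhoC_neq0 R.
have E d : count (fun c => cn (a - c) < 2 * rho R ^+ n.+1) [seq d + (rho R)%:C * c | c <- centers R n] =
  count (fun c => cn ((a - d) / (rho R)%:C - c) < 2 * rho R ^+ n) (centers R n).
  rewrite count_map; apply: eq_count => c /=.
  rewrite (_ : a - (d + _) = (rho R)%:C * ((a - d) / (rho R)%:C - c)); last by field.
  by rewrite cnM cn_rho exprS mulrCA ltr_pM2l.
have Z d : d \in digits R -> count (fun c => cn ((a - d) / (rho R)%:C - c) < 2 * rho R ^+ n) (centers R n) != 0%N ->
   cn (a - d) < 2 * rho R.
  move=> hd; rewrite -lt0n -has_count => /hasP[c hc h].
  have := centers_bound hc; have := ler_cnD ((a - d) / (rho R)%:C - c) c.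
  rewrite subrK cn_div cn_rho => h1 h2.
  have : cn (a - d) / rho R < 2 by lra.
  by rewrite ltr_pdivrMr.
have U d d' : d \in digits R -> d' \in digits R -> d != d' ->
   cn (a - d) < 2 * rho R -> cn (a - d') < 2 * rho R -> False.
  move=> hd hd' dd h1 h2; have := digits_sep hd hd' dd.
  by have := cn_tri a d d'; rewrite (cnB d a); rewrite /rho in h1 h2; lra.
rewrite centersS; have dsub : {subset digits R <= digits R} by [].
have K (l : seq R[i]) : uniq l -> {subset l <= digits R} ->
  (count (fun c => (cn (a - c) < 2 * rho R ^+ n.+1)%R) [seq (d + (rho R)%:C * c)%R | d <- l, c <- centers R n] <= 1)%N /\
  (count (fun c => (cn (a - c) < 2 * rho R ^+ n.+1)%R) [seq (d + (rho R)%:C * c)%R | d <- l, c <- centers R n] != 0%N ->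
   exists2 d, d \in l & cn (a - d) < 2 * rho R).
  elim: l => [|d l IHl] //= /andP[dl ul] sub.
  have [k1 k2] := IHl ul (fun x hx => sub x (mem_behead (s := d :: l) hx)).
  rewrite count_cat E; have hd := sub d (mem_head _ _).
  move: (IH ((a - d) / (rho R)%:C)) (Z d hd).
  case: (count _ (centers R n)) => [|[|//]] _ Zd.
    rewrite add0n; split => // /k2[d' d'l h]; exists d' => //.
    by rewrite in_cons d'l orbT.
  have {}Zd := Zd isT.
  case: (count _ _) k1 k2 => [|m] k1 k2.
    by rewrite addn0; split => // _; exists d => //; exact: mem_head.
  exfalso; have [d' d'l h] := k2 isT.
  apply: (U d d' hd _ _ Zd h); first by apply: sub; rewrite in_cons d'l orbT.
  by apply: contraNneq dl => ->.
exact: (K _ (uniq_digits R) dsub).1.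
Qed.

Definition allcenters n : seq R[i] := [seq c - shift1 | c <- centers R n] ++ [seq shift1 - c | c <- centers R n].

Lemma allcenters_disjoint n (a : R[i]) :
  (count (fun c => (cn (a - c) < 2 * rho R ^+ n)%R) (allcenters n) <= 1)%N.
Proof.
rewrite /allcenters count_cat !count_map.
rewrite (@eq_count _ _ (fun c => cn (a + shift1 - c) < 2 * rho R ^+ n)); last first.
  by move=> c /=; congr (cn _ < _); ring.
rewrite [X in (_ + X)%N](@eq_count _ _ (fun c => cn (shift1 - a - c) < 2 * rho R ^+ n)); last first.
  by move=> c /=; rewrite cnB; congr (cn _ < _); ring.
have h1 := centers_disjoint n (a + shift1); have h2 := centers_disjoint n (shift1 - a).
have N b : count (fun c => cn (b - c) < 2 * rho R ^+ n) (centers R n) != 0%N -> cn b <= 2.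
  rewrite -lt0n -has_count => /hasP[c hc /ltW]; exact: centers_disc.
case: (count _ _) h1 (N (a + shift1)) => [|[|//]] _ n1; first by rewrite add0n.
case: (count _ _) h2 (N (shift1 - a)) => [|[|//]] _ n2; first by rewrite addn0.
exfalso; have := n1 isT; have := n2 isT.
have := ler_cnD (a + shift1) (shift1 - a); rewrite (_ : a + shift1 + (shift1 - a) = shift2 R); last first.
  by rewrite shift2E; ring.
by rewrite cn_shift2; lra.
Qed.

Lemma curves_bdd : exists M : R, forall t i, 0 <= t <= 1 -> cn (curveA t ord0 i) <= M /\ cn (curveB t ord0 i) <= M.
Proof.
have [M HM] := curve_bdd curveA_cont; have [L HL] := curve_bdd curveB_cont.
exists (Num.max M L) => t i t01; rewrite !le_max HM ?HL ?orbT //; rewrite /dom; lra.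
Qed.

Definition ratF n z := vec3 (approx n (z - shift1)) (approx n (z + shift1)) (mu * (z * approx n (z - shift1))).

Lemma approx_plus n z : approx n (z + shift1) =
  ((1 / 4) ^+ n)%:C * \sum_(q <- [seq c - shift1 | c <- centers R n]) (z - q)^-1.
Proof.
rewrite approx_centers big_map; congr (_ * _); apply: eq_bigr => c _; congr (_^-1); ring.
Qed.
Lemma approx_minus n z : approx n (z - shift1) =
  ((1 / 4) ^+ n)%:C * \sum_(q <- [seq shift1 - c | c <- centers R n]) (z - q)^-1.
Proof.
rewrite -[z - shift1]opprK approx_odd approx_centers big_map -mulrN; congr (_ * _).
rewrite -sumrN; apply: eq_bigr => c _; rewrite -invrN; congr (_^-1); ring.
Qed.

Lemma ratF_ratfun n i : ratfun (denom (allcenters n)) (fun z => ratF n z ord0 i).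
Proof.
have P (l : seq R[i]) : {subset l <= allcenters n} ->
   ratfun (denom (allcenters n)) (fun z => ((1 / 4) ^+ n)%:C * \sum_(q <- l) (z - q)^-1).
  move=> sl; apply: ratfunM; first exact: ratfun_cst.
  by apply: ratfun_sum => q /sl ql; exact: ratfun_pole.
have s1 : {subset [seq c - shift1 | c <- centers R n] <= allcenters n}.
  by move=> q; rewrite mem_cat => ->.
have s2 : {subset [seq shift1 - c | c <- centers R n] <= allcenters n}.
  by move=> q; rewrite mem_cat => ->; rewrite orbT.
case: i => [[|[|[|]]] hi] //.
- by apply: ratfun_ext (P _ s2) => z; rewrite mxE /= approx_minus.
- by apply: ratfun_ext (P _ s1) => z; rewrite mxE /= approx_plus.
apply: (@ratfun_ext _ _ (fun z => mu * (((1 / 4) ^+ n)%:C *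
    \sum_(q <- [seq shift1 - c | c <- centers R n]) z / (z - q)))).
  move=> z; rewrite mxE /= approx_minus; congr (_ * _); rewrite mulrCA; congr (_ * _).
  by rewrite mulr_sumr.
apply: ratfunM; first exact: ratfun_cst.
apply: ratfunM; first exact: ratfun_cst.
by apply: ratfun_sum => q /s2 ql; exact: ratfun_pole1.
Qed.

(** The parameter t is that of a point of the Cantor set, where the height
vanishes and does not disturb the third coordinate. *)
Lemma curves_approx : exists2 C : R, 0 <= C & forall n c, c \in centers R n ->
  exists2 t, 0 <= t <= 1 & forall y, cn (y - c) = 2 * rho R ^+ n ->
    forall i, cn (ratF n (y - shift1) ord0 i - curveA t ord0 i) <= C * (31 / 32) ^+ n /\
      cn (ratF n (shift1 - y) ord0 i - curveB t ord0 i) <= C * (31 / 32) ^+ n.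
Proof.
have [C C0 H] := circle_approx R; have [B HB] := bval_bdd R.
have B0 : 0 <= B by apply: le_trans (HB 0); exact: cn_ge0.
have m0 := cn_ge0 mu.
have mC : 0 <= cn mu * C by rewrite mulr_ge0.
have mB : 0 <= cn mu * B by rewrite mulr_ge0.
(* Collects the bounds a1, a6, a7 below and those of circle_approx. *)
exists (9 + C + cn mu * (1000 + 102 * C + 6 * B)).
  by apply: addr_ge0; [lra|apply: mulr_ge0 => //; lra].
move=> n c hc; have [t [t01 ht hct Hy]] := H n c hc.
exists t => // y hy; have [y2 hf] := Hy y hy.
have p1 : rho R ^+ n <= (31 / 32) ^+ n.
  by apply: lerXn2r; rewrite ?nnegrE /rho; lra.
have r0 := rhoX_ge0 R n.
have p2 : 0 <= (31 / 32 : R) ^+ n by rewrite exprn_ge0 //; lra.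
have yt : cn (y - zarc t) <= 6 * rho R ^+ n by have := cn_tri c y (zarc t); rewrite hy; lra.
have fy : 195 <= cn (y - shift2 R) by apply: far_shift; lra.
have fe := zarc_far t.
have a1 : cn (approx n (y - shift2 R) - outer t) <= 9 * rho R ^+ n.
  apply: le_trans (cn_tri (approx n (zarc t - shift2 R)) _ _) _.
  have := @farP R n (zarc t - shift2 R) ltac:(lra).
  have := @approx_lip R n (y - shift2 R) (zarc t - shift2 R) ltac:(lra) ltac:(lra).
  by rewrite (_ : y - shift2 R - (zarc t - shift2 R) = y - zarc t); [rewrite /outer; lra|ring].
have a2 : cn (outer t) <= 4 by apply: far_bdd; lra.
have a3 : cn (approx n (y - shift2 R)) <= 13.
  have := cn_tri (outer t) (approx n (y - shift2 R)) 0; rewrite !subr0.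
  by have := rhoX_le1 R n; lra.
have a4 : cn (zarc t - shift1) <= 102 by have := ler_cnB (zarc t) shift1; rewrite cn_shift1; have := cn_zarc t; lra.
have a5 : cn (y - shift1) <= 102 by have := ler_cnB y shift1; rewrite cn_shift1; lra.
have a6 : cn (mu * ((y - shift1) * approx n (y - shift2 R)) - (mu * (zarc t - shift1) * outer t + (level t)%:C))
   <= cn mu * (1000 * rho R ^+ n).
  rewrite level_main // ht addr0.
  rewrite (_ : _ - _ = mu * ((y - zarc t) * approx n (y - shift2 R) + (zarc t - shift1) * (approx n (y - shift2 R) - outer t))); last by ring.
  rewrite cnM ler_wpM2l // (le_trans (ler_cnD _ _)) // !cnM.
  have := ler_pM (cn_ge0 _) (cn_ge0 _) yt a3.
  have := ler_pM (cn_ge0 _) (cn_ge0 _) a4 a1.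
  lra.
have a7 : cn (mu * ((shift1 - y) * - approx n y) - (mu * (zarc t - shift1) * bval t - (level t)%:C))
   <= cn mu * (102 * (C * (31 / 32) ^+ n) + 6 * rho R ^+ n * B).
  rewrite level_main // ht subr0.
  rewrite (_ : _ - _ = mu * ((y - shift1) * (approx n y - bval t) + (y - zarc t) * bval t)); last by ring.
  rewrite cnM ler_wpM2l // (le_trans (ler_cnD _ _)) // !cnM.
  have := ler_pM (cn_ge0 _) (cn_ge0 _) a5 hf.
  have := ler_pM (cn_ge0 _) (cn_ge0 _) yt (HB t).
  lra.
have E1 : y - shift1 - shift1 = y - shift2 R by rewrite shift2E; ring.
have E2 : y - shift1 + shift1 = y by ring.
have E3 : shift1 - y - shift1 = - y by ring.
have E4 : shift1 - y + shift1 = - (y - shift2 R) by rewrite shift2E; ring.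
set q := (31 / 32) ^+ n in p1 p2 hf a7 *.
have mq : 0 <= cn mu * q by rewrite mulr_ge0.
have mCq : 0 <= cn mu * C * q by rewrite mulr_ge0.
have mBq : 0 <= cn mu * B * q by rewrite mulr_ge0.
have Cq : 0 <= C * q by rewrite mulr_ge0.
have mr : cn mu * rho R ^+ n <= cn mu * q by rewrite ler_wpM2l.
have mrB : cn mu * B * rho R ^+ n <= cn mu * B * q by rewrite ler_wpM2l.
have ->: (9 + C + cn mu * (1000 + 102 * C + 6 * B)) * q =
  9 * q + C * q + 1000 * (cn mu * q) + 102 * (cn mu * C * q) + 6 * (cn mu * B * q) by ring.
have b6 : cn mu * (1000 * rho R ^+ n) <= 1000 * (cn mu * q) by lra.
have b7 : cn mu * (102 * (C * q) + 6 * rho R ^+ n * B) <= 102 * (cn mu * C * q) + 6 * (cn mu * B * q).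
  by lra.
have nx (x w : R[i]) : cn (- x - - w) = cn (x - w) by rewrite -opprD cnN.
case=> [[|[|[|]]] hi] //; rewrite !mxE /= ?E1 ?E2 ?E3 ?E4 ?approx_odd ?nx ?inner_main //; split; try lra.
Qed.

(** If f - f(hull_pt) vanished nowhere on the curves over [0, 1], it would be
bounded below there, and for large n the function f o ratF n - f (ratF n 0)
would be close to a nonzero constant on each circle while having the zero 0
outside of the discs. *)
Theorem hull_point (f : 'rV[R[i]]_3 -> R[i]) : polyfun f ->
  exists2 u, 0 <= u <= 1 & f (curveA u) = f hull_pt \/ f (curveB u) = f hull_pt.
Proof.
move=> pf; apply: contrapT => no.
have nA u : 0 <= u <= 1 -> 0 < cn (f (curveA u) - f hull_pt).
  move=> u01; rewrite cn_gt0 subr_eq0; apply/eqP => E; apply: no; exists u => //; by left.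
have nB u : 0 <= u <= 1 -> 0 < cn (f (curveB u) - f hull_pt).
  move=> u01; rewrite cn_gt0 subr_eq0; apply/eqP => E; apply: no; exists u => //; by right.
have [|m1 m10 H1] := @pos_lower R _ 0 1 ler01 _ nA.
  by apply/rcont_cn/ccontB; [exact: (polyfun_ccont curveA_cont)|exact: ccont_cst].
have [|m2 m20 H2] := @pos_lower R _ 0 1 ler01 _ nB.
  by apply/rcont_cn/ccontB; [exact: (polyfun_ccont curveB_cont)|exact: ccont_cst].
pose m := Num.min m1 m2; have m0 : 0 < m by rewrite lt_min m10.
have [M HM] := curves_bdd; have [C C0 HC] := curves_approx.
have M0 : 0 <= M by apply: le_trans (HM 0 ord0 _).1; rewrite ?cn_ge0 // lexx ler01.
pose C' := C + 3.
have [L L0 HL] := polyfun_lipschitz (M + C + 10) pf.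
have q01 : 0 <= (31 / 32 : R) < 1 by lra.
have [n /(_ n (leqnn n)) hn] := @expr_le_eps R (31 / 32) (m / 3) (L * C') q01 ltac:(lra).
have p1 : rho R ^+ n <= (31 / 32) ^+ n.
  by apply: lerXn2r; rewrite ?nnegrE /rho; lra.
have r0 := rhoX_ge0 R n.
set q := (31 / 32) ^+ n in p1 hn HC.
have q1 : q <= 1 by rewrite /q exprn_ile1 //; lra.
have q0 : 0 <= q by lra.
have Cq : C * q <= C by rewrite ler_piMr.
have Cq0 : 0 <= C * q by rewrite mulr_ge0.
have LC' : L * (C * q) <= m / 3.
  by apply: le_trans hn; rewrite /C' mulrDr mulrDl mulrA lerDl !mulr_ge0.
have T3 : 3 <= cn shift1 by rewrite cn_shift1; lra.
have T3' : 3 <= cn (- shift1) by rewrite cnN.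
have r1 := rhoX_le1 R n.
have P0 : cn (f (ratF n 0) - f hull_pt) <= m / 3.
  have b1 := farP n T3; have b2 := farP n T3'.
  have b3 := far_bdd T3; have b4 := far_bdd T3'.
  have dd i : cn (ratF n 0 ord0 i - hull_pt ord0 i) <= 3 * rho R ^+ n.
    case: i => [[|[|[|]]] hi] //; rewrite !mxE /= ?sub0r ?add0r //.
    by rewrite mul0r mulr0 subr0 cn0; lra.
  have bb i : cn (hull_pt ord0 i) <= 4.
    by case: i => [[|[|[|]]] hi] //; rewrite !mxE /=; [exact: b4|exact: b3|by rewrite expr0n /= addr0 sqrtr0 ler0n].
  have [] := HL (ratF n 0) _.
    by move=> i; have := cn_tri (hull_pt ord0 i) (ratF n 0 ord0 i) 0; rewrite !subr0;
      have := dd i; have := bb i; lra.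
  move=> _ /(_ hull_pt (3 * rho R ^+ n)) => K.
  apply: le_trans (K _ dd) _; first by move=> i; have := bb i; lra.
  rewrite ger0_norm; last by lra.
  apply: le_trans hn; rewrite -mulrA ler_wpM2l // /C' mulrDl; lra.
have circ (G : R -> 'rV[R[i]]_3) (t : R) z : (forall i, cn (G t ord0 i) <= M) ->
    (forall i, cn (ratF n z ord0 i - G t ord0 i) <= C * q) ->
    m <= cn (f (G t) - f hull_pt) -> 0 < Re ((f (G t) - f hull_pt)^-1 * (f (ratF n z) - f (ratF n 0))).
  move=> GM Gd mle.
  have b0 : f (G t) - f hull_pt != 0 by rewrite -cn_gt0; lra.
  have [] := HL (ratF n z) _.
    by move=> i; have := cn_tri (G t ord0 i) (ratF n z ord0 i) 0; rewrite !subr0;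
      have := Gd i; have := GM i; lra.
  move=> _ /(_ (G t) (C * q)) K.
  have {}K : cn (f (ratF n z) - f (G t)) <= m / 3.
    apply: le_trans (K _ Gd) _; first by move=> i; have := GM i; lra.
    by rewrite ger0_norm.
  have S : cn ((f (G t) - f hull_pt)^-1 * (f (ratF n z) - f (ratF n 0)) - 1) < 1.
    rewrite (_ : _ - 1 = ((f (ratF n z) - f (G t)) - (f (ratF n 0) - f hull_pt)) / (f (G t) - f hull_pt)); last first.
      by field.
    rewrite cn_div ltr_pdivrMr ?cn_gt0 // mul1r.
    have := ler_cnB (f (ratF n z) - f (G t)) (f (ratF n 0) - f hull_pt); lra.
  have := Re_cn ((f (G t) - f hull_pt)^-1 * (f (ratF n z) - f (ratF n 0)) - 1).
  by rewrite ReD ReN ler_norml /= => /andP[]; lra.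
apply: (@no_outer_zero R (allcenters n) (allcenters n) (2 * rho R ^+ n)
  (fun z => f (ratF n z) - f (ratF n 0)) 0).
- by rewrite mulr_gt0 // rhoX_gt0.
- by rewrite size_cat !size_map size_centers addn_gt0 expn_gt0.
- exact: allcenters_disjoint.
- move=> c hc; apply/hasP; exists c => //.
  by rewrite subrr cn0 mulr_gt0 // rhoX_gt0.
- have far_c c : c \in centers R n -> 98 <= cn (shift1 - c).
    by move=> /centers_bound h; have := lerB_cnB shift1 c; rewrite cn_shift1; lra.
  move=> c; rewrite mem_cat => /orP[] /mapP[c' /far_c h ->]; rewrite sub0r cnN; have := cnB c' shift1; lra.
- apply: ratfunD; last exact: ratfun_cst.
  exact: (ratfun_poly (ratF_ratfun n) pf).
- have cross c c' y : c \in centers R n -> c' \in centers R n -> cn (y - c) = 2 * rho R ^+ n ->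
     y - shift1 != shift1 - c'.
    move=> hc hc' hy; apply/eqP => E.
    have y2 : cn y <= 2 by apply: (centers_disc hc); rewrite hy.
    have := centers_bound hc'; have := ler_cnD y c'.
    rewrite (_ : y + c' = shift2 R); first by rewrite cn_shift2; lra.
    by rewrite shift2E -[y](subrK shift1) E; ring.
  move=> c; rewrite mem_cat => /orP[] /mapP[c' hc' ->].
    have [t t01 Ht] := HC n c' hc'.
    exists (f (curveA t) - f hull_pt)^-1 => z hz.
    have hz' : cn (z + shift1 - c') = 2 * rho R ^+ n by rewrite -hz; congr cn; ring.
    split.
      rewrite mem_cat negb_or; apply/andP; split; apply/mapP => -[c2 hc2 E].
        by have /eqP := circle_off hc' hc2 hz'; apply; rewrite E subrK.
      by have /eqP := cross _ _ _ hc' hc2 hz'; apply; rewrite addrK.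
    have zE : z = z + shift1 - shift1 by rewrite addrK.
    rewrite zE; apply: circ.
    + by move=> i; exact: (HM t i t01).1.
    + by move=> i; exact: (Ht _ hz' i).1.
    + by apply: le_trans (H1 t t01); rewrite ge_min lexx.
  have [t t01 Ht] := HC n c' hc'.
  exists (f (curveB t) - f hull_pt)^-1 => z hz.
  have hz' : cn (shift1 - z - c') = 2 * rho R ^+ n by rewrite -hz cnB; congr cn; ring.
  split.
    rewrite mem_cat negb_or; apply/andP; split; apply/mapP => -[c2 hc2 E].
      by have /eqP := cross _ _ _ hc' hc2 hz'; apply; rewrite E; ring.
    by have /eqP := circle_off hc' hc2 hz'; apply; rewrite E; ring.
  have zE : z = shift1 - (shift1 - z) by ring.
  rewrite zE; apply: circ.
  + by move=> i; exact: (HM t i t01).2.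
  + by move=> i; exact: (Ht _ hz' i).2.
  + by apply: le_trans (H2 t t01); rewrite ge_min lexx orbT.
- by rewrite subrr.
Qed.

End Curves.

(** * Uniform limits of polynomials *)

Section PolyApprox.
Variable R : realType.
Implicit Types (c y z : R[i]) (F : R[i] -> R[i]).

(** Radius 5 contains the path (within 2 of the origin) and the iterates of the
Picard scheme, which start within distance 2 of it. *)
Definition papx F := forall eps : R, 0 < eps -> exists p : {poly R[i]},
  forall y, cn y <= 5 -> cn (p.[y] - F y) <= eps.

Lemma papxD F G : papx F -> papx G -> papx (fun y => F y + G y).
Proof.
move=> pF pG eps e0; have e2 : 0 < eps / 2 by lra.
have [p Hp] := pF _ e2; have [q Hq] := pG _ e2; exists (p + q) => y y5.
rewrite hornerD (_ : _ - _ = (p.[y] - F y) + (q.[y] - G y)); last by ring.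
by have := ler_cnD (p.[y] - F y) (q.[y] - G y); have := Hp y y5; have := Hq y y5; lra.
Qed.

Lemma papxZ c F : papx F -> papx (fun y => c * F y).
Proof.
move=> pF eps e0; have c0 : 0 < cn c + 1 by have := cn_ge0 c; lra.
have [p Hp] := pF _ (divr_gt0 e0 c0); exists (c *: p) => y y5.
rewrite hornerZ -mulrBr cnM; have := Hp y y5; rewrite ler_pdivlMr // => h.
by have := cn_ge0 (p.[y] - F y); have := cn_ge0 c; lra.
Qed.

Lemma papx_ext F G : F =1 G -> papx F -> papx G.
Proof. by move=> /funext ->. Qed.

Lemma papx_sum (s : seq R[i]) (F : R[i] -> R[i] -> R[i]) :
  (forall c, c \in s -> papx (F c)) -> papx (fun y => \sum_(c <- s) F c y).
Proof.
elim: s => [|c s IH] H.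
  apply: (@papx_ext (fun=> 0)) => [y|]; first by rewrite big_nil.
  by move=> eps e0; exists 0 => y _; rewrite horner0 subrr cn0 ltW.
apply: (@papx_ext (fun y => F c y + \sum_(c <- s) F c y)).
  by move=> y; rewrite big_cons.
apply: papxD; first by apply: H; rewrite mem_head.
by apply: IH => d ds; apply: H; rewrite in_cons ds orbT.
Qed.

Lemma papx_lim F : (forall eps : R, 0 < eps -> exists2 G, papx G &
   forall y, cn y <= 5 -> cn (G y - F y) <= eps) -> papx F.
Proof.
move=> H eps e0; have e2 : 0 < eps / 2 by lra.
have [G pG HG] := H _ e2; have [p Hp] := pG _ e2; exists p => y y5.
by have := cn_tri (G y) p.[y] (F y); have := HG y y5; have := Hp y y5; lra.
Qed.

(** Geometric series in y / w, of ratio at most 1/2. *)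
Lemma papx_pole w : 10 <= cn w -> papx (fun y => (y - w)^-1).
Proof.
move=> w10; have w0 : w != 0 by rewrite -cn_gt0; lra.
have G N : exists p : {poly R[i]}, forall y, p.[y] * (y - w) = 1 - (y / w) ^+ N.
  elim: N => [|N [p Hp]]; first by exists 0 => y; rewrite horner0 mul0r expr0 subrr.
  exists (p - w^-1 *: ((w^-1 *: 'X) ^+ N)) => y.
  rewrite hornerD hornerN mulrBl Hp hornerZ horner_exp hornerZ hornerX exprS.
  rewrite [w^-1 * y]mulrC; set x := (y / w) ^+ N.
  by field.
move=> eps e0; have q01 : 0 <= (1 / 2 : R) < 1 by lra.
have [N /(_ N (leqnn N)) hN] := @expr_le_eps R (1 / 2) eps 1 q01 e0.
have [p Hp] := G N; exists p => y y5.
have yw : 5 <= cn (y - w) by rewrite cnB; have := lerB_cnB w y; lra.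
have yw0 : y - w != 0 by rewrite -cn_gt0; lra.
have -> : p.[y] - (y - w)^-1 = - (y / w) ^+ N / (y - w).
  by rewrite -[p.[y]](mulfK yw0) Hp; field.
rewrite cn_div cnN ler_pdivrMr; last by lra.
rewrite cnX cn_div mul1r in hN *.
have : (cn y / cn w) ^+ N <= (1 / 2) ^+ N.
  apply: lerXn2r; rewrite ?nnegrE ?divr_ge0 ?cn_ge0 //.
  by rewrite ler_pdivrMr; lra.
by have : eps * 1 <= eps * cn (y - w) by [rewrite ler_wpM2l; lra]; lra.
Qed.

Lemma papx_far : papx (fun y => far (y - shift2 R)).
Proof.
apply: papx_lim => eps e0.
have [n /(_ n (leqnn n)) hn] := @expr_le_eps R (rho R) eps 3 (rho_lt1 R) e0.
exists (fun y => approx n (y - shift2 R)); last first.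
  by move=> y y5; apply: le_trans (farP n _) hn; have := far_shift y5; lra.
apply: (@papx_ext (fun y => ((1 / 4) ^+ n)%:C * \sum_(c <- centers R n) (y - (shift2 R + c))^-1)).
  by move=> y; rewrite approx_centers; congr (_ * _); apply: eq_bigr => c _; rewrite opprD addrA.
apply: papxZ; apply: papx_sum => c /centers_bound hc; apply: papx_pole.
by have := lerB_cn (shift2 R) c; rewrite cn_shift2; have := rhoX_ge0 R n; lra.
Qed.

End PolyApprox.

Section UniformLimits.
Variables (R : realType) (N : nat) (I : Type) (pt : I -> 'rV[R[i]]_N) (D : I -> Prop).
Hypothesis ptB : exists M : R, forall i k, D i -> cn (pt i ord0 k) <= M.
Implicit Types (phi psi : I -> R[i]).

(** The uniform limits of polynomials on the curve pt over D: the functions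
whose values a point of the polynomial hull still sees. *)
Definition ulim phi := forall eps : R, 0 < eps -> exists2 f, polyfun f &
  forall i, D i -> cn (f (pt i) - phi i) <= eps.

Lemma ulim_poly f : polyfun f -> ulim (fun i => f (pt i)).
Proof. by move=> pf eps e0; exists f => // i _; rewrite subrr cn0 ltW. Qed.
Lemma ulim_cst c : ulim (fun=> c).
Proof. exact: ulim_poly (polyfun_cst _ c). Qed.
Lemma ulim_coord k : ulim (fun i => pt i ord0 k).
Proof. exact: ulim_poly (polyfun_coord _ k). Qed.
Lemma ulim_ext phi psi : (forall i, D i -> phi i = psi i) -> ulim phi -> ulim psi.
Proof.
by move=> E H eps e0; have [f pf Hf] := H eps e0; exists f => // i Di; rewrite -E ?Hf.
Qed.

Lemma ulim_bdd phi : ulim phi -> exists2 B : R, 0 <= B & forall i, D i -> cn (phi i) <= B.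
Proof.
move=> /(_ 1 ltr01)[f pf Hf]; have [M HM] := ptB.
have [L L0 HL] := polyfun_lipschitz M pf; exists (L + 1); first by lra.
move=> i Di; have [h _] := HL (pt i) (fun k => HM i k Di).
by have := cn_tri (f (pt i)) (phi i) 0; rewrite !subr0 (cnB (phi i)); have := Hf i Di; lra.
Qed.

Lemma ulimD phi psi : ulim phi -> ulim psi -> ulim (fun i => phi i + psi i).
Proof.
move=> H K eps e0; have e2 : 0 < eps / 2 by lra.
have [f pf Hf] := H _ e2; have [g pg Hg] := K _ e2.
exists (fun z => f z + g z); first exact: polyfunD.
move=> i Di; rewrite (_ : _ - _ = (f (pt i) - phi i) + (g (pt i) - psi i)); last by ring.
have := ler_cnD (f (pt i) - phi i) (g (pt i) - psi i); have := Hf i Di; have := Hg i Di.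
lra.
Qed.

Lemma ulimM phi psi : ulim phi -> ulim psi -> ulim (fun i => phi i * psi i).
Proof.
move=> H K eps e0; have [B B0 HB] := ulim_bdd H; have [C C0 HC] := ulim_bdd K.
pose M := B + C + 1; have M0 : 0 < M by rewrite /M; lra.
pose k := Num.min 1 (eps / M).
have k0 : 0 < k by rewrite lt_min ltr01 divr_gt0.
have k1 : k <= 1 by rewrite ge_min lexx.
have kM : k * M <= eps by rewrite -ler_pdivlMr // /k ge_min lexx orbT.
have [f pf Hf] := H _ k0; have [g pg Hg] := K _ k0.
exists (fun z => f z * g z); first exact: polyfunM.
move=> i Di.
rewrite (_ : _ - _ = (f (pt i) - phi i) * (g (pt i) - psi i) +
  ((f (pt i) - phi i) * psi i + phi i * (g (pt i) - psi i))); last by ring.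
apply: le_trans (ler_cnD _ _) _.
have := ler_cnD ((f (pt i) - phi i) * psi i) (phi i * (g (pt i) - psi i)).
rewrite !cnM.
have := ler_pM (cn_ge0 _) (cn_ge0 _) (Hf i Di) (le_trans (Hg i Di) k1).
have := ler_pM (cn_ge0 _) (cn_ge0 _) (Hf i Di) (HC i Di).
have := ler_pM (cn_ge0 _) (cn_ge0 _) (HB i Di) (Hg i Di).
rewrite /M in kM; lra.
Qed.

Lemma ulimN phi : ulim phi -> ulim (fun i => - phi i).
Proof.
move=> H; apply: ulim_ext (ulimM (ulim_cst (-1)) H) => i _.
by rewrite mulN1r.
Qed.

Lemma ulimB phi psi : ulim phi -> ulim psi -> ulim (fun i => phi i - psi i).
Proof. by move=> H K; apply: ulimD => //; exact: ulimN. Qed.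

Lemma ulimX phi n : ulim phi -> ulim (fun i => phi i ^+ n).
Proof.
move=> H; elim: n => [|n IH]; first exact: ulim_cst.
by apply: ulim_ext (ulimM H IH) => i _; rewrite exprS.
Qed.

Lemma ulim_horner (p : {poly R[i]}) phi : ulim phi -> ulim (fun i => p.[phi i]).
Proof.
move=> H; elim/poly_ind: p => [|p c IH].
  by apply: ulim_ext (ulim_cst 0) => i _; rewrite horner0.
apply: ulim_ext (ulimD (ulimM IH H) (ulim_cst c)) => i _.
by rewrite hornerMXaddC.
Qed.

Lemma ulim_lim phi : (forall eps : R, 0 < eps -> exists2 psi, ulim psi &
   forall i, D i -> cn (psi i - phi i) <= eps) -> ulim phi.
Proof.
move=> H eps e0; have e2 : 0 < eps / 2 by lra.
have [psi up Hp] := H _ e2; have [f pf Hf] := up _ e2; exists f => // i Di.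
by have := cn_tri (psi i) (f (pt i)) (phi i); have := Hf i Di; have := Hp i Di; lra.
Qed.

Lemma ulim_papx F phi : papx F -> (forall i, D i -> cn (phi i) <= 5) -> ulim phi ->
  ulim (fun i => F (phi i)).
Proof.
move=> pF p5 H; apply: ulim_lim => eps e0; have [p Hp] := pF _ e0.
exists (fun i => p.[phi i]); first exact: ulim_horner.
by move=> i /p5; exact: Hp.
Qed.

(** Picard iteration q |-> q + (2T)^2 (f(q - 2T) - f(phi - 2T)), which contracts
towards phi by far_conformal and keeps uniform limits of polynomials. *)
Lemma ulim_inverse phi : (forall i, D i -> cn (phi i) <= 2) ->
  ulim (fun i => far (phi i - shift2 R)) -> ulim phi.
Proof.
move=> p2 H.
have Q k : exists2 q, ulim q & forall i, D i -> cn (q i - phi i) <= 2 * (1 / 4) ^+ k.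
  elim: k => [|k [q uq Hq]].
    exists (fun=> 0); first exact: ulim_cst.
    by move=> i Di; rewrite expr0 sub0r cnN; have := p2 i Di; lra.
  have q5 i : D i -> cn (q i) <= 5.
    move=> Di; have := cn_tri (phi i) (q i) 0; rewrite !subr0.
    have : (1 / 4 : R) ^+ k <= 1 by rewrite exprn_ile1 //; lra.
    by have := Hq i Di; have := p2 i Di; lra.
  exists (fun i => shift2 R ^+ 2 * far (q i - shift2 R) + - shift2 R ^+ 2 * far (phi i - shift2 R) + q i).
    apply: ulimD => //; apply: ulimD; apply: ulimM => //; try exact: ulim_cst.
    exact (@ulim_papx (fun y => far (y - shift2 R)) q (@papx_far R) q5 uq).
  move=> i Di; have p5 : cn (phi i) <= 5 by have := p2 i Di; lra.
  have := far_conformal (q5 i Di) p5; rewrite addrA => h.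
  by apply: le_trans h _; rewrite exprS; have := Hq i Di; lra.
apply: ulim_lim => eps e0; have q01 : 0 <= (1 / 4 : R) < 1 by lra.
have [k /(_ k (leqnn k)) hk] := @expr_le_eps R (1 / 4) eps 2 q01 e0.
by have [q uq Hq] := Q k; exists q => // i Di; apply: le_trans (Hq i Di) hk.
Qed.

End UniformLimits.

(** * Polynomials telling the pieces of the Cantor set apart *)

Section RootIteration.
Variable R : realType.
Implicit Types (s z w : R[i]).

(** Newton iteration for z^-4 = 1, which is polynomial: it sends z to z (5 -
z^4) / 4. *)
Definition newton z : R[i] := z * (1 + (1 - z ^+ 4) / 4%:R).

Lemma cn4 : cn (4%:R : R[i]) = 4.
Proof. by rewrite -(rmorph_nat (real_complex R)) cn_pos. Qed.

(** The coefficients 160 + 80 + 15 + 1 sum up to 256, so the defect 1 - z^4 of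
modulus at most 1 is replaced by at most its square. *)
Lemma newton_defect z : 1 - newton z ^+ 4 = (1 - z ^+ 4) ^+ 2 *
  ((160%:R + 80%:R * (1 - z ^+ 4) + 15%:R * (1 - z ^+ 4) ^+ 2 + (1 - z ^+ 4) ^+ 3) / 256%:R).
Proof. by rewrite /newton; field. Qed.

(** The sector |arg z| < pi/4, which singles out the root 1 among the four. *)
Definition sector z := 0 < Re z /\ 0 < Re (z ^+ 2).

Lemma sqrtr2_sum (a b m : R) : 0 <= m -> a ^+ 2 + b ^+ 2 <= m ^+ 2 -> `|a| + `|b| <= 3 / 2 * m.
Proof.
move=> m0 h; rewrite -(@ler_pXn2r _ 2) ?nnegrE ?addr_ge0 ?mulr_ge0 //; last by lra.
have : (`|a| - `|b|) ^+ 2 >= 0 by exact: sqr_ge0.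
have := real_normK (num_real a); have := real_normK (num_real b).
have -> : (3 / 2 * m) ^+ 2 = 9 / 4 * m ^+ 2 by field.
by have := sqr_ge0 m; rewrite sqrrB sqrrD; lra.
Qed.

(** Besides the decrease of the defect, the iterate stays in the sector: z^4 has
positive real part, so |arg z| < pi/8, and the factor 1 + n with |n| <= 1/4
turns by less than pi/8. *)
Lemma newton_step z (q : R) : sector z -> q < 1 -> cn (1 - z ^+ 4) <= q ->
  sector (newton z) /\ cn (1 - newton z ^+ 4) <= q * cn (1 - z ^+ 4).
Proof.
move=> [z1 z2] q1 hz; set e := 1 - z ^+ 4 in hz *.
have e0 := cn_ge0 e.
have q0 : 0 <= q by lra.
have defect : cn (1 - newton z ^+ 4) <= q * cn e.
  rewrite newton_defect -/e cnM cnX cn_div.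
  have n256 : cn (256%:R : R[i]) = 256 by rewrite -(rmorph_nat (real_complex R)) cn_pos.
  have nat_cn n : cn (n%:R : R[i]) = n%:R by rewrite -(rmorph_nat (real_complex R)) cn_pos.
  have c2 : cn (e ^+ 2) <= 1 by rewrite cnX exprn_ile1 //; lra.
  have c3 : cn (e ^+ 3) <= 1 by rewrite cnX exprn_ile1 //; lra.
  have : cn (160%:R + 80%:R * e + 15%:R * e ^+ 2 + e ^+ 3) <= 256.
    have := ler_cnD (160%:R + 80%:R * e + 15%:R * e ^+ 2) (e ^+ 3).
    have := ler_cnD (160%:R + 80%:R * e) (15%:R * e ^+ 2).
    have := ler_cnD 160%:R (80%:R * e).
    by rewrite !(cnM 80%:R, cnM 15%:R) !nat_cn; lra.
  rewrite n256 => h.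
  have : cn e ^+ 2 * (cn (160%:R + 80%:R * e + 15%:R * e ^+ 2 + e ^+ 3) / 256) <= cn e ^+ 2 * 1.
    by rewrite ler_wpM2l ?sqr_ge0 // ler_pdivrMr // mul1r.
  have : cn e * cn e <= q * cn e by rewrite ler_wpM2r.
  rewrite expr2; lra.
split => //.
pose n := e / 4%:R.
have nb : cn n <= 1 / 4 by rewrite /n cn_div cn4; lra.
have newE : newton z = z * (1 + n) by [].
have rs4 : 0 < Re (z ^+ 4).
  have -> : z ^+ 4 = 1 - e by rewrite /e; ring.
  by rewrite ReD ReN /=; have := Re_cn e; rewrite ler_norml => /andP[]; lra.
set x := Re z in z1; set y := Im z.
have X2 : Re (z ^+ 2) = x ^+ 2 - y ^+ 2 by rewrite expr2 ReM -!expr2.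
have Y2 : Im (z ^+ 2) = 2 * (x * y) by rewrite expr2 ImM; rewrite -/x -/y; ring.
set X := Re (z ^+ 2) in z2 X2; set Y := Im (z ^+ 2) in Y2.
have X4 : 0 < X ^+ 2 - Y ^+ 2.
  by move: rs4; rewrite (_ : z ^+ 4 = z ^+ 2 * z ^+ 2); [rewrite ReM -!expr2|ring].
have YX : `|Y| <= X.
  rewrite -(@ler_pXn2r _ 2) ?nnegrE ?normr_ge0 ?(ltW z2) //.
  by rewrite real_normK ?num_real //; lra.
have yx : `|y| <= x.
  rewrite -(@ler_pXn2r _ 2) ?nnegrE ?normr_ge0 ?(ltW z1) //.
  by rewrite real_normK ?num_real //; lra.
have nr := le_trans (Re_cn n) nb; have ni := le_trans (Im_cn n) nb.
split.
  rewrite newE ReM ReD ImD /= -/x -/y add0r.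
  have : x * Re n >= - (x * (1/4)).
    have : `|x * Re n| <= x * (1 / 4) by rewrite normrM ger0_norm ?(ltW z1) // ler_wpM2l // ltW.
    by rewrite ler_norml => /andP[].
  have : y * Im n <= x * (1/4).
    have : `|y * Im n| <= x * (1 / 4) by rewrite normrM ler_pM.
    by rewrite ler_norml => /andP[].
  lra.
pose m := n + n + n ^+ 2.
have mE : newton z ^+ 2 = z ^+ 2 * (1 + m) by rewrite newE /m; ring.
have mb : cn m <= 9 / 16.
  have := ler_cnD (n + n) (n ^+ 2); have := ler_cnD n n.
  have : cn (n ^+ 2) <= (1 / 4) ^+ 2 by rewrite cnX lerXn2r ?nnegrE ?cn_ge0 //; lra.
  rewrite /m; lra.
have mm : `|Re m| + `|Im m| <= 27 / 32.
  have := @sqrtr2_sum (Re m) (Im m) (9 / 16) ltac:(lra).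
  rewrite -cnsq => h; apply: le_trans (h _) _; last by lra.
  by rewrite lerXn2r ?nnegrE ?cn_ge0 //; lra.
rewrite mE ReM ReD ImD /= -/X -/Y add0r.
have : X * Re m >= - (X * `|Re m|).
  have : `|X * Re m| <= X * `|Re m| by rewrite normrM ger0_norm ?(ltW z2).
  by rewrite ler_norml => /andP[].
have : Y * Im m <= X * `|Im m|.
  have : `|Y * Im m| <= X * `|Im m| by rewrite normrM ler_wpM2r.
  by rewrite ler_norml => /andP[].
have : X * (`|Re m| + `|Im m|) <= X * (27 / 32) by rewrite ler_wpM2l // ltW.
rewrite mulrDr; lra.
Qed.

Lemma sector_near z : sector z -> cn (1 - z) <= cn (1 - z ^+ 4).
Proof.
move=> [z1 z2].
have -> : 1 - z ^+ 4 = (1 - z) * ((1 + z) * (1 + z ^+ 2)) by ring.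
rewrite cnM ler_peMr ?cn_ge0 // cnM.
have a1 : 1 <= cn (1 + z).
  by apply: le_trans (Re_cn _); rewrite ReD /=; apply: le_trans (ler_norm _); lra.
have a2 : 1 <= cn (1 + z ^+ 2).
  by apply: le_trans (Re_cn _); rewrite ReD /=; apply: le_trans (ler_norm _); lra.
by rewrite -[leLHS]mulr1 ler_pM //; lra.
Qed.

Lemma newton_iter z (q : R) n : sector z -> q < 1 -> cn (1 - z ^+ 4) <= q ->
  sector (iter n newton z) /\ cn (1 - (iter n newton z) ^+ 4) <= q ^+ n * q.
Proof.
move=> sz q1 hz; have q0 : 0 <= q by apply: le_trans hz; exact: cn_ge0.
elim: n => [|n [IH1 IH2]]; first by rewrite expr0 mul1r.
have le : cn (1 - iter n newton z ^+ 4) <= q.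
  by apply: le_trans IH2 _; rewrite ler_piMl // exprn_ile1 // ltW.
have [h1 h2] := newton_step IH1 q1 le; rewrite iterS; split => //.
by apply: le_trans h2 _; rewrite [q ^+ n.+1]exprS -mulrA ler_wpM2l.
Qed.

Lemma newton_root w z n : w ^+ 4 = 1 -> iter n newton (w * z) = w * iter n newton z.
Proof.
move=> w4; elim: n => // n IH; rewrite !iterS IH /newton exprMn w4 mul1r; ring.
Qed.

Definition upoly (F : R[i] -> R[i]) := exists p : {poly R[i]}, forall z, p.[z] = F z.
Lemma upoly_cst c : upoly (fun=> c). Proof. by exists c%:P => z; rewrite hornerC. Qed.
Lemma upoly_id : upoly id. Proof. by exists 'X => z; rewrite hornerX. Qed.
Lemma upolyD F G : upoly F -> upoly G -> upoly (fun z => F z + G z).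
Proof. by move=> [p Hp] [q Hq]; exists (p + q) => z; rewrite hornerD Hp Hq. Qed.
Lemma upolyM F G : upoly F -> upoly G -> upoly (fun z => F z * G z).
Proof. by move=> [p Hp] [q Hq]; exists (p * q) => z; rewrite hornerM Hp Hq. Qed.
Lemma upolyX F n : upoly F -> upoly (fun z => F z ^+ n).
Proof. by move=> [p Hp]; exists (p ^+ n) => z; rewrite horner_exp Hp. Qed.
Lemma upoly_comp F G : upoly F -> upoly G -> upoly (F \o G).
Proof. by move=> [p Hp] [q Hq]; exists (p \Po q) => z; rewrite horner_comp Hq Hp. Qed.
Lemma upoly_newton n : upoly (iter n newton).
Proof.
elim: n => [|n IH]; first exact: upoly_id.
apply: (@upoly_comp newton) IH.
apply: upolyM; first exact: upoly_id.
apply: upolyD; first exact: upoly_cst.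
apply: upolyM; last exact: upoly_cst.
apply: upolyD; first exact: upoly_cst.
have [p Hp] := upolyM (upoly_cst (-1)) (upolyX 4 upoly_id).
by exists p => z; rewrite Hp mulN1r.
Qed.
Lemma upoly_bdd F (M : R) : upoly F -> exists2 B : R, 0 <= B & forall z, cn z <= M -> cn (F z) <= B.
Proof.
move=> [p Hp]; have : exists2 B : R, 0 <= B & forall z, cn z <= M -> cn (p.[z]) <= B.
  elim/poly_ind: p {Hp} => [|p c [B B0 HB]].
    by exists 0 => // z _; rewrite horner0 cn0.
  exists (B * `|M| + cn c); first by rewrite addr_ge0 ?mulr_ge0 ?cn_ge0.
  move=> z zM; rewrite hornerMXaddC (le_trans (ler_cnD _ _)) // lerD2r cnM.
  by rewrite ler_pM ?cn_ge0 ?HB // (le_trans zM) // ler_norm.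
by move=> [B B0 HB]; exists B => // z /HB; rewrite Hp.
Qed.

(** Averaging over the powers detects 1 among the fourth roots of unity. *)
Definition detect z : R[i] := (1 + z + z ^+ 2 + z ^+ 3) / 4%:R.
Lemma upoly_detect : upoly detect.
Proof.
apply: upolyM; last exact: upoly_cst.
apply: upolyD; last exact: upolyX upoly_id.
apply: upolyD; last exact: upolyX upoly_id.
by apply: upolyD; [exact: upoly_cst|exact: upoly_id].
Qed.

Lemma detect_root w : w ^+ 4 = 1 -> detect w = if w == 1 then 1 else 0.
Proof.
move=> w4; case: eqP => [->|/eqP w1].
  by rewrite /detect !expr1n; field.
have w1' : 1 - w != 0 by rewrite subr_eq0 eq_sym.
apply/eqP; rewrite /detect mulf_eq0 -(mulrI_eq0 _ (mulfI w1')).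
by rewrite (_ : _ * _ = 1 - w ^+ 4); [rewrite w4 subrr eqxx|ring].
Qed.

Lemma detect_near w s : cn w = 1 -> cn (1 - s) <= 1 ->
  cn (detect (w * s) - detect w) <= 5 * cn (1 - s).
Proof.
move=> w1 s1; set d := cn (1 - s) in s1 *.
have d0 : 0 <= d by exact: cn_ge0.
have s2 : cn s <= 2.
  by have := cn_tri 1 s 0; rewrite !subr0 cn1 (cnB s); rewrite -/d; lra.
have sE : s ^+ 2 - 1 = - ((1 - s) * (1 + s)) by ring.
have sE3 : s ^+ 3 - 1 = - ((1 - s) * (1 + s + s ^+ 2)) by ring.
have b2 : cn (1 + s) <= 3 by have := ler_cnD 1 s; rewrite cn1; lra.
have b3 : cn (1 + s + s ^+ 2) <= 7.
  have : cn (s ^+ 2) <= 2 ^+ 2 by rewrite cnX lerXn2r ?nnegrE ?cn_ge0.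
  by have := ler_cnD (1 + s) (s ^+ 2); lra.
have c1 : cn (w * (s - 1)) <= d by rewrite cnM w1 mul1r cnB.
have c2 : cn (w ^+ 2 * (s ^+ 2 - 1)) <= d * 3.
  by rewrite cnM cnX w1 expr1n mul1r sE cnN cnM ler_wpM2l.
have c3 : cn (w ^+ 3 * (s ^+ 3 - 1)) <= d * 7.
  by rewrite cnM cnX w1 expr1n mul1r sE3 cnN cnM ler_wpM2l.
rewrite (_ : _ - _ = (w * (s - 1) + w ^+ 2 * (s ^+ 2 - 1) + w ^+ 3 * (s ^+ 3 - 1)) / 4%:R).
  have := ler_cnD (w * (s - 1) + w ^+ 2 * (s ^+ 2 - 1)) (w ^+ 3 * (s ^+ 3 - 1)).
  have := ler_cnD (w * (s - 1)) (w ^+ 2 * (s ^+ 2 - 1)).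
  by rewrite cn_div cn4; lra.
by rewrite /detect; field.
Qed.

End RootIteration.

Section Indicators.
Variable R : realType.
Implicit Types (s t : R) (z : R[i]).

(** As |eta| <= 4/11 < sin (pi/8), the fourth power of 1 + eta has positive real
part; the factor 1/6 is small enough to bring the defect 1 - s^4 below 1. *)
Lemma start_sector (eta : R[i]) : cn eta <= 4 / 11 ->
  let s := (1 / 6)%:C * (1 + eta) in
  sector s /\ cn (1 - s ^+ 4) <= 1 - (1 / 500) ^+ 2.
Proof.
move=> h s; set x := Re (1 + eta); set y := Im (1 + eta).
have hx : (x - 1) ^+ 2 + y ^+ 2 <= 16 / 121.
  have : cn eta ^+ 2 <= (4 / 11) ^+ 2 by rewrite lerXn2r ?nnegrE ?cn_ge0 //; lra.
  rewrite cnsq /x /y ReD ImD /= add0r.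
  have -> : (4 / 11) ^+ 2 = 16 / 121 :> R by field.
  by have -> : 1 + Re eta - 1 = Re eta by ring.
have hx2 : (x - 1) ^+ 2 <= (4 / 11) ^+ 2.
  have -> : (4 / 11) ^+ 2 = 16 / 121 :> R by field.
  by have := sqr_ge0 y; lra.
have x1 : 7 / 11 <= x <= 15 / 11.
  move: hx2; rewrite -[leLHS]real_normK ?num_real // ler_pXn2r ?nnegrE ?normr_ge0 //; last by lra.
  by rewrite ler_norml; lra.
have yx : y ^+ 2 <= 16 / 105 * x ^+ 2.
  have := sqr_ge0 (11 * x - 105 / 11).
  by rewrite sqrrB in hx *; nra.
have Rs : Re s = 1 / 6 * x by rewrite ReZ.
have Is : Im s = 1 / 6 * y by rewrite ImZ.
clearbody s x y.
have xx : 49 / 121 <= x ^+ 2 by nra.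
have P4 : 16 / 105 * 6 <= (1 : R) by lra.
split.
  split; first by rewrite Rs; lra.
  by rewrite expr2 ReM Rs Is; nra.
have s4 : s ^+ 4 = s ^+ 2 * s ^+ 2 by ring.
pose P := (x ^+ 2) ^+ 2 - 6 * x ^+ 2 * y ^+ 2 + (y ^+ 2) ^+ 2.
pose Q := 4 * x * y * (x ^+ 2 - y ^+ 2).
have R4 : Re (s ^+ 4) = 1 / 1296 * P.
  by rewrite s4 !(ReM, ImM, expr2) Rs Is /P; field.
have I4 : Im (s ^+ 4) = 1 / 1296 * Q.
  by rewrite s4 !(ReM, ImM, expr2) Rs Is /Q; field.
have PQ : P ^+ 2 + Q ^+ 2 = (x ^+ 2 + y ^+ 2) ^+ 4 by rewrite /P /Q; ring.
have Pb : 14 / 1000 <= P.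
  have : x ^+ 2 * y ^+ 2 <= x ^+ 2 * (16 / 105 * x ^+ 2) by rewrite ler_wpM2l ?sqr_ge0.
  have : 49 / 121 * (49 / 121) <= x ^+ 2 * x ^+ 2 by rewrite ler_pM //; lra.
  have := sqr_ge0 (y ^+ 2); rewrite /P.
  by rewrite (expr2 (x ^+ 2)); lra.
have S4 : (x ^+ 2 + y ^+ 2) ^+ 4 <= 12.
  have s1 : x ^+ 2 + y ^+ 2 <= 225 / 121 by rewrite sqrrB in hx; nra.
  have : (x ^+ 2 + y ^+ 2) ^+ 4 <= (225 / 121) ^+ 4.
    by apply: lerXn2r; rewrite ?nnegrE ?addr_ge0 ?sqr_ge0 //; lra.
  have : (225 / 121) ^+ 4 <= 12 :> R by lra.
  lra.
apply: cn_le_sq; first by lra.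
rewrite !(ReD, ImD, ReN, ImN) R4 I4 /=.
have -> : (1 - 1 / 1296 * P) ^+ 2 + (0 - 1 / 1296 * Q) ^+ 2 =
  1 - 2 / 1296 * P + (1 / 1296) ^+ 2 * (P ^+ 2 + Q ^+ 2) by ring.
by rewrite PQ; lra.
Qed.

(** The digits as fourth roots of unity. *)
Definition droot (j : nat) : R[i] := digit R j / (1 +i* 1).

Let d3n0 : (1 +i* 1 : R[i]) != 0.
Proof. by rewrite eq_complex /= oner_eq0. Qed.

Lemma droot4 j : (j < 4)%N -> droot j ^+ 4 = 1.
Proof.
move=> j4; rewrite /droot expr_div_n; apply/(canLR (mulfK _)); first by rewrite expf_neq0.
rewrite mul1r; case: j j4 => [|[|[|[|]]]] //= _; rewrite /digit /=;
  rewrite !exprS expr0; apply: Cext; rewrite !(ReM, ImM) /=; ring.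
Qed.

Lemma droot_inj j k : (j < 4)%N -> (k < 4)%N -> j != k -> droot j / droot k != 1.
Proof.
move=> j4 k4 jk.
have dk0 i : (i < 4)%N -> digit R i != 0.
  move=> i4; rewrite -cn_gt0; apply: lt_le_trans (Re_cn _).
  by case: i i4 => [|[|[|[|]]]] //= _; rewrite ?normrN normr1.
have -> : droot j / droot k = digit R j / digit R k by rewrite /droot; field; rewrite d3n0 dk0.
apply/eqP => /(canRL (divfK (dk0 _ k4))); rewrite mul1r.
have := uniq_digits R => /(nth_uniq 0) => /(_ j k) /(_ j4 k4) E F.
by move: jk; rewrite -E; apply/negP; rewrite negbK; apply/eqP.
Qed.

Lemma cn_droot j : (j < 4)%N -> cn (droot j) = 1.
Proof.
move=> j4; have /(congr1 (@cn R)) := droot4 j4; rewrite cnX cn1 => E.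
by apply/eqP; rewrite -(@eqrXn2 _ 4) ?cn_ge0 // E expr1n.
Qed.

Definition cantor t := 0 <= t <= 1 /\ height t = 0.

(** A point of the k-th piece is d_k (1 + eta) with |eta| <= rho |zarc s| /
|d_k| <= 4/11.  After a rescaling by 1 / (6 (1 + i)) the iteration takes it to
the root of unity of d_k, and detect compares this root with that of d_j. *)
Lemma digit_indicator j (eps : R) : (j < 4)%N -> 0 < eps -> exists2 F, upoly F &
  forall k s, (k < 4)%N -> 0 <= s <= 1 ->
    cn (F (zarc ((s + 2 * k%:R) / 7)) - (if k == j then 1 else 0)) <= eps.
Proof.
move=> j4 e0.
have q01 : 0 <= (1 - (1 / 500) ^+ 2 : R) < 1 by lra.
have e1 : 0 < Num.min 1 (eps / 5) by rewrite lt_min ltr01 divr_gt0.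
have [n /(_ n (leqnn n)) hn] := @expr_le_eps R (1 - (1 / 500) ^+ 2) _ 1 q01 e1.
exists (fun z => detect ((droot j)^-1 * iter n (@newton R) ((1 / 6)%:C / (1 +i* 1) * z))).
  apply: (upoly_comp (upoly_detect R)); apply: upolyM; first exact: upoly_cst.
  by apply: (upoly_comp (upoly_newton R n)); apply: upolyM; [exact: upoly_cst|exact: upoly_id].
move=> k s k4 s01; rewrite zarc_piece //.
have dk2 : cn (digit R k) ^+ 2 = 2.
  by rewrite cnsq; case: k k4 => [|[|[|[|]]]] //= _; ring.
have dk0 : digit R k != 0 by rewrite -cn_gt0 -(@pmulr_rgt0 _ (cn (digit R k))) -?expr2 ?dk2 //;
  rewrite lt_neqAle cn_ge0 andbT eq_sym; apply/eqP => E; move: dk2; rewrite E expr0n /=; lra.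
pose eta := (rho R)%:C * zarc s / digit R k.
have heta : cn eta <= 4 / 11.
  rewrite -(@ler_pXn2r _ 2) ?nnegrE ?cn_ge0 //; last by lra.
  rewrite /eta cn_div cnM cn_rho expr_div_n exprMn dk2.
  by have := cn_zarc_sq s; rewrite /rho; lra.
have [sec hq] := start_sector heta.
have zE : (1 / 6)%:C / (1 +i* 1) * ((rho R)%:C * zarc s + digit R k) =
   droot k * ((1 / 6)%:C * (1 + eta)) by rewrite /droot /eta; field; rewrite d3n0 dk0.
rewrite zE newton_root ?droot4 //.
have [sn hn'] := @newton_iter R _ _ n sec (andP q01).2 hq.
set sg := iter n _ _ in sn hn' *.
have near : cn (1 - sg) <= Num.min 1 (eps / 5).
  apply: le_trans (sector_near sn) _; apply: le_trans hn' _.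
  apply: le_trans hn; rewrite [leRHS]mul1r ler_piMr ?exprn_ge0 //; lra.
rewrite mulrA -[(droot j)^-1 * _]mulrC.
have w4 : (droot k / droot j) ^+ 4 = 1 by rewrite expr_div_n !droot4 // divr1.
have w1 : cn (droot k / droot j) = 1 by rewrite cn_div !cn_droot // divr1.
have rj0 : droot j != 0 by rewrite -cn_gt0 cn_droot.
have -> : (if k == j then 1 else 0) = detect (droot k / droot j).
  rewrite detect_root //; have [->|kj] := eqVneq k j; first by rewrite divff // eqxx.
  by rewrite (negbTE (droot_inj k4 j4 kj)).
move: near; rewrite le_min => /andP[n1 n2].
apply: le_trans (detect_near w1 n1) _; lra.
Qed.

(** The parameters of the piece that is reached by following the word w of
digits. *)
Fixpoint in_word (w : seq nat) t : Prop :=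
  if w is j :: w' then exists2 s, in_word w' s & t = (s + 2 * j%:R) / 7 else 0 <= t <= 1.

Lemma in_word01 w t : all (fun j => j < 4)%N w -> in_word w t -> 0 <= t <= 1.
Proof.
elim: w t => [|j w IH] t //= /andP[j4 aw] [s /(IH _ aw) s01 ->].
by case: j j4 => [|[|[|[|]]]] //= _; lra.
Qed.

Lemma in_word_diam w s t : in_word w s -> in_word w t -> `|s - t| <= (1 / 7) ^+ size w.
Proof.
elim: w s t => [|j w IH] s t /=.
  by rewrite expr0 ler_norml => h1 h2; lra.
move=> [s' hs ->] [t' ht ->]; rewrite exprS.
rewrite (_ : (s' + 2 * j%:R) / 7 - (t' + 2 * j%:R) / 7 = 1 / 7 * (s' - t')); last by field.
by rewrite normrM ger0_norm; [rewrite ler_wpM2l ?IH //; lra|lra].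
Qed.

Lemma in_word_cover n t : cantor t -> exists2 w, size w = n & all (fun j => j < 4)%N w /\ in_word w t.
Proof.
elim: n t => [|n IH] t [t01 ht]; first by exists [::].
have [j [s [j4 s01 hs ->]]] := height_zero t01 ht.
have [w sw [aw iw]] := IH s (conj s01 hs).
by exists (j :: w); rewrite /= ?sw // j4; split => //; exists s.
Qed.

(** The indicator of the first digit times that of the remaining word at the
rescaled point; the latter is bounded but meaningless off the first piece, where
the former is made small enough to compensate for it. *)
Lemma word_indicator w (eps : R) : all (fun j => j < 4)%N w -> 0 < eps -> exists2 F, upoly F &
  forall t, cantor t -> (in_word w t -> cn (F (zarc t) - 1) <= eps) /\ (~ in_word w t -> cn (F (zarc t)) <= eps).
Proof.
elim: w eps => [|j w IH] eps.
  move=> _ e0; exists (fun=> 1); first exact: upoly_cst.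
  by move=> t [t01 _]; split => // _; rewrite subrr cn0 ltW.
move=> /= /andP[j4 aw] e0.
pose e1 := Num.min 1 (eps / 3).
have e10 : 0 < e1 by rewrite lt_min ltr01; lra.
have [e1a e1b] : e1 <= 1 /\ e1 <= eps / 3 by rewrite /e1 !ge_min !lexx orbT.
have [F pF HF] := IH e1 aw e10.
pose F' z := F ((15 / 4)%:C * (z - digit R j)).
have pF' : upoly F'.
  apply: (upoly_comp pF); apply: upolyM; first exact: upoly_cst.
  by apply: upolyD; [exact: upoly_id|exact: upoly_cst].
have [B B0 HB] := upoly_bdd 2 pF'.
have d0 : 0 < e1 / (B + 1) by rewrite divr_gt0 //; lra.
have [G pG HG] := digit_indicator j4 d0.
have dB : e1 / (B + 1) * (B + 1) = e1 by rewrite divfK // gt_eqF //; lra.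
set d := e1 / (B + 1) in d0 HG dB.
have dB' : B * d <= e1 by lra.
have Bd : 0 <= B * d by rewrite mulr_ge0 // ltW.
have de : d <= e1 by lra.
exists (fun z => F' z * G z); first exact: upolyM.
move=> t [t01 ht]; have [k [s [k4 s01 hs tE]]] := height_zero t01 ht.
have hG := HG k s k4 s01; rewrite -tE in hG.
have ht2 : cn (F' (zarc t)) <= B by apply: HB; exact: cn_zarc.
have [kj|kj] := eqVneq k j; last first.
  rewrite (negbTE kj) subr0 in hG.
  split.
    move=> [s' /(in_word01 aw) s01' tE']; exfalso.
    move: tE; rewrite tE' => tE; move/eqP: kj; apply.
    have {}tE : s' + 2 * j%:R = s + 2 * k%:R by lra.
    have [jk|] := ltnP j k.
      have hjk : (j.+1)%:R <= k%:R :> R by rewrite ler_nat.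
      by exfalso; rewrite -natr1 in hjk; lra.
    rewrite leq_eqVlt => /orP[/eqP //|kj].
    have hkj : (k.+1)%:R <= j%:R :> R by rewrite ler_nat.
    by exfalso; rewrite -natr1 in hkj; lra.
  move=> _; rewrite cnM; have := ler_pM (cn_ge0 _) (cn_ge0 _) ht2 hG; lra.
rewrite kj eqxx in hG.
have F'E : F' (zarc t) = F (zarc s).
  rewrite /F' tE kj zarc_piece // addrK mulrA -rmorphM /=.
  by rewrite (_ : 15 / 4 * rho R = 1) ?mul1r // /rho; field.
have [Hi Ho] := HF s (conj s01 hs); rewrite -F'E in Hi Ho.
have Gb : cn (G (zarc t)) <= 2.
  by have := cn_tri 1 (G (zarc t)) 0; rewrite !subr0 cn1; lra.
split.
  move=> [s' ws' tE']; have ss : s' = s by move: tE'; rewrite tE kj; lra.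
  have Hi' := Hi (eq_ind _ (in_word w) ws' _ ss).
  rewrite (_ : _ - 1 = F' (zarc t) * (G (zarc t) - 1) + (F' (zarc t) - 1)); last by ring.
  apply: le_trans (ler_cnD _ _) _; rewrite cnM.
  have := ler_pM (cn_ge0 _) (cn_ge0 _) ht2 hG; lra.
move=> nw; have Ho' : cn (F' (zarc t)) <= e1.
  by apply: Ho => ws; apply: nw; exists s => //; rewrite tE kj.
rewrite cnM; have := ler_pM (cn_ge0 _) (cn_ge0 _) Ho' Gb; lra.
Qed.

End Indicators.

(** * Polynomial convexity of the curves *)

Lemma uniform_continuity (R : realType) (u : R -> R[i]) : ccont u -> forall eps : R, 0 < eps ->
  exists2 d : R, 0 < d & forall s t, 0 <= t <= 1 -> `|s - t| < d -> cn (u s - u t) < eps.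
Proof.
move=> cu eps e0.
have := (compact_near_coveringP _).1 (@segment_compact R 0 1) R (0^'+) 
  (fun d t => forall s, `|s - t| < d -> cn (u s - u t) < eps).
case.
- move=> x _; have e2 : 0 < eps / 2 by lra.
  have [d d0 Hd] := cu x _ e2.
  exists ([set t | `|t - x| < d / 2], [set r : R | r < d / 2]).
    split => /=.
      exists (d / 2) => /=; first by lra.
      by move=> t /=; rewrite distrC.
    exists (d / 2) => /=; first by lra.
    by move=> r /=; rewrite sub0r normrN => h r0; apply: le_lt_trans (ler_norm _) h.
  move=> [t r] /= [tx rd] s st.
  have h1 := Hd t ltac:(lra).
  have h2 : cn (u s - u x) < eps / 2.
    apply: Hd; have := ler_normD (s - t) (t - x); rewrite addrA subrK; lra.
  have := cn_tri (u x) (u s) (u t); rewrite (cnB (u x)); lra.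
move=> d /= d0 H; exists (d / 2); first by lra.
move=> s t t01 st; apply: (H (d / 2)) => //=.
- rewrite sub0r normrN ger0_norm; lra.
- lra.
Qed.

Section CurveHull.
Variables (R : realType) (G : R -> 'rV[R[i]]_3).
Hypothesis Gc : forall i, ccont (fun u => G u ord0 i).
Hypothesis He : ulim G (@dom R) (@zarc R).
Hypothesis Hh : ulim G (@dom R) (fun u => (level u)%:C).

Variable z : 'rV[R[i]]_3.
Hypothesis zG : forall u, dom u -> z <> G u.
Hypothesis zhull : forall f (B : R), polyfun f ->
  (forall u, dom u -> cn (f (G u)) <= B) -> cn (f z) <= B.

Let G_bdd := curve_bdd Gc.

(** The curve with the point z adjoined: a uniform limit of polynomials on it
has a value at z, namely at None. *)
Let pt (o : option R) := if o is Some u then G u else z.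
Let D (o : option R) := if o is Some u then dom u else True.

Let pt_bdd : exists M : R, forall i k, D i -> cn (pt i ord0 k) <= M.
Proof.
have [M HM] := G_bdd; exists (`|M| + \sum_k cn (z ord0 k)).
have S0 : 0 <= \sum_k cn (z ord0 k) by apply: sumr_ge0 => k _; exact: cn_ge0.
case=> [u|] k /= du.
  by have := HM u k du; have := ler_norm M; lra.
rewrite (bigD1 k) //= addrCA lerDl addr_ge0 // sumr_ge0 // => j _; exact: cn_ge0.
Qed.

Let ulim_extend phi : ulim G (@dom R) phi ->
  exists v, ulim pt D (fun o => if o is Some u then phi u else v).
Proof.
move=> up.
have h0 n : 0 < (1 / 2 : R) ^+ n by rewrite exprn_gt0 //; lra.
have F n : exists f, polyfun f /\ forall u, dom u -> cn (f (G u) - phi u) <= (1 / 2) ^+ n.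
  by have [f pf Hf] := up _ (h0 n); exists f.
have [f Hf] := choice F.
have q01 : 0 <= (1 / 2 : R) < 1 by lra.
have [|v Hv] := @geom_cauchy R (fun n => f n z) 2 (1 / 2) q01.
  move=> n; apply: (zhull (f := fun w => f n.+1 w - f n w)).
    exact: polyfunB (Hf _).1 (Hf _).1.
  move=> u du; have := cn_tri (phi u) (f n.+1 (G u)) (f n (G u)).
  have := (Hf n.+1).2 u du; have := (Hf n).2 u du; rewrite exprS (cnB (phi u)).
  by have := h0 n; lra.
exists v => eps e0; have [n /(_ n (leqnn n)) hn] := @expr_le_eps R (1 / 2) eps 4 q01 e0.
exists (f n); first exact: (Hf n).1.
case=> [u|] /= du.
  by apply: le_trans ((Hf n).2 u du) _; have := h0 n; lra.
by apply: le_trans (Hv n) _; rewrite (_ : 2 / (1 - 1 / 2) = 4) //; field.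
Qed.

Let ulim_hull phi (B : R) : ulim pt D phi -> (forall u, dom u -> cn (phi (Some u)) <= B) ->
  cn (phi None) <= B.
Proof.
move=> up HB; apply/ler_addgt0Pr => eps e0; have e2 : 0 < eps / 2 by lra.
have [f pf Hf] := up _ e2.
have : cn (f z) <= B + eps / 2.
  apply: zhull => // u du; have := Hf (Some u) du; have := HB u du; rewrite /= => h1 h2.
  by have := cn_tri (phi (Some u)) (f (G u)) 0; rewrite !subr0; lra.
have := Hf None I; rewrite /= => h1 h2.
by have := cn_tri (f z) (phi None) 0; rewrite !subr0 (cnB (phi None)); lra.
Qed.

Let level_bound (u : R) : -1 <= level u <= 1.
Proof. by rewrite /level; have := height_bounds u; have := clamp01 (u - 1); lra. Qed.

(** The level sigma is the real part of the value of the level function at z.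
Were g small on the fibre and 1 at z, then (1 - (level - sigma)^2 / M)^n g would
be at most 3/4 on the curve for large n and at least 1 in modulus at z, because
the level function is real on the curve and differs from sigma by an imaginary
number at z. *)
Lemma fibre_separation : exists sigma : R, forall g, polyfun g -> g z = 1 ->
  (forall u, dom u -> level u = sigma -> cn (g (G u)) <= 1 / 2) -> False.
Proof.
have [om Hom] := ulim_extend Hh.
exists (Re om) => g pg gz Hg; set sg := Re om in Hg.
have cg := polyfun_ccont Gc pg.
have [||||d d0 Hd] := @separate_level R (fun u => level u - sg) (fun u => 3 / 4 - cn (g (G u))) 0 2.
- by [].
- by apply: rcontD; [exact: level_cont|exact: rcont_cst].
- apply: rcontD; first exact: rcont_cst.
  by apply/rcontP => t; apply: cvgN; exact: (rcontP _).1 (rcont_cn cg) t.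
- by move=> u du /eqP; rewrite subr_eq0 => /eqP /(Hg u du); lra.
have [B B0 HB] := dom_bdd cg.
pose M := (2 + `|sg|) ^+ 2.
have M4 : 4 <= M.
  rewrite /M (_ : 4 = 2 ^+ 2 :> R); last by ring.
  by apply: lerXn2r; rewrite ?nnegrE; have := normr_ge0 sg; lra.
have M0 : 0 < M by apply: lt_le_trans M4; rewrite ltr0n.
pose r u := 1 - (level u - sg) ^+ 2 / M.
have r01 u : 0 <= r u <= 1.
  rewrite /r; have : 0 <= (level u - sg) ^+ 2 / M by rewrite divr_ge0 ?sqr_ge0 //; lra.
  have : (level u - sg) ^+ 2 / M <= 1.
    rewrite ler_pdivrMr; last by lra.
    rewrite mul1r /M -[leLHS]real_normK ?num_real //; apply: lerXn2r; rewrite ?nnegrE //.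
      by have := normr_ge0 sg; lra.
    have hb : `|level u| <= 1 by rewrite ler_norml level_bound.
    have := ler_normB (level u) sg; lra.
  lra.
pose q := 1 - Num.min 1 (d ^+ 2 / M).
have m1 : Num.min 1 (d ^+ 2 / M) <= 1 by rewrite ge_min lexx.
have m2 : Num.min 1 (d ^+ 2 / M) <= d ^+ 2 / M by rewrite ge_min lexx orbT.
have m3 : 0 < Num.min 1 (d ^+ 2 / M).
  by rewrite lt_min ltr01 /= divr_gt0 // exprn_gt0.
have q01 : 0 <= q < 1 by rewrite /q; lra.
have [n /(_ n (leqnn n)) hn] := @expr_le_eps R q (1 / 2) B q01 ltac:(lra).
pose Phi o := (if o is Some u then (level u)%:C else om) - sg%:C.
pose Psi o := (1 - Phi o ^+ 2 * (M^-1)%:C) ^+ n * g (pt o).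
have uPsi : ulim pt D Psi.
  apply: ulimM => //; last exact: ulim_poly.
  apply: ulimX => //; apply: ulimB => //; first exact: ulim_cst.
  apply: ulimM => //; last exact: ulim_cst.
  by apply: ulimX => //; apply: ulimB => //; exact: ulim_cst.
have : cn (Psi None) <= 3 / 4.
  apply: ulim_hull => // u du.
  have E : Psi (Some u) = (r u ^+ n)%:C * g (G u).
    by rewrite /Psi /Phi /= /r !(rmorphXn, rmorphB, rmorphM, rmorph1).
  rewrite E cnM cn_pos; last by apply: exprn_ge0; have := r01 u; lra.
  have [lt|ge] := ltP `|level u - sg| d.
    have := Hd u du lt => h; have rn : r u ^+ n <= 1 by apply: exprn_ile1; have := r01 u; lra.
    have : r u ^+ n * cn (g (G u)) <= 1 * cn (g (G u)) by rewrite ler_wpM2r ?cn_ge0.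
    lra.
  have rq : r u ^+ n <= q ^+ n.
    apply: lerXn2r; rewrite ?nnegrE; [by have := r01 u; lra|by lra|].
    have : d ^+ 2 / M <= (level u - sg) ^+ 2 / M.
      rewrite ler_wpM2r ?invr_ge0; [by []|by lra|].
      rewrite -[leRHS]real_normK ?num_real //.
      by apply: lerXn2r; rewrite ?nnegrE //; exact: ltW.
    by rewrite /r /q; lra.
  have : r u ^+ n * cn (g (G u)) <= q ^+ n * B.
    by apply: ler_pM; rewrite ?cn_ge0 ?HB // exprn_ge0 //; have := r01 u; lra.
  lra.
rewrite /Psi /= gz mulr1 /Phi cnX => hP.
have : 1 <= cn (1 - (om - sg%:C) ^+ 2 * (M^-1)%:C).
  apply: le_trans (Re_cn _); apply: le_trans (ler_norm _).
  rewrite ReD ReN /= mulrC ReZ expr2 ReM !ReD !ImD !ReN !ImN /= /sg.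
  have Mi : 0 <= M^-1 by rewrite invr_ge0 ltW.
  have := mulr_ge0 Mi (sqr_ge0 (Im om)); set k := M^-1; lra.
by move=> /(exprn_ege1 n); lra.
Qed.

Let coord_neq (u : R) : dom u -> exists i, z ord0 i != G u ord0 i.
Proof.
move=> du; apply: contrapT => no; apply: (zG du); apply/rowP => i.
by apply/eqP/negPn/negP => h; apply: no; exists i.
Qed.

(** A product of coordinate factors, each vanishing at one point of the list. *)
Let sep_list (l : seq R) : exists g, [/\ polyfun g, g z = 1 &
  forall u, u \in l -> dom u -> g (G u) = 0].
Proof.
elim: l => [|v l [g [pg gz Hg]]].
  by exists (fun=> 1); split => //; exact: polyfun_cst.
have [dv|ndv] := pselect (dom v); last first.
  exists g; split => // u; rewrite in_cons => /orP[/eqP ->|]; [by move/ndv|exact: Hg].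
have [i zi] := coord_neq dv; rewrite -subr_eq0 in zi.
exists (fun w : 'rV_3 => (w ord0 i - G v ord0 i) / (z ord0 i - G v ord0 i) * g w); split.
- apply: polyfunM => //; apply: polyfunM; last exact: polyfun_cst.
  by apply: polyfunB; [exact: polyfun_coord|exact: polyfun_cst].
- by rewrite gz mulr1 divff.
- move=> u; rewrite in_cons => /orP[/eqP ->|ul] du.
    by rewrite subrr !mul0r.
  by rewrite Hg // mulr0.
Qed.

Let cantor_dom (u : R) : cantor u -> dom u.
Proof. by move=> [u01 _]; rewrite /dom; lra. Qed.

Let gap_lower : exists2 d : R, 0 < d & forall u : R, dom u -> exists i, d <= cn (z ord0 i - G u ord0 i).
Proof.
pose i0 := @Ordinal 3 0 isT; pose i1 := @Ordinal 3 1 isT; pose i2 := @Ordinal 3 2 isT.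
pose f u := cn (z ord0 i0 - G u ord0 i0) + (cn (z ord0 i1 - G u ord0 i1) + cn (z ord0 i2 - G u ord0 i2)).
have cf : rcont f.
  have c i : rcont (fun u => cn (z ord0 i - G u ord0 i)).
    by apply/rcont_cn/ccontB; [exact: ccont_cst|exact: Gc].
  by apply: rcontD => //; apply: rcontD.
have f0 u : 0 <= u <= 2 -> 0 < f u.
  move=> du; have [i zi] := coord_neq du.
  rewrite -subr_eq0 -cn_gt0 in zi; rewrite /f.
  have := cn_ge0 (z ord0 i0 - G u ord0 i0); have := cn_ge0 (z ord0 i1 - G u ord0 i1).
  have := cn_ge0 (z ord0 i2 - G u ord0 i2).
  case: i zi => [[|[|[|]]] hi] //; rewrite (bool_irrelevance hi isT) /i0 /i1 /i2; lra.
have [|d d0 Hd] := @pos_lower R f 0 2 _ cf f0; first by [].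
exists (d / 3); first by lra.
move=> u du; have := Hd u du; rewrite /f => h.
have [h0|h0] := leP (d / 3) (cn (z ord0 i0 - G u ord0 i0)); first by exists i0.
have [h1|h1] := leP (d / 3) (cn (z ord0 i1 - G u ord0 i1)); first by exists i1.
by exists i2; lra.
Qed.

Let separates_words n := forall w, size w = n -> exists g, [/\ polyfun g, g z = 1 &
  forall u, cantor u -> in_word w u -> cn (g (G u)) <= 1 / 8].

(** On a piece so small that the curve hardly moves, a single coordinate
separates z from the whole piece. *)
Let local_sep : exists n, separates_words n.
Proof.
have [d d0 Hd] := gap_lower.
have d8 : 0 < d / 8 by lra.
have U i := uniform_continuity (Gc i) d8.
have [a a0 Ha] := U (@Ordinal 3 0 isT).
have [b b0 Hb] := U (@Ordinal 3 1 isT).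
have [c c0 Hc] := U (@Ordinal 3 2 isT).
pose m := Num.min a (Num.min b c).
have m0 : 0 < m by rewrite !lt_min a0 b0.
have m2 : 0 < m / 2 by lra.
have q01 : 0 <= (1 / 7 : R) < 1 by lra.
have [n /(_ n (leqnn n)) hn] := @expr_le_eps R (1 / 7) (m / 2) 1 q01 m2.
exists n => w sw.
have [[v lv iv]|no] := pselect (exists2 v : R, cantor v & in_word w v); last first.
  exists (fun=> 1); split => //; first exact: polyfun_cst.
  by move=> u lu iu; exfalso; apply: no; exists u.
have [i zi] := Hd v (cantor_dom lv).
have n0 : z ord0 i - G v ord0 i != 0 by rewrite -cn_gt0; lra.
exists (fun x : 'rV_3 => (x ord0 i - G v ord0 i) / (z ord0 i - G v ord0 i)); split.
- apply: polyfunM; last exact: polyfun_cst.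
  by apply: polyfunB; [exact: polyfun_coord|exact: polyfun_cst].
- by rewrite divff.
move=> u lu iu; rewrite cn_div ler_pdivrMr ?cn_gt0 //.
have uv : `|u - v| < m.
  by apply: le_lt_trans (in_word_diam iu iv) _; rewrite sw; rewrite mul1r in hn; lra.
move: uv; rewrite !lt_min => /andP[ua /andP[ub uc]].
have := Ha u v lv.1 ua; have := Hb u v lv.1 ub; have := Hc u v lv.1 uc.
by case: i zi n0 => [[|[|[|]]] hi] //; rewrite (bool_irrelevance hi isT) => zi _; lra.
Qed.

(** Interpolate by 1 - F (1 - g) between the local function g on the piece,
where F is close to 1, and the constant 1 on the other pieces, where F is close
to 0. *)
Let word_sep n w (kap : R) : separates_words n ->
  size w = n -> all (fun j => j < 4)%N w -> 0 < kap <= 1 / 8 ->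
  exists g, [/\ polyfun g, g z = 1 & forall u, cantor u ->
    cn (g (G u)) <= 1 + kap /\ (in_word w u -> cn (g (G u)) <= 1 / 4)].
Proof.
move=> loc sw aw k01; have [g [pg gz Hg]] := loc w sw.
have [B B0 HB] := dom_bdd (polyfun_ccont Gc (polyfunB (polyfun_cst _ 1) pg)).
pose eps := kap / (B + 1); have e0 : 0 < eps by rewrite divr_gt0 //; lra.
have eB : eps * (B + 1) = kap by rewrite divfK // gt_eqF //; lra.
have e2 : 0 < eps / 2 by lra.
have [F [p Fp] HF] := word_indicator aw e2.
have [f pf Hf] := ulim_horner G_bdd p He e2.
exists (fun x => 1 - f x * (1 - g x)); split.
- apply: polyfunB; first exact: polyfun_cst.
  by apply: polyfunM => //; apply: polyfunB => //; exact: polyfun_cst.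
- by rewrite gz subrr mulr0 subr0.
move=> u lu; have du := cantor_dom lu; have [h1 h2] := HF u lu.
have := Hf u du; rewrite Fp => h3; have hB := HB u du.
have key (c : R[i]) : cn (F (zarc u) - c) <= eps / 2 -> cn ((f (G u) - c) * (1 - g (G u))) <= kap.
  move=> hc; have := cn_tri (F (zarc u)) (f (G u)) c => h4.
  have h5 : cn (f (G u) - c) <= eps by lra.
  rewrite cnM; have := ler_pM (cn_ge0 _) (cn_ge0 _) h5 hB; lra.
have [iu|niu] := pselect (in_word w u).
  have k1 := key 1 (h1 iu); have g8 := Hg u lu iu.
  have le : cn (1 - f (G u) * (1 - g (G u))) <= 1 / 4.
    rewrite (_ : 1 - _ = g (G u) - (f (G u) - 1) * (1 - g (G u))); last by ring.
    have := ler_cnB (g (G u)) ((f (G u) - 1) * (1 - g (G u))); lra.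
  by split => //; lra.
have h2' := h2 niu; rewrite -[F _]subr0 in h2'.
have k0 := key 0 h2'; rewrite subr0 in k0.
split => //; have := ler_cnB 1 (f (G u) * (1 - g (G u))); rewrite cn1; lra.
Qed.

(** Multiply over the words: each factor is at most 1 + kap, and one of them is
small. The constants 1 + kap have to be chosen with a product below B. *)
Let words_sep n (ws : seq (seq nat)) (B : R) :
  separates_words n ->
  (forall w, w \in ws -> size w = n /\ all (fun j => j < 4)%N w) -> 1 < B ->
  exists g, [/\ polyfun g, g z = 1 & forall u, cantor u ->
    cn (g (G u)) <= B /\ forall w, w \in ws -> in_word w u -> cn (g (G u)) <= B / 4].
Proof.
move=> loc; elim: ws B => [|w ws IH] B Hw B1.
  exists (fun=> 1); split => //; first exact: polyfun_cst.
  by move=> u _; split => //; rewrite cn1 ltW.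
pose kap := Num.min (1 / 8) ((B - 1) / 3).
have k0 : 0 < kap by rewrite lt_min; apply/andP; split; lra.
have [ka kb] : kap <= 1 / 8 /\ kap <= (B - 1) / 3 by rewrite /kap !ge_min !lexx orbT.
have kk : kap * kap <= 1 / 8 * kap by rewrite ler_wpM2r // ltW.
have [sw aw] := Hw w (mem_head _ _).
have k01 : 0 < kap <= 1 / 8 by rewrite k0.
have [g [pg gz Hg]] := word_sep loc sw aw k01.
have [||f [pf fz Hf]] := IH (1 + kap).
- by move=> v vw; apply: Hw; rewrite in_cons vw orbT.
- lra.
exists (fun x => g x * f x); split; first exact: polyfunM.
  by rewrite gz fz mulr1.
move=> u lu; have [g1 g2] := Hg u lu; have [f1 f2] := Hf u lu; rewrite cnM.
split.
  have := ler_pM (cn_ge0 _) (cn_ge0 _) g1 f1; lra.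
move=> v; rewrite in_cons => /orP[/eqP ->|vw] iv.
  have := ler_pM (cn_ge0 _) (cn_ge0 _) (g2 iv) f1; lra.
have := ler_pM (cn_ge0 _) (cn_ge0 _) g1 (f2 v vw iv); lra.
Qed.

Fixpoint words n : seq (seq nat) :=
  if n is m.+1 then [seq j :: w | j <- iota 0 4, w <- words m] else [:: [::]].

Lemma wordsS n : words n.+1 = [seq j :: w | j <- iota 0 4, w <- words n].
Proof. by []. Qed.

Lemma wordsP n w : w \in words n <-> size w = n /\ all (fun j => j < 4)%N w.
Proof.
elim: n w => [|n IH] w.
  rewrite inE; split=> [/eqP -> //|[/size0nil -> _]]; exact: eqxx.
rewrite wordsS; split.
  move=> /allpairsP[[j v] [hj /IH[sv av] ->]]; move: hj; rewrite mem_iota /= add0n sv => j4.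
  by split => //; rewrite j4.
case: w => [|j w]; first by case.
move=> [[sw] /andP[j4 aw]].
by apply/allpairsP; exists (j, w); split; [rewrite mem_iota|exact/IH|].
Qed.

Let sep_cantor : exists g, [/\ polyfun g, g z = 1 & forall u, cantor u -> cn (g (G u)) <= 1 / 2].
Proof.
have [n loc] := local_sep.
have [||g [pg gz Hg]] := @words_sep n (words n) 2 loc.
- by move=> w /wordsP.
- lra.
exists g; split => // u lu; have [w sw [aw iw]] := in_word_cover n lu.
have := (Hg u lu).2 w ((wordsP n w).2 (conj sw aw)) iw; lra.
Qed.

Let level_cases (u sg : R) : dom u -> level u = sg ->
  (0 <= u <= 1 /\ height u = sg) \/ (1 < u /\ u = 1 - sg /\ sg < 0).
Proof.
move=> du; have [u1|u1] := leP u 1.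
  have u01 : 0 <= u <= 1 by move: du; rewrite /dom; lra.
  by rewrite level_main // => <-; left; split => //; case/andP: u01 => ->.
have h1 : height u = 0 by rewrite -height_clamp clamp_ge1 ?height_at1 // ltW.
rewrite /level h1 clamp_id; last by move: du; rewrite /dom; lra.
by move=> E; right; split => //; split; lra.
Qed.

(** The fibre of fibre_separation is finite or the Cantor set, according to
whether its level is nonzero. *)
Theorem curve_not_in_hull : False.
Proof.
have [sg H] := fibre_separation.
have [s0|s0] := eqVneq sg 0.
  have [g [pg gz Hg]] := sep_cantor.
  apply: (H g) => // u du; rewrite s0 => hu; apply: Hg.
  by have [[? ?]|[_ [_]]] := level_cases du hu; [split|rewrite ltxx].
have [l Hl] : exists l : seq R, forall u : R, dom u -> level u = sg -> u \in l.
  have [sp|sn] := ltP 0 sg.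
    have [l Hl] := height_level sp; exists l => u du hu.
    by have [[u01 hu']|[_ [_]]] := level_cases du hu; [exact: Hl|lra].
  exists [:: 1 - sg] => u du hu; rewrite inE.
  have [[u01 hu']|[_ [-> _]]] := level_cases du hu; last by rewrite eqxx.
  have := height_bounds u; rewrite hu' => /andP[h _].
  by move: s0; rewrite eq_le sn h.
have [g [pg gz Hg]] := sep_list l.
by apply: (H g) => // u du hu; rewrite Hg ?Hl // cn0; lra.
Qed.

End CurveHull.

(** * The arcs *)

Section Topology.
Variable R : realType.
Implicit Types (x y : R[i]).

(** Links the topology of R[i], defined by its own R[i]-valued norm, to
estimates with the real-valued modulus. *)
Lemma nbhs_cnP x (A : set R[i]) :
  nbhs x A <-> exists2 d : R, 0 < d & forall y, cn (x - y) < d -> A y.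
Proof.
split.
  move=> /nbhs_ballP[d /= d0 H].
  have dE : d = (Re d)%:C.
    by apply: Cext => //=; move: d0; rewrite ltcE => /andP[/eqP].
  exists (Re d); first by move: d0; rewrite ltcE => /andP[].
  move=> y h; apply: H; rewrite /ball /= dE.
  by rewrite (_ : `|x - y| = (cn (x - y))%:C) ?ltcR.
move=> [d d0 H]; apply/nbhs_ballP; exists d%:C; first by rewrite /= ltcR.
move=> y; rewrite /ball /= => h; apply: H; move: h.
by rewrite (_ : `|x - y| = (cn (x - y))%:C) ?ltcR.
Qed.

Lemma nbhs_rowP (N : nat) (z : 'rV[R[i]]_N) (A : set 'rV[R[i]]_N) : 
  (exists2 d : R, 0 < d & forall w : 'rV[R[i]]_N, (forall i, cn (z ord0 i - w ord0 i) < d) -> A w) ->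
  nbhs z A.
Proof.
move=> [d d0 H]; exists (fun i j => [set y | cn (z i j - y) < d]).
  by move=> i j; apply/nbhs_cnP; exists d.
by move=> w Hw; apply: H => i; exact: Hw.
Qed.

Lemma curve_continuous (N : nat) (G : R -> 'rV[R[i]]_N) :
  (forall i, ccont (fun u => G u ord0 i)) -> continuous G.
Proof.
move=> cG t A [P HP HA].
suff : \forall s \near t, forall i j, P i j (G s i j).
  by apply: filterS => s Hs; apply: HA.
apply: (@filter_forall R _ (fun i s => forall j, P i j (G s i j)) (nbhs t) (nbhs_filter t)) => i.
apply: (@filter_forall R _ (fun j s => P i j (G s i j)) (nbhs t) (nbhs_filter t)) => j.
have := HP i j; rewrite (ord1 i) => /nbhs_cnP[d d0 H].
have [r r0 Hr] := cG j t d d0.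
apply/nbhs_ballP; exists r => //= s; rewrite /ball /= distrC => h.
by apply: H; rewrite cnB; exact: Hr.
Qed.

Definition seg (a b : R) : set R := [set u | a <= u <= b].

Lemma segE (a b : R) : seg a b = [set` `[a, b]].
Proof. by apply/seteqP; split => u; rewrite /seg /= in_itv. Qed.

Lemma compact_curve (N : nat) (G : R -> 'rV[R[i]]_N) (a b : R) :
  (forall i, ccont (fun u => G u ord0 i)) -> compact (G @` seg a b).
Proof.
move=> cG; rewrite segE; apply: continuous_compact; last exact: segment_compact.
exact: continuous_subspaceT (curve_continuous cG).
Qed.

(** The inverse is continuous by compactness, in the form of separate_level: a
small distance to z forces the parameter to be close to that of z. *)
Lemma injective_curve_arc (G : R -> 'rV[R[i]]_3) (a b : R) : a < b ->
  (forall i, ccont (fun u => G u ord0 i)) ->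
  (forall s t, a <= s <= b -> a <= t <= b -> G s = G t -> s = t) ->
  is_arc (G @` seg a b).
Proof.
move=> ab cG inj.
pose par t := (b - a) * t + a.
have cpar : rcont par by exact: rcont_affine.
have ba : 0 < b - a by lra.
have par_in t : 0 <= t <= 1 -> a <= par t <= b.
  move=> /andP[t0 t1]; rewrite /par.
  have p1 : 0 <= (b - a) * t by rewrite mulr_ge0 // ltW.
  have p2 : (b - a) * t <= (b - a) * 1 by rewrite ler_wpM2l // ltW.
  lra.
pose f t := G (par t).
have cf i : ccont (fun t => f t ord0 i).
  exact: (@ccont_comp R (fun u => G u ord0 i) par (cG i) cpar).
have finj s t : 0 <= s <= 1 -> 0 <= t <= 1 -> f s = f t -> s = t.
  move=> s01 t01 E; have := inj _ _ (par_in s s01) (par_in t t01) E.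
  by rewrite /par => /addIr /mulfI; apply; rewrite gt_eqF.
pose g z := xget 0 [set t | 0 <= t <= 1 /\ f t = z].
have fK t : 0 <= t <= 1 -> g (f t) = t.
  move=> t01; rewrite /g; case: xgetP => [s _ [s01 E]|/(_ t)]; first exact: finj.
  by case; split.
have X z : (G @` seg a b) z -> exists2 t, 0 <= t <= 1 & f t = z.
  move=> [u /andP[ua ub] <-]; exists ((u - a) / (b - a)).
    apply/andP; split; first by rewrite divr_ge0; lra.
    by rewrite ler_pdivrMr // mul1r; lra.
  by rewrite /f /par mulrC divfK ?gt_eqF // subrK.
exists f, g; split.
- exact: continuous_subspaceT (curve_continuous cf).
- apply/subspace_continuousP => z /X[t t01 tz].
  apply/cvgrPdist_lt => eps e0.
  pose F s := cn (f s ord0 (@Ordinal 3 0 isT) - z ord0 (@Ordinal 3 0 isT)) +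
    (cn (f s ord0 (@Ordinal 3 1 isT) - z ord0 (@Ordinal 3 1 isT)) +
     cn (f s ord0 (@Ordinal 3 2 isT) - z ord0 (@Ordinal 3 2 isT))).
  have cc i : rcont (fun s => cn (f s ord0 i - z ord0 i)).
    by apply/rcont_cn/ccontB; [exact: cf|exact: ccont_cst].
  have cF : rcont F by apply: rcontD => //; apply: rcontD.
  have F0 s : F s = 0 -> f s = z.
    move=> E; apply/rowP => -[[|[|[|]]] hi] //; rewrite (bool_irrelevance hi isT);
    apply/eqP; rewrite -subr_eq0 -cn_eq0 eq_le cn_ge0 andbT; move: E; rewrite /F;
    have := cn_ge0 (f s ord0 (@Ordinal 3 0 isT) - z ord0 (@Ordinal 3 0 isT));
    have := cn_ge0 (f s ord0 (@Ordinal 3 1 isT) - z ord0 (@Ordinal 3 1 isT));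
    have := cn_ge0 (f s ord0 (@Ordinal 3 2 isT) - z ord0 (@Ordinal 3 2 isT)); lra.
  have [||d d0 Hd] := @separate_level R F (fun s => eps - `|s - t|) 0 1 ler01 cF.
  - apply: rcontD; first exact: rcont_cst.
    apply: (@rcont_lip _ _ 1) => s s'; rewrite mul1r.
    have := ler_normB (s - t) (s' - t); have := ler_dist_dist (s' - t) (s - t).
    by rewrite (_ : s' - t - (s - t) = s' - s) ?[`|s - s'|]distrC; [rewrite opprK addrC|ring].
  - move=> s s01 /F0 E; rewrite (finj s t s01 t01) ?subrr ?normr0 ?subr0 //.
    by rewrite E tz.
  apply: nbhs_rowP; exists (d / 3); first by lra.
  move=> w Hw /X[s s01 sw].
  change (`|g z - g w| < eps); rewrite -sw -tz !fK // distrC.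
  have := Hd s s01; rewrite subr_gt0; apply.
  have := Hw (@Ordinal 3 0 isT); have := Hw (@Ordinal 3 1 isT); have := Hw (@Ordinal 3 2 isT).
  rewrite ger0_norm /F ?addr_ge0 ?cn_ge0 // sw !(cnB (z ord0 _)); lra.
- move=> t; rewrite /= in_itv => t01; exists (par t) => //; exact: par_in.
- move=> z /X[t t01 <-]; rewrite fK //= in_itv //.
- split.
    by move=> t; rewrite inE /= in_itv => t01; exact: fK.
  by move=> z; rewrite inE => /X[t t01 <-]; rewrite fK.
Qed.

End Topology.

Section Assembly.
Variable R : realType.
Implicit Types (u t : R).

Lemma outer_inj u t : outer u = outer t -> zarc u = zarc t.
Proof.
move=> E; apply/eqP; rewrite -subr_eq0 -cn_eq0 eq_le cn_ge0 andbT.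
have h1 : cn (zarc u) <= 5 by have := cn_zarc u; lra.
have h2 : cn (zarc t) <= 5 by have := cn_zarc t; lra.
have := far_conformal h1 h2; rewrite -/(outer u) -/(outer t) E mulNr subrr add0r.
by have := cn_ge0 (zarc u - zarc t); lra.
Qed.

Lemma param_link u : 1 <= u <= 2 -> zarc u = zarc 1 /\ level u = 1 - u.
Proof.
move=> u12; have u1 : 1 <= u by lra.
rewrite -(zarc_clamp u) clamp_ge1 //; split => //.
by rewrite /level -height_clamp clamp_ge1 // height_at1 clamp_id; lra.
Qed.

(** On [0, 1] the path zarc is injective; on the link it is constant and the
level function takes over. *)
Lemma param_inj u t : dom u -> dom t -> zarc u = zarc t -> level u = level t -> u = t.
Proof.
rewrite /dom => du dt E H.
have z11 : 0 <= (1 : R) <= 1 by rewrite lexx ler01.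
have [u1|u1] := lerP u 1; have [t1|t1] := lerP t 1.
- by apply: zarc_inj => //; lra.
- have [E' H'] := @param_link t ltac:(lra).
  have u1' : u = 1 by apply: zarc_inj => //; [lra|rewrite E].
  by move: H; rewrite H' u1' level_main // height_at1; lra.
- have [E' H'] := @param_link u ltac:(lra).
  have t1' : t = 1 by apply: zarc_inj => //; [lra|rewrite -E].
  by move: H; rewrite H' t1' level_main // height_at1; lra.
- have [_ Hu] := @param_link u ltac:(lra); have [_ Ht] := @param_link t ltac:(lra).
  by move: H; rewrite Hu Ht; lra.
Qed.

Lemma curveA_inj u t : dom u -> dom t -> curveA u = curveA t -> u = t.
Proof.
move=> du dt /vec3_inj[E1 _]; rewrite E1 (outer_inj E1) => /addrI /realC_inj H.
by apply: param_inj => //; exact: outer_inj.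
Qed.

Lemma curveB_inj u t : dom u -> dom t -> curveB u = curveB t -> u = t.
Proof.
move=> du dt /vec3_inj[/oppr_inj E2 /oppr_inj E1].
rewrite E2 (outer_inj E1) => /addrI /oppr_inj /realC_inj H.
by apply: param_inj => //; exact: outer_inj.
Qed.

Lemma outer_inv u : cn ((zarc u - shift2 R) * outer u - 1) <= 1 / 48.
Proof. by apply: far_inv; have := zarc_far u; lra. Qed.

Lemma cn_zarcT u : 98 <= cn (zarc u - shift1 R).
Proof. by rewrite cnB; have := lerB_cnB (shift1 R) (zarc u); rewrite cn_shift1; have := cn_zarc u; lra. Qed.

Lemma outer_neq0 u : outer u != 0.
Proof.
apply/eqP => E; have := outer_inv u; rewrite E mulr0 sub0r cnN cn1; lra.
Qed.

Lemma mu_spec : mu R * (zarc 1 - shift1 R) * outer1 R = 1.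
Proof.
rewrite /mu -mulrA mulVf // mulf_neq0 ?outer_neq0 //.
by rewrite -cn_gt0; have := cn_zarcT 1; lra.
Qed.

(** As outer is close to 1 / (zarc - 2T), the product outer u (zarc u + zarc t -
2T) is close to 1, and by its normalization mu is close to 2. *)
Lemma ratio_near2 u t : cn (mu R * outer u * (zarc u + zarc t - shift2 R) - 2%:R) <= 1 / 5.
Proof.
set x := zarc u - shift2 R; set x1 := zarc 1 - shift2 R.
have x195 : 195 <= cn x by exact: zarc_far.
have x195' : 195 <= cn x1 by exact: zarc_far.
have x0 : x != 0 by rewrite -cn_gt0; lra.
have x10 : x1 != 0 by rewrite -cn_gt0; lra.
set dl := x * outer u - 1; set dl1 := x1 * outer1 R - 1.
have hd : cn dl <= 1 / 48 by exact: outer_inv.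
have hd1 : cn dl1 <= 1 / 48 by exact: outer_inv.
set al := zarc t / x; set be := zarc 1 / x1.
have ha : cn al <= 1 / 97.
  by rewrite /al cn_div ler_pdivrMr; have := cn_zarc t; lra.
have hb : cn be <= 1 / 97.
  by rewrite /be cn_div ler_pdivrMr; have := cn_zarc (1 : R); lra.
pose P := (1 + dl) * (1 + al); pose Q := (1 + dl1) * (1 + be).
have near (p q : R[i]) : cn p <= 1 / 48 -> cn q <= 1 / 97 -> cn ((1 + p) * (1 + q) - 1) <= 32 / 1000.
  move=> hp hq; rewrite (_ : _ - 1 = p + q + p * q); last by ring.
  have := ler_cnD (p + q) (p * q); have := ler_cnD p q; rewrite cnM.
  by have := ler_pM (cn_ge0 _) (cn_ge0 _) hp hq; lra.
have nP : cn (P - 1) <= 32 / 1000 by exact: near.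
have nQ : cn (Q - 1) <= 32 / 1000 by exact: near.
have Qb : 968 / 1000 <= cn Q.
  by have := cn_tri Q 1 0; rewrite !subr0 cn1 (cnB 1); lra.
have Q0 : Q != 0 by rewrite -cn_gt0; lra.
have num : outer u * (zarc u + zarc t - shift2 R) = P.
  rewrite /P /dl /al (_ : 1 + (x * outer u - 1) = x * outer u); last by ring.
  rewrite (_ : zarc u + zarc t - shift2 R = x + zarc t); last by rewrite /x; ring.
  by field.
have den : (zarc 1 - shift1 R) * outer1 R * 2%:R = Q.
  rewrite /Q /dl1 /be (_ : 1 + (x1 * outer1 R - 1) = x1 * outer1 R); last by ring.
  rewrite (_ : 1 + zarc 1 / x1 = 2%:R * (zarc 1 - shift1 R) / x1); last first.
    apply: (mulIf x10); rewrite divfK // mulrDl divfK // mul1r /x1 shift2E; ring.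
  by field.
have -> : mu R * outer u * (zarc u + zarc t - shift2 R) = 2%:R * (P / Q).
  have -> : mu R = 2%:R / Q by apply: (mulIf Q0); rewrite divfK // -den !mulrA mu_spec mul1r.
  by rewrite -mulrA num; field.
rewrite (_ : _ - 2%:R = 2%:R * ((P - Q) / Q)); last by field.
rewrite cnM cn_div (_ : cn 2%:R = 2); last first.
  by rewrite -(rmorph_nat (real_complex R)) cn_pos.
have PQ : cn (P - Q) <= 64 / 1000.
  by have := cn_tri 1 P Q; rewrite (cnB 1); lra.
have : cn (P - Q) / cn Q <= 1 / 10 by rewrite ler_pdivrMr; lra.
lra.
Qed.

(** A common point of the curves forces level u + level t = - mu outer u (zarc u
+ zarc t - 2T), which is close to -2.  As level is nonnegative on [0, 1] and at
least -1 on the link, both points are on the links, where the right-hand side is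
exactly -2. *)
Lemma curves_disjoint u t : dom u -> dom t -> curveA u = curveB t -> u = 2 /\ t = 2.
Proof.
rewrite /dom => du dt /vec3_inj[E1 E2 E3].
have S : (level u + level t)%:C = - (mu R * outer u * (zarc u + zarc t - shift2 R)).
  have gE : inner t = - outer u by rewrite E1 opprK.
  rewrite rmorphD /= -[(level u)%:C](addKr (mu R * (zarc u - shift1 R) * outer u)) E3 gE shift2E.
  ring.
have hE : level u + level t = - Re (mu R * outer u * (zarc u + zarc t - shift2 R)) by rewrite -ReN -S.
have := Re_cn (mu R * outer u * (zarc u + zarc t - shift2 R) - 2%:R).
have := ratio_near2 u t => h1 h2; have := le_trans h2 h1.
rewrite ReD ReN /= => h3.
have main (s : R) : 0 <= s <= 1 -> 0 <= level s.
  by move=> s01; rewrite level_main //; have := height_bounds s; lra.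
have low (s : R) : 0 <= s <= 2 -> -1 <= level s.
  move=> ds; have [s1|s1] := lerP s 1; first by have := main s; lra.
  by have [_ ->] := @param_link s ltac:(lra); lra.
have sum : level u + level t <= - (9 / 5).
  move: h3; rewrite ler_norml hE => /andP[]; lra.
have u1 : 1 < u.
  by rewrite ltNge; apply/negP => u1; have := main u; have := low t; lra.
have t1 : 1 < t.
  by rewrite ltNge; apply/negP => t1; have := main t; have := low u; lra.
have [eu hu] := @param_link u ltac:(lra); have [et ht] := @param_link t ltac:(lra).
have : level u + level t = - 2.
  have xu : outer u = outer1 R by rewrite /outer eu.
  apply: realC_inj; rewrite S xu eu et shift2E rmorphN /= rmorph_nat; congr (- _).
  by transitivity (2%:R * (mu R * (zarc 1 - shift1 R) * outer1 R)); [ring|rewrite mu_spec mulr1].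
rewrite hu ht => h4; split; lra.
Qed.

Lemma curves_junction : curveA (2 : R) = curveB 2.
Proof.
have [e2 h2] := @param_link 2 ltac:(lra).
have x2 : outer 2 = outer1 R by rewrite /outer e2.
have g2 : inner 2 = - outer1 R.
  rewrite /inner (_ : 2 - 1 = 1); last by ring.
  rewrite clamp_id ?lexx ?ler01 // mul1r -(bval_clamp 2) clamp_ge1 ?ler1n //.
  by rewrite addrC subrK.
rewrite /curveA /curveB x2 g2 e2 h2 opprK; congr vec3.
rewrite mulrN mu_spec (_ : 1 - 2 = -1); last by ring.
by rewrite rmorphN rmorph1 /= opprK subrr addNr.
Qed.

(** The coordinates f(-T) and f(T) of the point are near 1/T in modulus, whereas
outer, up to sign one of these coordinates on either curve, is near 1/(2T). *)
Lemma hull_pt_notin u : hull_pt R <> curveA u /\ hull_pt R <> curveB u.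
Proof.
have T98 : 98 <= cn (shift1 R) by rewrite cn_shift1; lra.
have T98' : 98 <= cn (- shift1 R) by rewrite cnN.
have fT := far_inv T98; have fT' := far_inv T98'; have xi := outer_inv u.
have big := cn_zarcT u.
have key (w : R[i]) : cn (shift1 R * w - 1) <= 1 / 48 -> cn ((zarc u - shift1 R) * w) <= 1 / 24 -> False.
  rewrite !cnM => h1 h2.
  have : 1 - cn (shift1 R) * cn w <= 1 / 48.
    apply: le_trans h1; rewrite -cnM; have := cn_tri (shift1 R * w) 1 0.
    by rewrite !subr0 cn1 (cnB 1); lra.
  have : 98 * cn w <= cn (zarc u - shift1 R) * cn w by rewrite ler_wpM2r ?cn_ge0.
  rewrite cn_shift1; lra.
split=> /vec3_inj[E1 E2 _].
  apply: (key (- outer u)); first by rewrite -E1 mulrN -mulNr.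
  rewrite (_ : _ * _ = (- shift1 R * outer u - 1) - ((zarc u - shift2 R) * outer u - 1)); last by rewrite shift2E; ring.
  by rewrite -{1}E1; have := ler_cnB (- shift1 R * far (- shift1 R) - 1) ((zarc u - shift2 R) * outer u - 1); lra.
apply: (key (- outer u)); first by rewrite -E2.
rewrite (_ : _ * _ = (shift1 R * - outer u - 1) - ((zarc u - shift2 R) * outer u - 1)); last by rewrite shift2E; ring.
by rewrite -{1}E2; have := ler_cnB (shift1 R * far (shift1 R) - 1) ((zarc u - shift2 R) * outer u - 1); lra.
Qed.

(** The outer coordinate gives zarc by ulim_inverse, and then the third
coordinate gives the level function. *)
Lemma curveA_ulim : ulim (@curveA R) (@dom R) (@zarc R) /\ ulim (@curveA R) (@dom R) (fun u => (level u)%:C).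
Proof.
have B := curve_bdd (@curveA_cont R).
have C0 := ulim_coord (@curveA R) (@dom R) (@Ordinal 3 0 isT).
have C2 := ulim_coord (@curveA R) (@dom R) (@Ordinal 3 2 isT).
have Ue : ulim (@curveA R) (@dom R) (@zarc R).
  apply: ulim_inverse => //; first by move=> u _; exact: cn_zarc.
  by apply: ulim_ext C0 => u _; rewrite mxE.
split => //.
have UC c := @ulim_cst R 3 R (@curveA R) (@dom R) c.
apply: ulim_ext (ulimB B C2 (ulimM B (ulimM B (UC (mu R)) (ulimB B Ue (UC (shift1 R)))) C0)) => u _.
by rewrite !mxE /= addrC addKr.
Qed.

Lemma curveB_ulim : ulim (@curveB R) (@dom R) (@zarc R) /\ ulim (@curveB R) (@dom R) (fun u => (level u)%:C).
Proof.
have B := curve_bdd (@curveB_cont R).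
have C0 := ulim_coord (@curveB R) (@dom R) (@Ordinal 3 0 isT).
have C1 := ulim_coord (@curveB R) (@dom R) (@Ordinal 3 1 isT).
have C2 := ulim_coord (@curveB R) (@dom R) (@Ordinal 3 2 isT).
have Ue : ulim (@curveB R) (@dom R) (@zarc R).
  apply: ulim_inverse => //; first by move=> u _; exact: cn_zarc.
  by apply: ulim_ext (ulimN B C1) => u _; rewrite mxE /= opprK.
split => //.
have UC c := @ulim_cst R 3 R (@curveB R) (@dom R) c.
apply: ulim_ext (ulimN B (ulimD C2 (ulimM B (ulimM B (UC (mu R)) (ulimB B Ue (UC (shift1 R)))) C0))) => u _.
rewrite !mxE /=; ring.
Qed.

Lemma curve_polynomially_convex (G : R -> 'rV[R[i]]_3) :
  (forall i, ccont (fun u => G u ord0 i)) ->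
  ulim G (@dom R) (@zarc R) -> ulim G (@dom R) (fun u => (level u)%:C) ->
  polynomially_convex (G @` seg 0 2).
Proof.
move=> Gc He Hh; split; first exact: compact_curve.
apply/seteqP; split => z; last first.
  move=> Gz p; have pp : polyfun (fun w => poly_eval p w) by exists p.
  have [M M0 HM] := dom_bdd (polyfun_ccont Gc pp).
  apply: ub_le_sup; last by exists z.
  by exists M => _ [_ [u du <-] <-]; exact: HM.
move=> hz; apply: contrapT => nz; apply: (@curve_not_in_hull R G Gc He Hh z).
  by move=> u du E; apply: nz; exists u.
move=> f B [p pf] HB; rewrite -pf; apply: le_trans (hz p) _.
apply: ge_sup; first by exists (ComplexField.Normc.normc (poly_eval p (G 0))), (G 0) => //; exists 0 => //; rewrite /seg /= lexx ler0n.
by move=> _ [_ [u du <-] <-]; rewrite pf; exact: HB.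
Qed.

End Assembly.

Theorem corollary3p6 (R : realType) :
  exists X : set 'rV[R[i]]_3,
    [/\ is_arc X,
        nontrivial_rational_hull X
      & exists A B : set 'rV[R[i]]_3,
          [/\ is_arc A, polynomially_convex A,
              is_arc B, polynomially_convex B
            & X = A `|` B]].
Proof.
pose A := @curveA R @` seg 0 2; pose B := @curveB R @` seg 0 2.
have arcA : is_arc A.
  apply: injective_curve_arc; [by []|exact: curveA_cont|exact: curveA_inj].
have arcB : is_arc B.
  apply: injective_curve_arc; [by []|exact: curveB_cont|exact: curveB_inj].
have [uA1 uA2] := curveA_ulim R; have [uB1 uB2] := curveB_ulim R.
have pcA : polynomially_convex A by apply: curve_polynomially_convex => //; exact: curveA_cont.
have pcB : polynomially_convex B by apply: curve_polynomially_convex => //; exact: curveB_cont.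
exists (A `|` B); split; last by exists A, B.
  (* The first curve followed by the second one backwards; truncating both makes
     the concatenation a sum, and its continuity immediate. *)
  pose G (u : R) := curveA (Num.min u 2) + curveB (4 - Num.max u 2) - curveA 2.
  have GA u : u <= 2 -> G u = curveA u.
    move=> u2; rewrite /G min_l // max_r // (_ : 4 - 2 = 2); last by ring.
    by rewrite -curves_junction addrK.
  have GB u : 2 <= u -> G u = curveB (4 - u).
    by move=> u2; rewrite /G min_r // max_l // addrAC subrr add0r.
  have GE : A `|` B = G @` seg 0 4.
    apply/seteqP; split => z.
      move=> [[u /andP[u0 u2] <-]|[u /andP[u0 u2] <-]].
        by exists u; [rewrite /seg /=; lra|exact: GA].
      exists (4 - u); first by rewrite /seg /=; lra.
      by rewrite GB; [congr curveB; ring|lra].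
    move=> [u /andP[u0 u4] <-]; have [u2|u2] := lerP u 2.
      by left; exists u; [rewrite /seg /=; lra|rewrite GA].
    by right; exists (4 - u); [rewrite /seg /=; lra|rewrite GB // ltW].
  rewrite GE; apply: injective_curve_arc; first by [].
    move=> i.
    have cm : rcont (fun u : R => Num.min u 2) by apply: rcont_min; [exact: rcont_id|exact: rcont_cst].
    have cM : rcont (fun u : R => 4 - Num.max u 2).
      have := rcont_comp (rcont_affine (-1) 4) (rcont_max (@rcont_id R) (@rcont_cst R 2)).
      by congr rcont; apply/funext => u; rewrite /= mulN1r addrC.
    apply: (@ccont_ext R (fun u => curveA (Num.min u 2) ord0 i + curveB (4 - Num.max u 2) ord0 i
      - curveA 2 ord0 i)); first by move=> u; rewrite !mxE.
    apply: ccontB; last exact: ccont_cst.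
    apply: ccontD.
      exact: (@ccont_comp R (fun u => curveA u ord0 i) _ (curveA_cont i) cm).
    exact: (@ccont_comp R (fun u => curveB u ord0 i) _ (curveB_cont i) cM).
  move=> s t s04 t04.
  have [s2|s2] := lerP s 2; have [t2|t2] := lerP t 2.
  - by rewrite !GA //; apply: curveA_inj; rewrite /dom; lra.
  - rewrite GA // (GB t); last exact: ltW.
    move=> /curves_disjoint[]; rewrite /dom; [lra|lra|].
    by move=> -> h; lra.
  - rewrite (GA t) // GB; last exact: ltW.
    move=> /esym /curves_disjoint[]; rewrite /dom; [lra|lra|].
    by move=> -> h; lra.
  - rewrite !GB; [|exact: ltW|exact: ltW].
    by move=> /curveB_inj; rewrite /dom => h; have := h ltac:(lra) ltac:(lra); lra.
exists (hull_pt R); split.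
  move=> p; have [u u01 E] := @hull_point R (fun w => poly_eval p w) (ex_intro _ p (fun=> erefl)).
  have u02 : seg 0 2 u by rewrite /seg /=; lra.
  case: E => E; [exists (curveA u)|exists (curveB u)] => //; [left|right]; by exists u.
by move=> [[u _ E]|[u _ E]]; have [h1 h2] := hull_pt_notin u; [apply: h1|apply: h2].
Qed.
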